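(* Let $N=2$, and let $\mathcal{R}=\{\rho:\mathbb{R}^3\to\mathbb{R}\ :\ \rho\ge0,\ \sqrt\rho\in H^1(\mathbb{R}^3),\ \int_{\mathbb{R}^3}\rho\,dx=2\}$. Then $$\lim_{\hbar\to0}F_{HK}^{\hbar}[\rho]=E_{OT}[\rho]\qquad\text{for every }\rho\in\mathcal{R},$$ where $F_{HK}^\hbar$ is the Hohenberg–Kohn functional with kinetic energy functional $T_\hbar$, and $E_{OT}$ is the optimal transportation functional with Coulomb cost.
   Context: Let $\mathcal{A}$ be the set of $\Psi\in L^2((\mathbb{R}^3\times\mathbb{Z}_2)^2;\mathbb{C})$ with $\nabla\Psi\in L^2$ (gradient in the position variables), $\|\Psi\|_{L^2}=1$ and $\Psi(z_2,z_1)=-\Psi(z_1,z_2)$, where $z_i=(x_i,s_i)\in\mathbb{R}^3\times\mathbb{Z}_2$ and $\int dz_i=\sum_{s_i\in\mathbb{Z}_2}\int_{\mathbb{R}^3}dx_i$. For $\Psi\in\mathcal{A}$ the pair density is $\rho_2^\Psi(x,y)=\sum_{s,t\in\mathbb{Z}_2}|\Psi(x,s,y,t)|^2$ and the single-particle density is $\rho^\Psi(x)=2\int_{\mathbb{R}^3}\rho_2^\Psi(x,y)\,dy$. The set $\mathcal{R}$ equals the image of $\mathcal{A}$ under $\Psi\mapsto\rho^\Psi$ (a result of Lieb). With a fixed mass $m>0$ and $\hbar>0$, $$T_\hbar[\Psi]=\frac{\hbar^2}{2m}\int\int\sum_{i=1}^2|\nabla_{x_i}\Psi|^2\,dz_1dz_2,\qquad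 V_{ee}[\rho_2]=\int_{\mathbb{R}^6}\frac{\rho_2(x,y)}{|x-y|}\,dx\,dy,$$ $$F_{HK}^\hbar[\rho]=\inf\{T_\hbar[\Psi]+V_{ee}[\rho_2^\Psi]\ :\ \Psi\in\mathcal{A},\ \rho^\Psi=\rho\}.$$ $E_{OT}[\rho]=\inf\int_{\mathbb{R}^6}\frac1{|x-y|}\,d\rho_2(x,y)$, the infimum being over nonnegative Radon measures $\rho_2$ on $\mathbb{R}^6$ both of whose marginals on $\mathbb{R}^3$ equal $\frac12\rho(x)\,dx$. *)

(* Defs.v *)
From HB Require Import structures.
From mathcomp Require Import all_boot all_order all_algebra.
From mathcomp Require Import all_classical all_reals all_analysis.
From mathcomp Require Import complex.

Set Implicit Arguments.
Unset Strict Implicit.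
Unset Printing Implicit Defensive.

Import Order.TTheory GRing.Theory Num.Theory.
Import numFieldNormedType.Exports.

Local Open Scope classical_set_scope.
Local Open Scope ring_scope.

Notation R3 R := (R * R * R)%type (only parsing).
Notation R6 R := (R3 R * R3 R)%type (only parsing).
(* position and spin of one electron *)
Notation electron R := (R3 R * 'Z_2)%type (only parsing).

Lemma product_measure1_sigma_finite d1 d2 (T1 : measurableType d1)
    (T2 : measurableType d2) (R : realType)
    (m1 : {sigma_finite_measure set T1 -> \bar R})
    (m2 : {sigma_finite_measure set T2 -> \bar R}) :
  sigma_finite setT (m1 \x m2)%E.
Proof.
have /sigma_finiteP[F [TF ndF Foo]] := sigma_finiteT m1.
have /sigma_finiteP[G [TG ndG Goo]] := sigma_finiteT m2.
exists (fun n => F n `*` G n).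
  rewrite -setXTT TF TG predeqE => -[x y]; split.
    move=> [/= [n _ Fnx] [k _ Gky]]; exists (maxn n k) => //; split.
    - by move: x Fnx; exact/subsetPset/ndF/leq_maxl.
    - by move: y Gky; exact/subsetPset/ndG/leq_maxr.
  by move=> [n _ []/= ? ?]; split; exists n.
move=> k; have [? ?] := Foo k; have [? ?] := Goo k.
split; first exact: measurableX.
by rewrite product_measure1E// lte_mul_pinfty// ge0_fin_numE.
Qed.

Section lebesgue.
Context {R : realType}.

(* [lebesgue_measure] lives on the alias [measurableTypeR R]; it is transported
   to [R] itself, so that its products live on [R * R * R], which is both a
   measurable and a normed space. *)
Definition leb1 : set R -> \bar R := @lebesgue_measure R.

Let leb1_0 : leb1 set0 = 0%E.
Proof. exact: (@measure0 _ _ _ (@lebesgue_measure R)). Qed.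
Let leb1_ge0 A : (0 <= leb1 A)%E.
Proof. exact: (@measure_ge0 _ _ _ (@lebesgue_measure R)). Qed.
Let leb1_sigma_additive : semi_sigma_additive leb1.
Proof. exact: (@measure_semi_sigma_additive _ _ _ (@lebesgue_measure R)). Qed.
HB.instance Definition _ :=
  isMeasure.Build _ R R leb1 leb1_0 leb1_ge0 leb1_sigma_additive.
Let leb1_sigma_finite : sigma_finite setT leb1.
Proof. exact: (@sigma_finiteT _ _ _ (@lebesgue_measure R)). Qed.
HB.instance Definition _ :=
  Measure_isSigmaFinite.Build _ R R leb1 leb1_sigma_finite.

Definition leb2 : set (R * R)%type -> \bar R := (leb1 \x leb1)%E.
HB.instance Definition _ := Measure.on leb2.
HB.instance Definition _ := Measure_isSigmaFinite.Build _ _ _ leb2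
  (product_measure1_sigma_finite leb1 leb1).

Definition leb3 : set (R3 R) -> \bar R := (leb2 \x leb1)%E.
HB.instance Definition _ := Measure.on leb3.
HB.instance Definition _ := Measure_isSigmaFinite.Build _ _ _ leb3
  (product_measure1_sigma_finite leb2 leb1).

Definition leb6 : set (R6 R) -> \bar R := (leb3 \x leb3)%E.
HB.instance Definition _ := Measure.on leb6.
HB.instance Definition _ := Measure_isSigmaFinite.Build _ _ _ leb6
  (product_measure1_sigma_finite leb3 leb3).

End lebesgue.

Section weak_derivative.
Context {R : realType} {V : normedModType R}.

Definition iter_derive (vs : seq V) (f : V -> R) : V -> R :=
  foldr (fun v g => 'D_v g) f vs.

Definition smooth (f : V -> R) : Prop :=
  forall vs : seq V, continuous (iter_derive vs f) /\
    forall x v, derivable (iter_derive vs f) x v.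

Definition test_function (phi : V -> R) : Prop :=
  smooth phi /\ compact (closure [set x | phi x != 0]).

(* [I] is the Lebesgue integral of real functions on [V]; it is a parameter
   because the library has no structure joining normed and measurable spaces. *)
Definition weak_derivative (I : (V -> R) -> R) (v : V) (u g : V -> R) : Prop :=
  forall phi, test_function phi ->
    I (fun x => u x * 'D_v phi x) = - I (fun x => g x * phi x).

End weak_derivative.

Section functionals.
Context {R : realType}.
Implicit Types (x y : R3 R) (Psi : electron R -> electron R -> R[i]).
Implicit Types (rho : R3 R -> R) (m hbar : R).

Definition basis3 (j : 'I_3) : R3 R :=
  ((j == 0%N :> nat)%:R, (j == 1%N :> nat)%:R, (j == 2%N :> nat)%:R).

Definition euclidean_norm x : R :=
  Num.sqrt (x.1.1 ^+ 2 + x.1.2 ^+ 2 + x.2 ^+ 2).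

(* the inverse is that of [\bar R]: the cost is [+oo] on the diagonal *)
Definition coulomb x y : \bar R := ((euclidean_norm (x - y))%:E^-1)%E.

Definition inH1 (u : R3 R -> R) : Prop :=
  u \in Lfun leb3 2%:E /\
  forall j, exists2 g, g \in Lfun leb3 2%:E &
    weak_derivative (Rintegral leb3 setT) (basis3 j) u g.

(* The densities are classes of functions modulo equality almost everywhere. *)
Definition densities : set (R3 R -> R) :=
  [set rho : R3 R -> R | [/\ measurable_fun setT rho,
    {ae leb3, forall x, 0 <= rho x},
    inH1 (fun x => Num.sqrt (rho x)) &
    (\int[leb3]_x (rho x)%:E = 2%:E)%E]].

(* direction of the j-th coordinate of the position of the i-th electron *)
Definition position_dir (i : 'I_2) (j : 'I_3) : R6 R :=
  if i == 0 then (basis3 j, 0) else (0, basis3 j).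

Definition weak_partials (v : R6 R) (u : R6 R -> R) : set (R6 R -> R) :=
  [set g | g \in Lfun leb6 2%:E /\
           weak_derivative (Rintegral leb6 setT) v u g].

(* A representative of the weak derivative of u along v, which is unique almost
   everywhere; the junk value 0 is used only if there is none in L^2. *)
Definition weak_partial (v : R6 R) (u : R6 R -> R) : R6 R -> R :=
  xget (cst 0) (weak_partials v u).

Definition spin_component Psi (s t : 'Z_2) : R6 R -> R[i] :=
  fun p => Psi (p.1, s) (p.2, t).

Definition inL2 (f : R6 R -> R[i]) : Prop :=
  (@complex.Re R \o f) \in Lfun leb6 2%:E /\
  (@complex.Im R \o f) \in Lfun leb6 2%:E.

Definition has_L2_gradient (f : R6 R -> R[i]) : Prop :=
  forall i j, weak_partials (position_dir i j) (@complex.Re R \o f) !=set0 /\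
              weak_partials (position_dir i j) (@complex.Im R \o f) !=set0.

Definition partialC (i : 'I_2) (j : 'I_3) (f : R6 R -> R[i]) : R6 R -> R[i] :=
  fun p => Complex (weak_partial (position_dir i j) (@complex.Re R \o f) p)
                   (weak_partial (position_dir i j) (@complex.Im R \o f) p).

Definition sqnorm_gradient (i : 'I_2) (f : R6 R -> R[i]) : R6 R -> R :=
  fun p => \sum_(j < 3) ComplexField.Normc.normc (partialC i j f p) ^+ 2.

Definition L2norm Psi : \bar R :=
  ((\sum_(s : 'Z_2) \sum_(t : 'Z_2) \int[leb6]_p
      (ComplexField.Normc.normc (spin_component Psi s t p) ^+ 2)%:E)
   `^ (2^-1))%E.

Definition fermionic Psi : Prop :=
  forall s t : 'Z_2, {ae leb6, forall p : R6 R,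
    Psi (p.2, t) (p.1, s) = - Psi (p.1, s) (p.2, t)}.

Definition wavefunctions : set (electron R -> electron R -> R[i]) :=
  [set Psi | [/\ forall s t, inL2 (spin_component Psi s t),
    forall s t, has_L2_gradient (spin_component Psi s t),
    L2norm Psi = 1%E & fermionic Psi]].

Definition pair_density Psi x y : R :=
  \sum_(s : 'Z_2) \sum_(t : 'Z_2)
    ComplexField.Normc.normc (Psi (x, s) (y, t)) ^+ 2.

Definition density Psi x : \bar R :=
  (2%:E * \int[leb3]_y (pair_density Psi x y)%:E)%E.

Definition kinetic m hbar Psi : \bar R :=
  ((hbar ^+ 2 / (2 * m))%:E *
   \sum_(s : 'Z_2) \sum_(t : 'Z_2) \int[leb6]_p
     (\sum_(i < 2) sqnorm_gradient i (spin_component Psi s t) p)%:E)%E.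

Definition Vee (rho2 : R3 R -> R3 R -> R) : \bar R :=
  (\int[leb6]_p ((rho2 p.1 p.2)%:E * coulomb p.1 p.2))%E.

Definition F_HK m hbar rho : \bar R :=
  ereal_inf [set (kinetic m hbar Psi + Vee (pair_density Psi))%E | Psi in
    [set Psi | wavefunctions Psi /\
               {ae leb3, forall x, density Psi x = (rho x)%:E}]].

(* On the Euclidean space R^6, a Radon measure is a Borel measure that is finite
   on compact sets. *)
Definition radon (nu : {measure set (R6 R) -> \bar R}) : Prop :=
  forall K : set (R6 R), compact K -> measurable K -> (nu K < +oo)%E.

Definition half_marginals rho (nu : {measure set (R6 R) -> \bar R}) : Prop :=
  forall A : set (R3 R), measurable A ->
    (pushforward nu fst A = \int[leb3]_(x in A) (2^-1 * rho x)%:E /\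
     pushforward nu snd A = \int[leb3]_(x in A) (2^-1 * rho x)%:E)%E.

Definition E_OT rho : \bar R :=
  ereal_inf [set (\int[nu]_p coulomb p.1 p.2)%E | nu in
    [set nu : {measure set (R6 R) -> \bar R} |
       radon nu /\ half_marginals rho nu]].

End functionals.

(* Main.v *)
Require Import Defs.
From HB Require Import structures.
From mathcomp Require Import all_boot all_order all_algebra.
From mathcomp Require Import all_classical all_reals all_analysis.
From mathcomp Require Import complex ring lra unstable measurable_realfun.

Set Implicit Arguments.
Unset Strict Implicit.
Unset Printing Implicit Defensive.

Import Order.TTheory GRing.Theory Num.Theory.
Import numFieldNormedType.Exports.

Local Open Scope classical_set_scope.
Local Open Scope ring_scope.

(** Two inequalities, of very different depth, give the limit.

    Lower bound.  The pair density of an admissible wave function is symmetric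
    almost everywhere, so the measure that it defines has both marginals equal
    to half of the single-particle density: it is a transport plan.  As the
    kinetic energy is nonnegative, the transport cost is a lower bound for the
    Hohenberg-Kohn functional at every value of the Planck constant
    ([E_OT_le_F_HK]).

    Upper bound.  It suffices to find, for a plan gamma of finite cost and for
    eta > 0, one wave function with density exactly rho, with finite kinetic
    energy, and with interaction energy at most the cost of gamma plus eta
    ([near_optimal_wavefunction]): its kinetic energy is proportional to the
    square of the Planck constant and disappears in the limit.  A plan is in
    general singular, and smoothing it by convolution would destroy its
    marginals.  Instead, write w = rho / 2 and take a joint density of the form
      w(x) w(y) b(x, y),   b(x, y) = sum_(k, l) b_kl chi_k(x)^2 chi_l(y)^2,
    where the chi_k are smooth, their squares add up to 1, and they live on
    small cells or far from the origin ([partition_of_unity]).  With m_k the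
    mass of w in the k-th cell and b_kl = a_kl / (m_k m_l), both marginals are
    exactly w as soon as the matrix a has the m_k as row and column sums
    ([density_marginal]).

    The natural matrix a_kl is the mass that gamma gives to the product of the
    cells k and l.  For two small cells at a distance much larger than their
    diameters this hardly changes the Coulomb cost.  The other pairs of cells
    would be expensive, even of infinite cost when k = l.  Their total mass is
    small, because the part of gamma near the diagonal is controlled by its
    cost ([near_diagonal_mass]), and their mass is rerouted: a bad pair (k, l)
    and a pair (k', l') swap partners, which keeps the row and column sums
    ([rerouted]).  Since w has no atoms, and does not even charge planes, most
    pairs (k', l') are such that (k, l') and (k', l) are at least some fixed
    distance apart ([mass_slab]); so the cost of the rerouted mass is small.

    A wave function is a square root of the joint density, and b may vanish.
    However, by the Cauchy-Schwarz inequality the root of a combination of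
    squares with nonnegative coefficients is Lipschitz ([half_derive_sos_bound]);
    replacing b by b + e and letting e tend to 0, sqrt(w(x) w(y) b(x, y)) has
    square integrable weak derivatives ([weak_derivative_root],
    [weak_partials_root]).  Antisymmetry costs nothing thanks to spin: put this
    root f on the component (up, down), minus its transpose on (down, up), and
    0 elsewhere.  The pair density is then the symmetrization of the joint
    density, which has the same marginals and the same Coulomb energy. *)

(** * Smooth functions *)

Section smooth_calculus.
Context {R : realType}.
Implicit Types V W : normedModType R.

(** Finite order version of [smooth]: closure properties of [smooth] mix derivatives
    of different orders, so they are proved by induction on this order. *)
Fixpoint cdiff V (n : nat) (f : V -> R) : Prop :=
  [/\ continuous f, (forall x v, derivable f x v) &
      if n is n'.+1 then forall v, cdiff n' ('D_v f) else True].

Lemma cdiffSP V n (f : V -> R) :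
  cdiff n.+1 f <-> [/\ continuous f, (forall x v, derivable f x v) &
                     forall v, cdiff n ('D_v f)].
Proof. by []. Qed.

Lemma cdiff0P V (f : V -> R) :
  cdiff 0 f <-> continuous f /\ (forall x v, derivable f x v).
Proof. by split=> [[]|[]]. Qed.

Lemma cdiffS V n (f : V -> R) : cdiff n.+1 f -> cdiff n f.
Proof.
elim: n f => [|n IH] f; first by move=> [].
by move=> [cf df Df]; split=> // v; apply: IH; exact: Df.
Qed.

Lemma cdiff_continuous V n (f : V -> R) : cdiff n f -> continuous f.
Proof. by case: n => [|n] []. Qed.

Lemma cdiff_derivable V n (f : V -> R) : cdiff n f ->
  forall x v, derivable f x v.
Proof. by case: n => [|n] []. Qed.

Lemma iter_derive_rcons V vs v (f : V -> R) :
  iter_derive (rcons vs v) f = iter_derive vs ('D_v f).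
Proof. by rewrite /iter_derive foldr_rcons. Qed.

Lemma smoothP V (f : V -> R) : smooth f <-> forall n, cdiff n f.
Proof.
split=> [sf n|cf vs].
  elim: n f sf => [|n IH] f sf; have [cf df] := sf [::]; split=> // v.
  by apply: IH => vs; have := sf (rcons vs v); rewrite iter_derive_rcons.
elim/last_ind: vs f cf => [|vs v IH] f cf; first by have [] := cf 0%N.
by rewrite iter_derive_rcons; apply: IH => n; have [_ _] := cf n.+1; exact.
Qed.

Lemma smooth_continuous V (f : V -> R) : smooth f -> continuous f.
Proof. by move=> /(_ [::])[]. Qed.

Lemma smooth_derivable V (f : V -> R) : smooth f -> forall x v, derivable f x v.
Proof. by move=> /(_ [::])[]. Qed.

Lemma smooth_derive V (f : V -> R) v : smooth f -> smooth ('D_v f).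
Proof. by move=> sf vs; rewrite -iter_derive_rcons; exact: sf. Qed.

Lemma cdiff_cst V n (c : R) : cdiff n (fun _ : V => c).
Proof.
have D v : 'D_v (fun _ : V => c) = (fun _ => 0) :> (V -> R).
  by apply/funext => x; exact: derive_cst.
elim: n c D => [|n IH] c D; split=> //; try exact: cst_continuous.
move=> v; rewrite D; apply: IH => w.
by apply/funext => x; exact: derive_cst.
Qed.

Lemma cdiffD V n (f g : V -> R) : cdiff n f -> cdiff n g ->
  cdiff n (fun x => f x + g x).
Proof.
have C h k : cdiff 0 h -> cdiff 0 k -> cdiff 0 (fun x : V => h x + k x).
  move=> /cdiff0P[ch dh] /cdiff0P[ck dk]; apply/cdiff0P; split.
    by move=> x; apply: cvgD; [exact: ch|exact: ck].
  by move=> x v; have := derivableD (dh x v) (dk x v).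
elim: n f g => [|n IH] f g cf cg; first exact: C.
have /cdiff0P[c0 d0] := C f g
  ((cdiff0P f).2 (conj (cdiff_continuous cf) (cdiff_derivable cf)))
  ((cdiff0P g).2 (conj (cdiff_continuous cg) (cdiff_derivable cg))).
apply/cdiffSP; split=> // v.
have -> : 'D_v (fun x => f x + g x) = (fun x => 'D_v f x + 'D_v g x).
  apply/funext => x.
  rewrite [LHS](_ : _ = 'D_v (f + g) x)// deriveD//; apply: cdiff_derivable; [exact: cf|exact: cg].
move/cdiffSP: cf => [_ _ /(_ v) cf]; move/cdiffSP: cg => [_ _ /(_ v) cg].
exact: IH.
Qed.

Lemma cdiffM V n (f g : V -> R) : cdiff n f -> cdiff n g ->
  cdiff n (fun x => f x * g x).
Proof.
have C h k : cdiff 0 h -> cdiff 0 k -> cdiff 0 (fun x : V => h x * k x).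
  move=> /cdiff0P[ch dh] /cdiff0P[ck dk]; apply/cdiff0P; split.
    by move=> x; apply: cvgM; [exact: ch|exact: ck].
  by move=> x v; have := derivableM (dh x v) (dk x v).
elim: n f g => [|n IH] f g cf cg; first exact: C.
have /cdiff0P[c0 d0] := C f g
  ((cdiff0P f).2 (conj (cdiff_continuous cf) (cdiff_derivable cf)))
  ((cdiff0P g).2 (conj (cdiff_continuous cg) (cdiff_derivable cg))).
apply/cdiffSP; split=> // v.
have -> : 'D_v (fun x => f x * g x) = (fun x => f x * 'D_v g x + g x * 'D_v f x).
  apply/funext => x.
  rewrite [LHS](_ : _ = 'D_v (f * g) x)// deriveM//; apply: cdiff_derivable; [exact: cf|exact: cg].
move: (cf) (cg) => /cdiffS cf' /cdiffS cg'.
move/cdiffSP: cf => [_ _ /(_ v) cf]; move/cdiffSP: cg => [_ _ /(_ v) cg].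
by apply: cdiffD; apply: IH.
Qed.

Lemma cdiffV V n (f : V -> R) : (forall x, f x != 0) -> cdiff n f ->
  cdiff n (fun x => (f x)^-1).
Proof.
move=> f0; elim: n => [|n IH] cf; have [kf df Df] := cf.
  apply/cdiff0P; split=> [x|x v]; last exact: derivableV.
  by apply: cvgV; [exact: f0|exact: kf].
apply/cdiffSP; split=> [x|x v|v]; last 2 first.
- exact: derivableV.
- suff -> : 'D_v (fun x => (f x)^-1) =
      (fun x => (-1) * ((f x)^-1 * (f x)^-1) * 'D_v f x).
    apply: cdiffM; last exact: Df.
    have cV := IH (cdiffS cf).
    by apply: cdiffM; [exact: cdiff_cst|exact: cdiffM].
  by apply/funext => x; rewrite deriveV//= -exprVn expr2 mulN1r.
by apply: cvgV; [exact: f0|exact: kf].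
Qed.

(** Directional derivatives depend only on the restriction to a line, so the
    one-dimensional chain rule suffices. *)
Lemma derive_comp1 V (phi : R -> R) (f : V -> R) x v :
  derivable f x v -> derivable phi (f x) 1 ->
  derivable (fun y => phi (f y)) x v /\
  'D_v (fun y => phi (f y)) x = 'D_1 phi (f x) * 'D_v f x.
Proof.
move=> df dphi.
pose g := fun h : R => f (h *: v + x).
have g0 : g 0 = f x by rewrite /g scale0r add0r.
have dg : derivable g 0 1 by apply/(derivable1P _ _ _).1.
have dpg : derivable (phi \o g) 0 1.
  apply/derivable1_diffP; apply: differentiable_comp; first exact/derivable1_diffP.
  by rewrite g0; exact/derivable1_diffP.
have D1 : derivable (fun y => phi (f y)) x v by apply/derivable1P.
split=> //.
have E (h : V -> R) : 'D_v h x = 'D_1 (fun t : R => h (t *: v + x)) 0.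
  rewrite /derive; set F := (X in lim (X @ _)); set G := (X in _ = lim (X @ _)).
  suff -> : F = G by [].
  by apply/funext => t; rewrite /F /G /= addr0 scale0r add0r [t *: 1]mulr1.
have K := derive1_comp dg (eq_ind_r (fun z => derivable phi z 1) dphi g0).
rewrite !derive1E g0 in K.
by rewrite E [X in _ * X]E; exact: K.
Qed.

Lemma derivable_sqrt (t : R) : 0 < t -> derivable Num.sqrt t 1.
Proof. by move=> t0; case: (is_derive1_sqrt t0). Qed.

Lemma derive_sqrt_comp V (f : V -> R) x v : 0 < f x -> derivable f x v ->
  'D_v (fun y => Num.sqrt (f y)) x = 'D_v f x / (2 * Num.sqrt (f x)).
Proof.
move=> f0 df; have [_ ->] := derive_comp1 df (derivable_sqrt f0).
by rewrite derive_sqrt// mulrC.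
Qed.

Lemma cdiff_sqrt V n (f : V -> R) : (forall x, 0 < f x) -> cdiff n f ->
  cdiff n (fun x => Num.sqrt (f x)).
Proof.
move=> f0.
have C : continuous f -> continuous (fun x => Num.sqrt (f x)).
  move=> kf x; apply: continuous_comp; [exact: kf|exact: sqrt_continuous].
have D x v : derivable f x v -> derivable (fun x => Num.sqrt (f x)) x v.
  by move=> df; have [] := derive_comp1 df (derivable_sqrt (f0 x)).
elim: n => [|n IH] cf.
  move/cdiff0P: cf => [kf df]; apply/cdiff0P; split; first exact: C.
  by move=> x v; exact: D.
have /cdiffSP[kf df Df] := cf; apply/cdiffSP; split; first exact: C.
  by move=> x v; exact: D.
move=> v.
have -> : 'D_v (fun x => Num.sqrt (f x)) =
    (fun x => (2^-1 * (Num.sqrt (f x))^-1) * 'D_v f x).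
  by apply/funext => x; rewrite derive_sqrt_comp// mulrC invfM.
apply: cdiffM; last exact: Df.
apply: cdiffM; first exact: cdiff_cst.
apply: cdiffV; last exact: IH (cdiffS cf).
by move=> x; rewrite gt_eqF// sqrtr_gt0.
Qed.

(** The hypothesis says that [i] is affine with linear part [l]; it is used for
    slices, for the exchange of the two electrons and for changes of scale. *)
Lemma derive_affine V W (i : V -> W) (l : V -> W) (f : W -> R) x v :
  (forall (h : R) v x, i (h *: v + x) = h *: l v + i x) ->
  'D_v (fun y => f (i y)) x = 'D_(l v) f (i x).
Proof.
move=> il; rewrite /derive; set F := fun h : R => _; set G := fun h : R => _.
suff -> : F = G by [].
by apply/funext => t; rewrite /F /G /= il.
Qed.

Lemma derivable_affine V W (i : V -> W) (l : V -> W) (f : W -> R) x v :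
  (forall (h : R) v x, i (h *: v + x) = h *: l v + i x) ->
  derivable f (i x) (l v) -> derivable (fun y => f (i y)) x v.
Proof.
move=> il; rewrite /derivable; set F := fun h : R => _; set G := fun h : R => _.
suff -> : F = G by [].
by apply/funext => t; rewrite /F /G /= il.
Qed.

Lemma cdiff_affine V W (i : V -> W) (l : V -> W) n (f : W -> R) :
  continuous i ->
  (forall (h : R) v x, i (h *: v + x) = h *: l v + i x) ->
  cdiff n f -> cdiff n (fun y => f (i y)).
Proof.
move=> ci il; have C (h : W -> R) : continuous h -> continuous (fun y => h (i y)).
  by move=> ch x; apply: continuous_comp; [exact: ci|exact: ch].
elim: n f => [|n IH] f.
  move=> /cdiff0P[cf df]; apply/cdiff0P; split=> [|x v]; first exact: C.
  exact: (derivable_affine il).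
move=> /cdiffSP[cf df Df]; apply/cdiffSP; split=> [|x v|v]; first exact: C.
  exact: (derivable_affine il).
have -> : 'D_v (fun y => f (i y)) = (fun y => 'D_(l v) f (i y)).
  by apply/funext => x; exact: derive_affine.
exact: (IH ('D_(l v) f) (Df (l v))).
Qed.

Lemma smooth_cst V (c : R) : smooth (fun _ : V => c).
Proof. by apply/smoothP => n; exact: cdiff_cst. Qed.

Lemma smoothD V (f g : V -> R) : smooth f -> smooth g ->
  smooth (fun x => f x + g x).
Proof. by move=> /smoothP sf /smoothP sg; apply/smoothP => n; exact: cdiffD. Qed.

Lemma smoothM V (f g : V -> R) : smooth f -> smooth g ->
  smooth (fun x => f x * g x).
Proof. by move=> /smoothP sf /smoothP sg; apply/smoothP => n; exact: cdiffM. Qed.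

Lemma smoothV V (f : V -> R) : (forall x, f x != 0) -> smooth f ->
  smooth (fun x => (f x)^-1).
Proof. by move=> f0 /smoothP sf; apply/smoothP => n; exact: cdiffV. Qed.

Lemma smooth_sqrt V (f : V -> R) : (forall x, 0 < f x) -> smooth f ->
  smooth (fun x => Num.sqrt (f x)).
Proof. by move=> f0 /smoothP sf; apply/smoothP => n; exact: cdiff_sqrt. Qed.

Lemma smooth_affine V W (i : V -> W) (l : V -> W) (f : W -> R) :
  continuous i ->
  (forall (h : R) v x, i (h *: v + x) = h *: l v + i x) ->
  smooth f -> smooth (fun y => f (i y)).
Proof.
by move=> ci il /smoothP sf; apply/smoothP => n; exact: (cdiff_affine ci il).
Qed.

Lemma smooth_sum V (I : Type) (r : seq I) (P : pred I) (f : I -> V -> R) :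
  (forall i, smooth (f i)) -> smooth (fun x => \sum_(i <- r | P i) f i x).
Proof.
move=> sf; elim: r => [|i r IH].
  by under eq_fun do rewrite big_nil; exact: smooth_cst.
case: (boolP (P i)) => Pi.
  by under eq_fun do rewrite big_cons Pi; exact: smoothD.
by under eq_fun do rewrite big_cons (negbTE Pi).
Qed.

Lemma derive_mulfun V (f g : V -> R) x v : derivable f x v -> derivable g x v ->
  'D_v (fun y => f y * g y) x = f x * 'D_v g x + g x * 'D_v f x.
Proof. exact: deriveM. Qed.

Lemma derive_addfun V (f g : V -> R) x v : derivable f x v -> derivable g x v ->
  'D_v (fun y => f y + g y) x = 'D_v f x + 'D_v g x.
Proof. exact: deriveD. Qed.

Lemma derive_sumfun V (I : Type) (r : seq I) (f : I -> V -> R) x v :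
  (forall i, smooth (f i)) ->
  'D_v (fun y => \sum_(i <- r) f i y) x = \sum_(i <- r) 'D_v (f i) x.
Proof.
move=> sf; elim: r => [|i r IH].
  by rewrite big_nil; under eq_fun do rewrite big_nil; exact: derive_cst.
rewrite big_cons -IH; under eq_fun do rewrite big_cons.
apply: derive_addfun; first exact: (smooth_derivable (sf i)).
exact: (smooth_derivable (smooth_sum r xpredT sf)).
Qed.

Lemma derive_near_cst V (f : V -> R) (c : R) x v :
  (\forall y \near x, f y = c) -> 'D_v f x = 0.
Proof.
move=> fc; have fx : f x = c by exact: nbhs_singleton fc.
rewrite -(derive_cst c x v); apply: near_eq_derive.
exact: fc.
Qed.

End smooth_calculus.

Arguments cdiff_derivable {R V n f} _ _ _.
Arguments smooth_derivable {R V f} _ _ _.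

(** * Smooth partitions of unity by squares *)

Section flat_function.
Context {R : realType}.

Lemma derivable_dir (f : R -> R) x v : derivable f x 1 ->
  derivable f x v /\ 'D_v f x = v * 'D_1 f x.
Proof.
move=> /derivable1_diffP df; split; first exact: diff_derivable.
rewrite !deriveE//.
by rewrite -{1}[v]mulr1 -[v * 1]/(v *: 1) linearZ.
Qed.

(** Powers of 1/t times exp(-1/t), for all powers at once: this family is closed
    under differentiation up to linear combinations, which proves smoothness. *)
Definition flat (k : nat) (t : R) : R :=
  if 0 < t then t^-1 ^+ k * expR (- t^-1) else 0.

Lemma flat_ge0 k t : 0 <= flat k t.
Proof.
rewrite /flat; case: ifPn => // t0.
by rewrite mulr_ge0 ?expR_ge0// exprn_ge0// invr_ge0 ltW.
Qed.

Lemma flat_gt0 k t : 0 < t -> 0 < flat k t.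
Proof. by move=> t0; rewrite /flat t0 mulr_gt0 ?expR_gt0// exprn_gt0// invr_gt0. Qed.

Lemma flat_le0 k t : t <= 0 -> flat k t = 0.
Proof. by rewrite /flat leNgt => /negbTE ->. Qed.

Lemma flatS k t : t^-1 * flat k t = flat k.+1 t.
Proof. by rewrite /flat; case: ifPn => _; rewrite ?mulr0// mulrA exprS. Qed.

(** The exponential exp(1/t) dominates the next power of 1/t, divided by a
    factorial; linear decay at 0 is what the derivative at 0 needs. *)
Lemma flat_bound k t : `|flat k t| <= (k.+1)`!%:R * `|t|.
Proof.
rewrite ger0_norm ?flat_ge0// /flat; case: ifPn => t0; last by rewrite mulr_ge0.
rewrite gtr0_norm//.
have s0 : 0 < t^-1 by rewrite invr_gt0.
have := expR_ge1Dxn k (ltW s0).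
rewrite expRN; set E := expR _ => H.
have E0 : 0 < E by rewrite expR_gt0.
rewrite -ler_pdivrMr// mulrAC -exprSr ler_pdivrMr// mulrC -ler_pdivrMr ?ltr0n ?fact_gt0//.
by apply: le_trans H; rewrite lerDr.
Qed.

Lemma near_gt (t a : R) : a < t -> \forall s \near t, a < s.
Proof. by move=> t0; apply: (@cvgr_gt R R (nbhs t) _ id t); [exact: cvg_id|]. Qed.

Lemma near_lt (t a : R) : t < a -> \forall s \near t, s < a.
Proof. by move=> t0; apply: (@cvgr_lt R R (nbhs t) _ id t); [exact: cvg_id|]. Qed.

Lemma near_flat_gt0 k (t : R) : 0 < t ->
  \forall s \near t, flat k s = s^-1 ^+ k * expR (- s^-1).
Proof. by move=> /near_gt; apply: filterS => s s0; rewrite /flat s0. Qed.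

Lemma is_derive_flat_gt0 k (t : R) : 0 < t ->
  is_derive t 1 (fun s : R => s^-1 ^+ k * expR (- s^-1))
    (flat k.+2 t - k%:R * flat k.+1 t).
Proof.
move=> t0.
have t1 : t != 0 by rewrite gt_eqF.
have dV : is_derive t 1 (fun s : R => s^-1) (- t ^- 2).
  split; first by apply: (derivableV t1); exact: derivable_id.
  by rewrite deriveV// derive_id [_ *: _]mulr1.
have dX := @is_deriveX R _ (fun s : R => s^-1) k t 1 _ dV.
have dE : is_derive t 1 (fun s : R => expR (- s^-1)) (expR (- t^-1) * t ^- 2).
  have dN : is_derive t 1 (fun s : R => - s^-1) (- (- t ^- 2)) by exact: is_deriveN.
  have [a b] := dN.
  have dexp : derivable (@expR R) (- t^-1) 1 by exact: derivable_expR.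
  have [D1 D2] := derive_comp1 a dexp.
  split; first exact: D1.
  by rewrite D2 b opprK; congr (_ * _); rewrite (@derive_val _ _ _ _ _ _ _ (is_derive_expR _)).
have := is_deriveM dX dE.
have -> : (fun s : R => s^-1 ^+ k * expR (- s^-1)) =
    (fun s : R => s^-1) ^+ k * (fun s : R => expR (- s^-1)).
  by apply/funext => s; rewrite !fctE.
move=> H; apply: is_derive_eq H _; rewrite /flat t0 /=.
rewrite !fctE -!exprVn /GRing.scale/=.
case: k {dX} => [|k] /=; first by rewrite mul0r mul0r !expr0 mul1r mulr0; ring.
by rewrite !exprS; ring.
Qed.

Lemma derivable_flat k (t : R) :
  derivable (flat k) t 1 /\ 'D_1 (flat k) t = flat k.+2 t - k%:R * flat k.+1 t.
Proof.
have [t0|t0|->] := ltgtP t 0.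
- have N : \forall s \near t, cst 0 s = flat k s.
    by near=> s; rewrite flat_le0// ltW//; near: s; exact: near_lt.
  split; first by apply: near_eq_derivable N _; exact: derivable_cst.
  rewrite -(@near_eq_derive R R R _ _ t 1 N) derive_cst !flat_le0 ?ltW//.
  by rewrite mulr0 subrr.
- have N : \forall s \near t, s^-1 ^+ k * expR (- s^-1) = flat k s.
    by have := near_flat_gt0 k t0; apply: filterS => s ->.
  have [D1 D2] := is_derive_flat_gt0 k t0.
  split; first exact: near_eq_derivable N D1.
  by rewrite -(@near_eq_derive R R R _ _ t 1 N).
- have C : (fun h : R => h^-1 *: ((flat k \o shift 0) (h *: 1) - flat k 0)) @ 0^'
      --> (0 : R).
    have -> : (fun h : R => h^-1 *: ((flat k \o shift 0) (h *: 1) - flat k 0)) =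
        flat k.+1.
      apply/funext => h /=.
      by rewrite (@flat_le0 k 0)// subr0 addr0 [h *: 1]mulr1 [_ *: _]flatS.
    apply: cvg_within_filter.
    apply/cvgrPdist_le => e e0; near=> h.
    rewrite sub0r normrN (le_trans (flat_bound _ _))//.
    rewrite -ler_pdivlMl ?ltr0n ?fact_gt0//.
    near: h; apply: (@nbhs0_le R R); by rewrite mulr_gt0// invr_gt0 ltr0n fact_gt0.
  split; first by apply/cvg_ex; exists 0.
  by rewrite !flat_le0// mulr0 subrr; apply/cvg_lim.
Unshelve. all: by end_near. Qed.

Lemma smooth_flat k : smooth (flat k).
Proof.
apply/smoothP => n; elim: n k => [|n IH] k.
all: have df (x v : R) : derivable (flat k) x v by
  have [] := derivable_dir v (derivable_flat k x).1.
all: have cf : continuous (flat k) by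
  move=> x; apply: differentiable_continuous; apply/derivable1_diffP; exact: df.
  by apply/cdiff0P.
apply/cdiffSP; split=> // v.
have -> : 'D_v (flat k) = (fun t => v * (flat k.+2 t + (- k%:R) * flat k.+1 t)).
  apply/funext => t; have [d1 d2] := derivable_flat k t.
  by rewrite (derivable_dir v d1).2 d2 mulNr.
apply: cdiffM; first exact: cdiff_cst.
apply: cdiffD; first exact: IH.
by apply: cdiffM; [exact: cdiff_cst|exact: IH].
Qed.

Let den t := flat 0 t ^+ 2 + flat 0 (1 - t) ^+ 2.

Let den_gt0 t : 0 < den t.
Proof.
rewrite /den; have [t0|t0] := ltP 0 t.
  by rewrite ltr_wpDr ?sqr_ge0// exprn_gt0// flat_gt0.
by rewrite ltr_wpDl ?sqr_ge0// exprn_gt0// flat_gt0// subr_gt0 (le_lt_trans t0).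
Qed.

(** A switch from false for t <= 0 to true for t >= 1.  The values at true and false
    are normalized so that their squares add up to 1: square roots of densities,
    not densities, have to be smooth. *)
Definition cut (b : bool) (t : R) : R :=
  flat 0 (if b then t else 1 - t) / Num.sqrt (flat 0 t ^+ 2 + flat 0 (1 - t) ^+ 2).

Lemma cut_sqr t : cut true t ^+ 2 + cut false t ^+ 2 = 1.
Proof.
rewrite /cut !expr_div_n -mulrDl sqr_sqrtr; last exact: ltW (den_gt0 t).
by rewrite divff// gt_eqF//; exact: den_gt0.
Qed.

Lemma cut_true_neq0 t : cut true t != 0 -> 0 < t.
Proof. by rewrite /cut ltNge; apply: contraNN => /flat_le0 ->; rewrite mul0r. Qed.

Lemma cut_false_neq0 t : cut false t != 0 -> t < 1.
Proof.
rewrite /cut ltNge; apply: contraNN => t1.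
by rewrite flat_le0 ?mul0r// subr_le0.
Qed.

Lemma smooth_cut b : smooth (cut b).
Proof.
have s1 : smooth (fun t : R => flat 0 (1 - t)).
  apply: (@smooth_affine R R R (fun t => 1 - t) (fun v => - v)).
  - by move=> x; apply: cvgB; [exact: cvg_cst|exact: cvg_id].
  - by move=> h v x; rewrite /GRing.scale/=; ring.
  - exact: smooth_flat.
have s2 : smooth (fun t : R => flat 0 t ^+ 2 + flat 0 (1 - t) ^+ 2).
  exact: (smoothD (smoothM (smooth_flat 0) (smooth_flat 0)) (smoothM s1 s1)).
have s3 : smooth (fun t : R => (Num.sqrt (flat 0 t ^+ 2 + flat 0 (1 - t) ^+ 2))^-1).
  refine (smoothV _ (smooth_sqrt den_gt0 s2)).
  by move=> t; rewrite gt_eqF// sqrtr_gt0; exact: den_gt0.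
by case: b; [exact: (smoothM (smooth_flat 0) s3)|exact: (smoothM s1 s3)].
Qed.

Lemma cut_bound b t : `|cut b t| <= 1.
Proof.
rewrite -(@ler_pXn2r _ 2)// ?nnegrE// expr1n real_normK ?num_real//.
by rewrite -(cut_sqr t); case: b; rewrite ?lerDl ?lerDr sqr_ge0.
Qed.

Lemma cut_constE b t : (t <= 0 -> cut b t = (~~ b)%:R) /\ (1 <= t -> cut b t = b%:R).
Proof.
split=> H; rewrite /cut.
  rewrite (flat_le0 0 H) expr0n add0r sqrtr_sqr ger0_norm ?flat_ge0//.
  case: b; first by rewrite (flat_le0 0 H) mul0r.
  by rewrite divff// gt_eqF// flat_gt0// subr_gt0 (le_lt_trans H).
have H' : 1 - t <= 0 by rewrite subr_le0.
rewrite (flat_le0 0 H') expr0n addr0 sqrtr_sqr ger0_norm ?flat_ge0//.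
case: b; last by rewrite (flat_le0 0 H') mul0r.
by rewrite divff// gt_eqF// flat_gt0// (lt_le_trans _ H).
Qed.

(** Outside of the unit interval the switch is constant. *)
Lemma cut_derive_bound b v : exists B, forall t, `|'D_v (cut b) t| <= B.
Proof.
pose g : R -> R := 'D_v (cut b).
have cg : continuous g := smooth_continuous (smooth_derive v (smooth_cut b)).
have cD : {within `[0, 1], continuous (fun t : R => `|g t|)}.
  by apply: continuous_subspaceT => t; apply: cvg_norm; exact: cg.
have [c _ cB] := EVT_max ler01 cD.
exists `|g c| => t.
have [t0|t0] := ltP t 0.
  rewrite (@derive_near_cst _ _ (cut b) (~~ b)%:R) ?normr0//.
  by near=> s; apply: (cut_constE b s).1; apply/ltW; near: s; exact: near_lt.
have [t1|t1] := ltP 1 t; last by apply: cB; rewrite in_itv/= t0.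
rewrite (@derive_near_cst _ _ (cut b) b%:R) ?normr0//.
by near=> s; apply: (cut_constE b s).2; apply/ltW; near: s; exact: near_gt.
Unshelve. all: by end_near. Qed.

End flat_function.

Section smooth_bounded.
Context {R : realType}.
Implicit Types V W : normedModType R.

(** These bounds make products with square integrable functions square
    integrable, and are uniform dominations for limits. *)
Definition smooth_bounded V (f : V -> R) : Prop :=
  [/\ smooth f, exists B, forall x, `|f x| <= B &
      forall v, exists B, forall x, `|'D_v f x| <= B].

Lemma smooth_bounded_cst V (c : R) : smooth_bounded (fun _ : V => c).
Proof.
split; [exact: smooth_cst|by exists (`|c|)|move=> v; exists 0 => x].
by rewrite derive_cst normr0.
Qed.

Lemma smooth_boundedM V (f g : V -> R) : smooth_bounded f -> smooth_bounded g -> smooth_bounded (fun x => f x * g x).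
Proof.
move=> [sf [A hA] Df] [sg [B hB] Dg]; split; first exact: (smoothM sf sg).
  by exists (A * B) => x; rewrite normrM ler_pM.
move=> v; have [A' hA'] := Df v; have [B' hB'] := Dg v.
exists (A * B' + B * A') => x.
have -> : 'D_v (fun x => f x * g x) x = f x * 'D_v g x + g x * 'D_v f x.
  by rewrite [LHS](_ : _ = 'D_v (f * g) x)// deriveM//; exact: smooth_derivable.
by rewrite (le_trans (ler_normD _ _))// lerD// normrM ler_pM.
Qed.

Lemma smooth_bounded_prod V (I : Type) (r : seq I) (f : I -> V -> R) :
  (forall i, smooth_bounded (f i)) -> smooth_bounded (fun x => \prod_(i <- r) f i x).
Proof.
move=> nf; elim: r => [|i r IH].
  by under eq_fun do rewrite big_nil; exact: smooth_bounded_cst.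
by under eq_fun do rewrite big_cons; exact: smooth_boundedM.
Qed.

Lemma smooth_bounded_affine V W (i : V -> W) (l : V -> W) (f : W -> R) :
  continuous i ->
  (forall (h : R) v x, i (h *: v + x) = h *: l v + i x) ->
  smooth_bounded f -> smooth_bounded (fun y => f (i y)).
Proof.
move=> ci il [sf [B hB] Df]; split; first exact: (smooth_affine ci il sf).
  by exists B => x; exact: hB.
move=> v; have [C hC] := Df (l v); exists C => x.
by rewrite (derive_affine _ _ _ il).
Qed.

Lemma smooth_bounded_cut b : smooth_bounded (cut b : R -> R).
Proof.
split; [exact: smooth_cut|exists 1; exact: cut_bound|exact: cut_derive_bound].
Qed.

End smooth_bounded.

Section partition.
Context {R : realType}.
Implicit Types x y : R3 R.

Definition coord3 (c : 'I_3) x : R := tnth [tuple x.1.1; x.1.2; x.2] c.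

Lemma coord3_affine c (h : R) x y : coord3 c (h *: x + y) = h * coord3 c x + coord3 c y.
Proof. by case: c => [] [|[|[|//]]] H; rewrite /coord3 !(tnth_nth 0). Qed.

Lemma coord3B c x y : coord3 c (x - y) = coord3 c x - coord3 c y.
Proof. by case: c => [] [|[|[|//]]] H; rewrite /coord3 !(tnth_nth 0). Qed.

Lemma continuous_coord3 c : continuous (coord3 c).
Proof.
case: c => [] [|[|[|//]]] H.
- have -> : coord3 (Ordinal H) = fst \o fst by apply/funext => x; rewrite /coord3 (tnth_nth 0).
  by move=> x; apply: continuous_comp; exact: cvg_fst.
- have -> : coord3 (Ordinal H) = snd \o fst by apply/funext => x; rewrite /coord3 (tnth_nth 0).
  by move=> x; apply: continuous_comp; [exact: cvg_fst|exact: cvg_snd].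
- have -> : coord3 (Ordinal H) = snd by apply/funext => x; rewrite /coord3 (tnth_nth 0).
  by move=> x; exact: cvg_snd.
Qed.

(** For every coordinate c and every node t_j of a grid that covers the interval
    from -L to L, choose a side of t_j by [cut], and multiply over all (c, j).  The squares of
    the products, over all choices, add up to the product of 1 = cut true ^ 2 + cut false ^ 2.
    On the support of a choice, either two consecutive nodes are chosen on opposite
    sides, which confines the coordinate, or the coordinate lies beyond the grid. *)
Lemma partition_of_unity (L d : R) : 0 < d -> 0 < L ->
  exists (I : finType) (chi : I -> R3 R -> R),
  [/\ forall i, smooth_bounded (chi i), forall x, \sum_i chi i x ^+ 2 = 1 &
      forall i c,
        (forall x y, chi i x != 0 -> chi i y != 0 ->
           `|coord3 c x - coord3 c y| <= 2 * d) \/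
        (forall x, chi i x != 0 -> L <= `|coord3 c x|)].
Proof.
move=> d0 L0.
pose n := Num.trunc ((2 * L + d) / d).
have nd : 2 * L + d <= n.+1%:R * d.
  by rewrite -ler_pdivrMr// ltW// truncnS_gt.
pose t (j : nat) := - L - d + j%:R * d.
pose w (b : bool) c j x := cut b ((coord3 c x - t j) / d).
have wT c j x : w true c j x != 0 -> t j < coord3 c x.
  by move=> /cut_true_neq0; rewrite pmulr_lgt0 ?invr_gt0// subr_gt0.
have wF c j x : w false c j x != 0 -> coord3 c x < t j + d.
  by move=> /cut_false_neq0; rewrite ltr_pdivrMr// mul1r ltrBlDl.
pose I := {ffun 'I_3 * 'I_n.+2 -> bool}.
pose chi (s : I) x := \prod_(p : 'I_3 * 'I_n.+2) w (s p) p.1 p.2 x.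
have chi0 s x (p : 'I_3 * 'I_n.+2) : chi s x != 0 -> w (s p) p.1 p.2 x != 0.
  by move=> /prodf_neq0; exact.
exists I, chi; split.
- move=> s; apply: smooth_bounded_prod => p.
  apply: (@smooth_bounded_affine R _ _ (fun x => (coord3 p.1 x - t p.2) / d)
    (fun v => coord3 p.1 v / d)).
  + move=> x; apply: cvgM; last exact: cvg_cst.
    by apply: cvgB; [exact: continuous_coord3|exact: cvg_cst].
  + by move=> h v x; rewrite coord3_affine /GRing.scale/=; ring.
  + exact: smooth_bounded_cut.
- move=> x.
  under eq_bigr => s _ do rewrite /chi -prodrXl.
  rewrite -(bigA_distr_bigA (fun (p : 'I_3 * 'I_n.+2) b => w b p.1 p.2 x ^+ 2)).
  by apply: big1 => p _; rewrite big_bool /= cut_sqr.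
- move=> s c.
  case: (boolP (s (c, ord0))) => [s0|/negbTE s0]; last first.
    right => x /(chi0 s x (c, ord0)); rewrite s0 => /wF /=.
    rewrite /t mul0r addr0 subrK => xL.
    by rewrite ler_normr lerNr (ltW xL) orbT.
  case: (boolP (s (c, ord_max))) => [sn|/negbTE sn].
    right => x /(chi0 s x (c, ord_max)); rewrite sn => /wT /=.
    rewrite /t => xL; rewrite ler_normr; apply/orP; left.
    by rewrite (le_trans _ (ltW xL))//; lra.
  left.
  (* the side changes from true at the first node to false at the last one *)
  have [a sa sa1] : exists2 a : nat, (a < n.+1)%N &
      s (c, inord a) && ~~ s (c, inord a.+1).
    apply: contrapT => no.
    have all_true k : (k <= n.+1)%N -> s (c, inord k).
      elim: k => [_|k IH kn]; first by rewrite -[inord 0]/(inord (@ord0 n.+1)) inord_val.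
      case: (boolP (s (c, inord k.+1))) => // sk; exfalso; apply: no.
      by exists k => //; rewrite IH// ltnW.
    by have := all_true n.+1 (leqnn _); rewrite -[inord n.+1]/(inord (@ord_max n.+1)) inord_val sn.
  case/andP: sa1 => sT /negbTE sF.
  have bnd x : chi s x != 0 -> t a < coord3 c x < t a + 2 * d.
    move=> cx; apply/andP; split.
      have := chi0 s x (c, inord a) cx; rewrite sT => /wT /=.
      by rewrite inordK// ltnW// ltnS.
    have := chi0 s x (c, inord a.+1) cx; rewrite sF => /wF /=.
    rewrite inordK// => /lt_le_trans; apply; rewrite /t -natr1; lra.
  move=> x y /bnd /andP[x1 x2] /bnd /andP[y1 y2].
  by rewrite ler_norml; apply/andP; split; lra.
Qed.

End partition.

(** * Measurability, square integrability and test functions *)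

Section open_sets_measurable.

(** Continuous functions on the products R^3 and R^6 have to be measurable for the
    product sigma-algebra, although the topology does not come from it.  A countable base
    of the topology by measurable sets is enough, and is inherited by products. *)
Definition countable_measurable_base (T : topologicalType) (M : set (set T)) :=
  exists B : nat -> set T, (forall n, M (B n)) /\
    forall U x, open U -> U x -> exists n, B n x /\ B n `<=` U.

Lemma base_real (R : realType) :
  countable_measurable_base (measurable : set (set R)).
Proof.
pose B n : set R := if unpickle n is Some p
  then [set` `]ratr (p : rat * rat).1, ratr p.2[] else set0.
exists B; split; first by move=> n; rewrite /B; case: unpickle => [p|].
move=> U x oU Ux.
have /nbhs_ballP[e /= e0 eU] : nbhs x U by exact: open_nbhs_nbhs.
have [p] := @rat_in_itvoo R (x - e) x ltac:(by rewrite ltrBlDr ltrDl).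
rewrite in_itv/= => /andP[p1 p2].
have [q] := @rat_in_itvoo R x (x + e) ltac:(by rewrite ltrDl).
rewrite in_itv/= => /andP[q1 q2].
exists (pickle (p, q)); rewrite /B pickleK/= in_itv/= p2 q1; split=> // y /=.
rewrite in_itv/= => /andP[y1 y2]; apply: eU; rewrite /ball/= ltr_norml.
by apply/andP; split; lra.
Qed.

Lemma base_prod (T1 T2 : topologicalType) (M1 : set (set T1)) (M2 : set (set T2))
    (M : set (set (T1 * T2))) :
  (forall A B, M1 A -> M2 B -> M (A `*` B)) ->
  countable_measurable_base M1 -> countable_measurable_base M2 ->
  countable_measurable_base M.
Proof.
move=> MX [B1 [mB1 b1]] [B2 [mB2 b2]].
pose B n : set (T1 * T2) := if unpickle n is Some p
  then B1 (p : nat * nat).1 `*` B2 p.2 else B1 0%N `*` B2 0%N.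
exists B; split.
  by move=> n; rewrite /B; case: unpickle => [p|]; exact: MX.
move=> U [x y] oU Ux.
have [[P Q] /= [nP nQ] PQ] : nbhs (x, y) U by exact: open_nbhs_nbhs.
have [n [nx nP']] := b1 _ x (open_interior P) nP.
have [k [kx kQ']] := b2 _ y (open_interior Q) nQ.
exists (pickle (n, k)); rewrite /B pickleK/=; split=> // -[a b] /= [na kb].
by apply: PQ; split; [exact: (interior_subset (nP' _ na))|exact: (interior_subset (kQ' _ kb))].
Qed.

Lemma base_open_measurable (T : topologicalType) (M : set (set T)) :
  (forall F : nat -> set T, (forall n, M (F n)) -> M (\bigcup_n F n)) -> M set0 ->
  countable_measurable_base M -> forall U, open U -> M U.
Proof.
move=> MU M0 [B [mB bB]] U oU.
have -> : U = \bigcup_n (if `[< B n `<=` U >] then B n else set0).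
  apply/seteqP; split=> [x Ux|x [n _]].
    have [n [nx nU]] := bB U x oU Ux; exists n => //.
    by rewrite (asboolT nU).
  by case: ifPn => // /asboolP; exact.
by apply: MU => n; case: ifPn.
Qed.

Lemma base_R3 (R : realType) :
  countable_measurable_base (measurable : set (set (R3 R))).
Proof.
apply: base_prod (@base_real R); first by move=> A B; exact: measurableX.
by apply: base_prod (@base_real R) (@base_real R) => A B; exact: measurableX.
Qed.

Lemma base_R6 (R : realType) :
  countable_measurable_base (measurable : set (set (R6 R))).
Proof. by apply: base_prod (@base_R3 R) (@base_R3 R) => A B; exact: measurableX. Qed.

Lemma continuous_measurable3 (R : realType) (f : R3 R -> R) :
  continuous f -> measurable_fun setT f.
Proof.
move=> /continuousP cf.
apply: (measurability _ (RGenOpens.measurableE R)).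
move=> _ [_ [a [b ->] <-]]; rewrite setTI.
apply: (base_open_measurable _ _ (@base_R3 R)) => //; last exact/cf/interval_open.
by move=> F mF; exact: bigcupT_measurable.
Qed.

Lemma continuous_measurable6 (R : realType) (f : R6 R -> R) :
  continuous f -> measurable_fun setT f.
Proof.
move=> /continuousP cf.
apply: (measurability _ (RGenOpens.measurableE R)).
move=> _ [_ [a [b ->] <-]]; rewrite setTI.
apply: (base_open_measurable _ _ (@base_R6 R)) => //; last exact/cf/interval_open.
by move=> F mF; exact: bigcupT_measurable.
Qed.

End open_sets_measurable.

Section real_measurable.
Context d (T : measurableType d) (R : realType).
Implicit Types f g : T -> R.

Lemma measurable_fun_sqrt f : measurable_fun setT f ->
  measurable_fun setT (fun x => Num.sqrt (f x)).
Proof.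
move=> mf; apply: (@measurableT_comp _ _ _ _ _ _ (@Num.sqrt R)) => //.
by apply: continuous_measurable_fun; exact: sqrt_continuous.
Qed.

Lemma measurable_fun_inv f : measurable_fun setT f ->
  measurable_fun setT (fun x => (f x)^-1).
Proof.
move=> mf; apply: (@measurableT_comp _ _ _ _ _ _ (@GRing.inv R)) => //.
rewrite -(setvU [set 0 : R]).
apply/measurable_funU; [exact: measurableC|exact: measurable_set1|split].
  apply: open_continuous_measurable_fun.
    exact/closed_openC/accessible_closed_set1/hausdorff_accessible/Rhausdorff.
  by move=> x; rewrite inE/= => /eqP x0; exact: inv_continuous.
exact: measurable_fun_set1.
Qed.

End real_measurable.

Section square_integrable.
Context d (T : measurableType d) (R : realType) (mu : {measure set T -> \bar R}).
Implicit Types f g : T -> R.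

Lemma Lfun2P f : f \in Lfun mu 2%:E <->
  measurable_fun setT f /\ (\int[mu]_x (f x ^+ 2)%:E < +oo)%E.
Proof.
split=> [lf|[mf If]].
  split; first by move: lf; rewrite inE => /andP[]; rewrite inE.
  have /integrableP[_] := Lfun2_integrable_sqr lf.
  by under eq_integral => x _ do rewrite /= ger0_norm ?sqr_ge0//.
rewrite inE; apply/andP; split; rewrite inE//=.
rewrite /finite_norm unlock /Lnorm.
under eq_integral => x _ do rewrite /= powR_mulrn// real_normK ?num_real//.
by rewrite poweR_lty.
Qed.

Lemma Lfun2_mulbounded f (h : T -> R) B : f \in Lfun mu 2%:E -> measurable_fun setT h ->
  (forall x, `|h x| <= B) -> (fun x => f x * h x) \in Lfun mu 2%:E.
Proof.
move=> /Lfun2P[mf If] mh hB; apply/Lfun2P; split; first exact: measurable_funM.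
apply: (@le_lt_trans _ _ (\int[mu]_x ((B ^+ 2)%:E * (f x ^+ 2)%:E))%E).
  apply: ge0_le_integral => //.
  - by move=> x _; rewrite lee_fin sqr_ge0.
  - by apply/measurable_EFinP/measurable_funX/measurable_funM.
  - by apply: emeasurable_funM => //; apply/measurable_EFinP/measurable_funX.
  - move=> x _; rewrite -EFinM lee_fin exprMn mulrC ler_wpM2r ?sqr_ge0//.
    by rewrite -[h x ^+ 2]real_normK ?num_real// lerXn2r// ?nnegrE// (le_trans _ (hB x)).
rewrite ge0_integralZl//.
- by rewrite lte_mul_pinfty// lee_fin sqr_ge0.
- exact/measurable_EFinP/measurable_funX.
- by move=> x _; rewrite lee_fin sqr_ge0.
- by rewrite lee_fin sqr_ge0.
Qed.

Lemma Lfun2D f g : f \in Lfun mu 2%:E -> g \in Lfun mu 2%:E ->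
  (fun x => f x + g x) \in Lfun mu 2%:E.
Proof.
have h : (1 <= 2%:E :> \bar R)%E by rewrite lee_fin ler1n.
by move=> lf lg; have := (@Lfun_addr_closed _ _ _ mu 2%:E h).2 f g lf lg.
Qed.

Lemma Lfun2_integrableM f g : f \in Lfun mu 2%:E -> g \in Lfun mu 2%:E ->
  mu.-integrable setT (fun x => (f x * g x)%:E).
Proof. by move=> lf lg; apply/Lfun1_integrable/Lfun2_mul_Lfun1. Qed.

Lemma Lfun2_bounded_finite (h : T -> R) (B : set T) M : measurable_fun setT h -> measurable B ->
  (mu B < +oo)%E -> (forall x, `|h x| <= M) -> (forall x, h x != 0 -> B x) ->
  h \in Lfun mu 2%:E.
Proof.
move=> mh mB Boo hM hB; apply/Lfun2P; split=> //.
apply: (@le_lt_trans _ _ (\int[mu]_x ((M ^+ 2)%:E * (\1_B x)%:E))%E).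
  apply: ge0_le_integral => //.
  - by move=> x _; rewrite lee_fin sqr_ge0.
  - exact/measurable_EFinP/measurable_funX.
  - by apply: emeasurable_funM => //; apply/measurable_EFinP.
  - move=> x _; rewrite -EFinM lee_fin.
    have [->|hx] := eqVneq (h x) 0.
      by rewrite expr0n mulr_ge0// sqr_ge0.
    rewrite indicE mem_set ?mulr1; last exact: hB.
    by rewrite -[h x ^+ 2]real_normK ?num_real// lerXn2r// ?nnegrE// (le_trans _ (hM x)).
rewrite ge0_integralZl//.
- by rewrite integral_indic// setIT lte_mul_pinfty// lee_fin sqr_ge0.
- exact/measurable_EFinP.
- by rewrite lee_fin sqr_ge0.
Qed.

(** The identity defining a weak derivative, as the vanishing of one integral: in
    this form it passes to limits and can be integrated over a parameter. *)
Lemma Rintegral_oppE f g : mu.-integrable setT (EFin \o f) ->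
  mu.-integrable setT (EFin \o g) ->
  (Rintegral mu setT f = - Rintegral mu setT g <->
   (\int[mu]_x (f x + g x)%:E = 0)%E).
Proof.
move=> If Ig.
have E : (\int[mu]_x (f x + g x)%:E = (Rintegral mu setT f + Rintegral mu setT g)%:E)%E.
  rewrite -RintegralD// /Rintegral fineK//.
  apply: integrable_fin_num => //; under eq_fun do rewrite EFinD; exact: integrableD.
rewrite E; split=> [->|]; first by rewrite addNr.
by move=> [] /eqP; rewrite addr_eq0 => /eqP.
Qed.

End square_integrable.

Section test_functions.
Context {R : realType}.
Implicit Types V W : normedModType R.

Lemma test_function_derive V (phi : V -> R) v :
  test_function phi -> test_function ('D_v phi).
Proof.
move=> [sphi cphi]; split; first exact: smooth_derive.
apply: (subclosed_compact (@closed_closure _ _) cphi).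
have -> : closure [set x | phi x != 0] = closure (closure [set x | phi x != 0]).
  exact/closure_id/closed_closure.
apply: closureS => x /= /eqP Dx; apply: contrapT => ncl; apply: Dx.
apply: (@derive_near_cst _ _ _ 0).
have : open (~` closure [set x | phi x != 0]).
  exact/closed_openC/closed_closure.
rewrite openE => /(_ x ncl); apply: filterS => y ny.
by apply: contrapT => /eqP py; apply: ny; exact: subset_closure.
Qed.

Lemma test_functionM V (G phi : V -> R) : smooth G -> test_function phi ->
  test_function (fun x => G x * phi x).
Proof.
move=> sG [sphi cphi]; split; first exact: (smoothM sG sphi).
apply: (subclosed_compact (@closed_closure _ _) cphi).
by apply: closureS => x /=; rewrite mulf_eq0 negb_or => /andP[].
Qed.

Lemma test_function_bounded V (phi : V -> R) : test_function phi ->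
  exists M N, forall x, `|phi x| <= M /\ (phi x != 0 -> `|x| <= N).
Proof.
move=> [sphi cphi]; set K := closure _ in cphi.
have cc : {within K, continuous phi}.
  by apply: continuous_subspaceT; exact: smooth_continuous.
have [M [_ MP]] := compact_bounded (continuous_compact cc cphi).
have [N [_ NP]] := compact_bounded cphi.
exists (Num.max 0 (M + 1)), (N + 1) => x; split; last first.
  by move=> px; apply: (NP (N + 1)); [rewrite ltrDl|exact: subset_closure].
have [->|px] := eqVneq (phi x) 0; first by rewrite normr0 le_max lexx.
rewrite le_max; apply/orP; right; apply: (MP (M + 1)); first by rewrite ltrDl.
by exists x => //; exact: subset_closure.
Qed.

(** The inverse [r] on the left transports compactness of the support. *)
Lemma test_function_affine V W (i : V -> W) (l : V -> W) (r : W -> V) phi :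
  continuous i -> continuous r -> cancel i r ->
  (forall (h : R) v x, i (h *: v + x) = h *: l v + i x) ->
  test_function phi -> test_function (fun x => phi (i x)).
Proof.
move=> ci cr ir il [sphi cphi]; split; first exact: (smooth_affine ci il sphi).
have cK := continuous_compact (continuous_subspaceT cr) cphi.
apply: (subclosed_compact (@closed_closure _ _) cK).
move=> x clx; exists (i x); last exact: ir.
move=> B nB; have [y [/= py By]] := clx (i @^-1` B) (ci x _ nB).
by exists (i y).
Qed.

End test_functions.

Section box.
Context {R : realType}.

Lemma leb1_itv (N : R) : (leb1 `[(- N)%R, N] < +oo)%E.
Proof.
rewrite /leb1 (@lebesgue_measure_itv R `[(- N)%R, N])/=.
by case: ifPn => _; rewrite ?ltry// -EFinB ltry.
Qed.

Definition box3 (N : R) : set (R3 R) := (`[(- N), N] `*` `[(- N), N]) `*` `[(- N), N].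

Lemma measurable_box3 N : measurable (box3 N).
Proof. by apply: measurableX => //; apply: measurableX. Qed.

Lemma leb3_box3 N : (leb3 (box3 N) < +oo)%E.
Proof.
rewrite /leb3 /box3 product_measure1E//; last exact: measurableX.
have l1 := leb1_itv N.
have l2 : (leb2 (`[(- N)%R, N] `*` `[(- N)%R, N]) < +oo)%E.
  by rewrite /leb2 product_measure1E// lte_mul_pinfty ?measure_ge0// ge0_fin_numE.
by rewrite lte_mul_pinfty ?measure_ge0// ge0_fin_numE.
Qed.

Lemma norm_box3 (N : R) (x : R3 R) : `|x| <= N -> box3 N x.
Proof.
rewrite /box3; case: x => [[a b] c]; rewrite /Num.norm/= !ge_max => /andP[/andP[]].
by rewrite !ler_norml => *; rewrite !in_itv.
Qed.

Lemma test_function_Lfun3 (phi : R3 R -> R) : test_function phi ->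
  phi \in Lfun leb3 2%:E.
Proof.
move=> tphi; have [M [N MN]] := test_function_bounded tphi.
apply: (@Lfun2_bounded_finite _ _ _ _ _ (box3 N) M).
- by have [sphi _] := tphi; exact: continuous_measurable3 (smooth_continuous sphi).
- exact: measurable_box3.
- exact: leb3_box3.
- by move=> x; have [] := MN x.
- by move=> x px; apply: norm_box3; have [_] := MN x; exact.
Qed.

Lemma test_function_Lfun6 (phi : R6 R -> R) : test_function phi ->
  phi \in Lfun leb6 2%:E.
Proof.
move=> tphi; have [M [N MN]] := test_function_bounded tphi.
apply: (@Lfun2_bounded_finite _ _ _ _ _ (box3 N `*` box3 N) M).
- by have [sphi _] := tphi; exact: continuous_measurable6 (smooth_continuous sphi).
- by apply: measurableX; exact: measurable_box3.
- have E : leb6 (box3 N `*` box3 N) = (leb3 (box3 N) * leb3 (box3 N))%E.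
    by rewrite /leb6 product_measure1E//; exact: measurable_box3.
  have l3 := leb3_box3 N.
  by rewrite [X in (X < _)%E]E lte_mul_pinfty ?measure_ge0// ge0_fin_numE.
- by move=> x; have [] := MN x.
- move=> x px; have [_ /(_ px)] := MN x.
  rewrite /Num.norm/= ge_max => /andP[? ?].
  by split; exact: norm_box3.
Qed.

End box.

(** * Weak derivative of the root of a sum of squares *)

Section sum_of_squares.
Context {R : realType} {V : normedModType R} {I : finType}.
Variable chi : I -> V -> R.

Definition sos (c : I -> R) (x : V) : R := \sum_i c i * chi i x ^+ 2.

(** Half of the derivative of [sos], so that the derivative of its root is this
    divided by the root. *)
Definition half_derive_sos (c : I -> R) (v x : V) : R :=
  \sum_i c i * chi i x * 'D_v (chi i) x.

Lemma sos_ge0 c x : (forall i, 0 <= c i) -> 0 <= sos c x.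
Proof. by move=> c0; apply: sumr_ge0 => i _; rewrite mulr_ge0// sqr_ge0. Qed.

Lemma smooth_sos c : (forall i, smooth (chi i)) -> smooth (sos c).
Proof.
move=> sc; apply: smooth_sum => i.
exact: (smoothM (smooth_cst (c i)) (smoothM (sc i) (sc i))).
Qed.

Lemma derive_sos c v x : (forall i, smooth (chi i)) ->
  'D_v (sos c) x = 2 * half_derive_sos c v x.
Proof.
move=> sc.
rewrite /half_derive_sos mulr_sumr [LHS]derive_sumfun; last first.
  by move=> i; exact: (smoothM (smooth_cst (c i)) (smoothM (sc i) (sc i))).
apply: eq_bigr => i _.
have d := smooth_derivable (sc i) x v.
rewrite derive_mulfun; [|exact: derivable_cst|exact: (derivableM d d)].
by rewrite derive_cst mulr0 addr0 derive_mulfun//; ring.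
Qed.

(** The bound is proportional to the root itself: hence the derivative of the root
    is bounded, even near zeros of [sos], and uniformly in a positive constant
    added under the root.  Each term c chi chi' is the root of c chi^2, which is at most the whole root, times
    the root of c times chi'. *)
Lemma half_derive_sos_bound c v C (B : I -> R) x : (forall i, 0 <= c i <= C) ->
  (forall i, `|'D_v (chi i) x| <= B i) ->
  `|half_derive_sos c v x| <= (Num.sqrt C * \sum_i B i) * Num.sqrt (sos c x).
Proof.
move=> cC hB.
have c0 i : 0 <= c i by case/andP: (cC i).
rewrite mulrAC mulr_sumr (le_trans (ler_norm_sum _ _ _))//; apply: ler_sum => i _.
rewrite normrM ler_pM//.
have -> : c i * chi i x = Num.sqrt (c i) * (Num.sqrt (c i) * chi i x).
  by rewrite mulrA -expr2 sqr_sqrtr.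
rewrite normrM ger0_norm ?sqrtr_ge0// ler_pM ?sqrtr_ge0//.
  by rewrite ler_wsqrtr//; case/andP: (cC i).
rewrite -sqrtr_sqr ler_wsqrtr// exprMn sqr_sqrtr// /sos (bigD1 i)//= lerDl.
by apply: sumr_ge0 => j _; rewrite mulr_ge0// sqr_ge0.
Qed.

Lemma smooth_root c (e : R) : (forall i, 0 <= c i) -> 0 < e ->
  (forall i, smooth (chi i)) -> smooth (fun x => Num.sqrt (sos c x + e)).
Proof.
move=> c0 e0 sc; apply: smooth_sqrt.
  by move=> x; rewrite ltr_wpDl// sos_ge0.
exact: (smoothD (smooth_sos c sc) (smooth_cst e)).
Qed.

Lemma derive_root c e v x : (forall i, 0 <= c i) -> 0 < e ->
  (forall i, smooth (chi i)) ->
  'D_v (fun x => Num.sqrt (sos c x + e)) x =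
  half_derive_sos c v x / Num.sqrt (sos c x + e).
Proof.
move=> c0 e0 sc.
have se0 : 0 < sos c x + e by rewrite ltr_wpDl// sos_ge0.
have ds := smooth_derivable (smooth_sos c sc) x v.
have de : derivable (fun x => sos c x + e) x v.
  exact: (smooth_derivable (smoothD (smooth_sos c sc) (smooth_cst e))).
rewrite (@derive_sqrt_comp _ _ (fun x => sos c x + e) x v se0 de).
rewrite derive_addfun; [|exact: ds|exact: derivable_cst].
by rewrite derive_cst addr0 derive_sos// invfM mulrACA divff// mul1r.
Qed.

End sum_of_squares.

Section weak_derivative_root.
Context {R : realType}.

Lemma cvg_invS_sqrt (a : R) : 0 <= a ->
  Num.sqrt (a + n.+1%:R^-1) @[n --> \oo] --> Num.sqrt a.
Proof.
move=> a0; apply: continuous_cvg; first exact: sqrt_continuous.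
rewrite -[X in _ --> X]addr0; apply: cvgD; first exact: cvg_cst.
exact: cvg_harmonic.
Qed.

(** Leibniz rule for u times the root F of [sos chi c], with derivative
    g F + u F'.  At zeros of [sos] the quotient that stands for F' has denominator 0 and is
    0.  For F_e, the root of [sos chi c] + e, the rule is the hypothesis on u with the test
    function F_e phi; let e tend to 0 by dominated convergence.  The conclusion records
    the integrability of the integrand as well, because the integral is next
    used inside a double integral. *)
Lemma weak_derivative_root (I : finType) (chi : I -> R3 R -> R) (c : I -> R)
    (u g : R3 R -> R) (v : R3 R) :
  (forall i, smooth_bounded (chi i)) -> (forall i, 0 <= c i) ->
  u \in Lfun leb3 2%:E -> g \in Lfun leb3 2%:E ->
  weak_derivative (Rintegral leb3 setT) v u g ->
  forall phi, test_function phi ->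
  let J x := u x * Num.sqrt (sos chi c x) * 'D_v phi x +
    (g x * Num.sqrt (sos chi c x) +
      u x * (half_derive_sos chi c v x / Num.sqrt (sos chi c x))) * phi x in
  leb3.-integrable setT (EFin \o J) /\ (\int[leb3]_x (J x)%:E = 0)%E.
Proof.
move=> nc c0 uL gL wd phi tphi J.
have sc i : smooth (chi i) by have [] := nc i.
have [Bd hBd] := choice (fun i => let: And3 _ _ h := nc i in h v).
have [Bc hBc] := choice (fun i => let: And3 _ h _ := nc i in h).
pose C := \sum_i c i.
have cC i : 0 <= c i <= C.
  rewrite c0 /C (bigD1 i)//= lerDl; exact: sumr_ge0.
pose K := Num.sqrt C * \sum_i Bd i.
have hK x : `|half_derive_sos chi c v x| <= K * Num.sqrt (sos chi c x).
  by apply: half_derive_sos_bound => // i; exact: hBd.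
have K0 : 0 <= K.
  rewrite mulr_ge0// ?sqrtr_ge0// sumr_ge0// => i _.
  exact: le_trans (hBd i 0).
pose A := Num.sqrt (\sum_i c i * Bc i ^+ 2 + 1).
have hA (e : R) x : 0 <= e <= 1 -> Num.sqrt (sos chi c x + e) <= A.
  case/andP=> e0 e1; rewrite ler_wsqrtr// lerD// ler_sum// => i _.
  rewrite ler_wpM2l// -[chi i x ^+ 2]real_normK ?num_real// lerXn2r// ?nnegrE//.
  by rewrite (le_trans _ (hBc i x)).
pose G (e : R) x := Num.sqrt (sos chi c x + e).
pose f (e : R) x := u x * G e x * 'D_v phi x +
  (g x * G e x + u x * (half_derive_sos chi c v x / G e x)) * phi x.
pose e_ (n : nat) : R := n.+1%:R^-1.
have e_gt0 n : 0 < e_ n by rewrite invr_gt0.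
have e_le1 n : 0 <= e_ n <= 1 by rewrite ltW//= invf_le1// ler1n.
(* with e > 0 the root is smooth, so its product with phi is a test function *)
have f0 n : (\int[leb3]_x (f (e_ n) x)%:E = 0)%E.
  have tG : test_function (fun x => G (e_ n) x * phi x).
    by apply: test_functionM => //; exact: smooth_root.
  have L1 := test_function_Lfun3 tG.
  have L2 := test_function_Lfun3 (test_function_derive v tG).
  have I1 := Lfun2_integrableM uL L2.
  have I2 := Lfun2_integrableM gL L1.
  have := (Rintegral_oppE I1 I2).1 (wd _ tG).
  move=> <-; apply: eq_integral => x _; congr EFin.
  have -> : 'D_v (fun x => G (e_ n) x * phi x) x =
      G (e_ n) x * 'D_v phi x + phi x * 'D_v (G (e_ n)) x.
    have sG := smooth_root c0 (e_gt0 n) sc.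
    have -> : 'D_v (fun x => G (e_ n) x * phi x) x = 'D_v (G (e_ n) * phi) x by [].
    rewrite deriveM//; first exact: smooth_derivable.
    by case: tphi => sphi _; exact: smooth_derivable.
  by rewrite derive_root// /f; ring.
have mF : measurable_fun setT (sos chi c).
  exact: continuous_measurable3 (smooth_continuous (smooth_sos c sc)).
have mH : measurable_fun setT (half_derive_sos chi c v).
  apply: measurable_sum => i; apply: measurable_funM.
    by apply: measurable_funM => //; exact: continuous_measurable3 (smooth_continuous (sc i)).
  exact: continuous_measurable3 (smooth_continuous (smooth_derive v (sc i))).
have /Lfun2P[mu _] := uL.
have /Lfun2P[mg _] := gL.
have pL := test_function_Lfun3 tphi.
have dpL := test_function_Lfun3 (test_function_derive v tphi).
have /Lfun2P[mp _] := pL.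
have /Lfun2P[mdp _] := dpL.
have mG e : measurable_fun setT (G e).
  by apply/measurable_fun_sqrt/measurable_funD.
have mf e : measurable_fun setT (f e).
  apply: measurable_funD; first by apply: measurable_funM => //; exact: measurable_funM.
  apply: measurable_funM => //; apply: measurable_funD; first exact: measurable_funM.
  apply: measurable_funM => //; apply: measurable_funM => //.
  exact: measurable_fun_inv.
pose dom x := A * `|u x * 'D_v phi x| + (A * `|g x * phi x| + K * `|u x * phi x|).
have Idom : leb3.-integrable setT (EFin \o dom).
  have In (a b : R3 R -> R) k : a \in Lfun leb3 2%:E -> b \in Lfun leb3 2%:E ->
      leb3.-integrable setT (fun x => (k * `|a x * b x|)%:E).
    move=> aL bL; have := integrable_norm (Lfun2_integrableM aL bL).
    by move=> /(integrableZl measurableT k); apply: eq_integrable.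
  have E : EFin \o dom = (fun x => (A * `|u x * 'D_v phi x|)%:E +
      ((A * `|g x * phi x|)%:E + (K * `|u x * phi x|)%:E))%E by [].
  rewrite E; apply: integrableD => //; first exact: In.
  by apply: integrableD => //; exact: In.
have Gge e x : 0 <= G e x by exact: sqrtr_ge0.
(* domination uniform in e, where K bounds the derivative of the root *)
have f_dom n x : `|f (e_ n) x| <= dom x.
  have GA : G (e_ n) x <= A by exact: hA.
  have HG : `|half_derive_sos chi c v x / G (e_ n) x| <= K.
    rewrite normrM normfV (ger0_norm (Gge _ _)).
    have G0 : 0 < G (e_ n) x by rewrite sqrtr_gt0 ltr_wpDl// sos_ge0.
    rewrite ler_pdivrMr// (le_trans (hK x))// ler_wpM2l//.
    by rewrite ler_wsqrtr// lerDl ltW.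
  rewrite (le_trans (ler_normD _ _))// lerD//.
    by rewrite mulrAC normrM mulrC ler_wpM2r// (ger0_norm (Gge _ _)).
  rewrite mulrDl (le_trans (ler_normD _ _))// lerD//.
    by rewrite mulrAC normrM mulrC ler_wpM2r// (ger0_norm (Gge _ _)).
  by rewrite mulrAC normrM mulrC ler_wpM2r.
(* at a zero of sos the numerator vanishes too, so the quotient is constantly 0 *)
have cvf x : f (e_ n) x @[n --> \oo] --> f 0 x.
  have cG : G (e_ n) x @[n --> \oo] --> G 0 x.
    by rewrite /G addr0; apply: cvg_invS_sqrt; exact: sos_ge0.
  apply: cvgD.
    by apply: cvgM; [apply: cvgM => //; exact: cvg_cst|exact: cvg_cst].
  apply: cvgM; last exact: cvg_cst.
  apply: cvgD; first by apply: cvgM => //; exact: cvg_cst.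
  apply: cvgM; first exact: cvg_cst.
  have [F0|F0] := eqVneq (sos chi c x) 0.
    have -> : half_derive_sos chi c v x = 0.
      by apply/eqP; rewrite -normr_le0 (le_trans (hK x))// F0 sqrtr0 mulr0.
    by under eq_fun do rewrite mul0r; rewrite mul0r; exact: cvg_cst.
  apply: cvgM; first exact: cvg_cst.
  by apply: cvgV => //; rewrite /G addr0 gt_eqF// sqrtr_gt0 lt_neqAle eq_sym F0 sos_ge0.
have D := @dominated_convergence _ _ R leb3 setT measurableT
  (fun n x => (f (e_ n) x)%:E) (EFin \o f 0) (EFin \o dom).
have fJ : f 0 = J by apply/funext => x; rewrite /f /J /G addr0.
have [||||] := D _ _ _ Idom.
- by move=> n; apply/measurable_EFinP; exact: mf.
- by apply/measurable_EFinP; exact: mf.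
- by apply: aeW => x _; apply: cvg_EFin (cvf x); exact: nearW.
- by apply: aeW => x n _; rewrite /= lee_fin; exact: f_dom.
rewrite fJ => IJ _; under eq_fun do rewrite f0.
by move=> /(cvg_lim (@ereal_hausdorff R)); rewrite lim_cst// => <-.
Qed.

End weak_derivative_root.

(** * The two-electron root and its weak derivatives *)

Section swap.
Context d (T : measurableType d) {R : realType}
  (mu : {sigma_finite_measure set T -> \bar R}).

Lemma ge0_integral_swap (f : T * T -> \bar R) :
  measurable_fun setT f -> (forall p, 0 <= f p)%E ->
  (\int[mu \x mu]_p f (swap p) = \int[mu \x mu]_p f p)%E.
Proof.
move=> mf f0; rewrite fubini_tonelli1//; last first.
  by apply: measurableT_comp => //; exact: measurable_swap.
by rewrite [RHS]fubini_tonelli2.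
Qed.

Lemma integral_swap (f : T * T -> \bar R) : measurable_fun setT f ->
  (\int[mu \x mu]_p f (swap p) = \int[mu \x mu]_p f p)%E.
Proof.
move=> mf; rewrite integralE [RHS]integralE.
rewrite (_ : (fun p => f (swap p)) = f \o @swap T T)// funepos_comp funeneg_comp.
congr (_ - _)%E.
  apply: (ge0_integral_swap (f := f^\+%E)); last exact: funepos_ge0.
  exact: measurable_funepos.
apply: (ge0_integral_swap (f := f^\-%E)); last exact: funeneg_ge0.
exact: measurable_funeneg.
Qed.

End swap.

Section tensor.
Context d1 d2 (T1 : measurableType d1) (T2 : measurableType d2) {R : realType}
  (m1 : {sigma_finite_measure set T1 -> \bar R})
  (m2 : {sigma_finite_measure set T2 -> \bar R}).

Lemma ge0_integral_tensor (f : T1 -> \bar R) (g : T2 -> \bar R) :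
  measurable_fun setT f -> measurable_fun setT g ->
  (forall x, 0 <= f x)%E -> (forall y, 0 <= g y)%E ->
  (\int[m1 \x m2]_p (f p.1 * g p.2) = \int[m1]_x f x * \int[m2]_y g y)%E.
Proof.
move=> mf mg f0 g0; rewrite fubini_tonelli1; last 2 first.
- by apply: emeasurable_funM; apply: measurableT_comp.
- by move=> p; exact: mule_ge0.
rewrite /fubini_F /=.
under eq_integral => x _ do rewrite ge0_integralZl//.
by rewrite ge0_integralZr// integral_ge0.
Qed.

Lemma tensor_Lfun2 (f : T1 -> R) (g : T2 -> R) :
  f \in Lfun m1 2%:E -> g \in Lfun m2 2%:E ->
  (fun p => f p.1 * g p.2) \in Lfun (m1 \x m2)%E 2%:E.
Proof.
move=> /Lfun2P[mf If] /Lfun2P[mg Ig]; apply/Lfun2P; split.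
  by apply: measurable_funM; apply: measurableT_comp.
under eq_integral => p _ do rewrite exprMn EFinM.
rewrite (ge0_integral_tensor (f := fun x => (f x ^+ 2)%:E) (g := fun y => (g y ^+ 2)%:E)).
- by rewrite lte_mul_pinfty ?integral_ge0// ?ge0_fin_numE ?integral_ge0// => ? _;
    rewrite lee_fin sqr_ge0.
- exact/measurable_EFinP/measurable_funX.
- exact/measurable_EFinP/measurable_funX.
- by move=> x; rewrite lee_fin sqr_ge0.
- by move=> x; rewrite lee_fin sqr_ge0.
Qed.

End tensor.

Section two_electrons.
Context {R : realType} {I : finType}.
Variable chi : I -> R3 R -> R.
Hypothesis nchi : forall i, smooth_bounded (chi i).

(** Written as an iterated sum of squares in the first variable, so that the results for
    one electron apply to slices with the second position fixed. *)
Definition sos2 (b : I -> I -> R) (p : R6 R) : R :=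
  sos chi (fun k => sos chi (b k) p.2) p.1.

Lemma sos2E (b : I -> I -> R) p : sos2 b p = \sum_k \sum_l b k l * chi k p.1 ^+ 2 * chi l p.2 ^+ 2.
Proof.
rewrite /sos2 /sos; apply: eq_bigr => k _; rewrite mulr_suml.
by apply: eq_bigr => l _; ring.
Qed.

Lemma sos2_swap b p : sos2 b (swap p) = sos2 (fun k l => b l k) p.
Proof.
rewrite !sos2E exchange_big; apply: eq_bigr => k _; apply: eq_bigr => l _ /=.
by ring.
Qed.

Lemma sos2_ge0 (b : I -> I -> R) p : (forall k l, 0 <= b k l) -> 0 <= sos2 b p.
Proof. by move=> b0; apply: sos_ge0 => k; exact: sos_ge0. Qed.

Let schi i : smooth (chi i). Proof. by have [] := nchi i. Qed.

Let mchi i : measurable_fun setT (chi i).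
Proof. exact: continuous_measurable3 (smooth_continuous (schi i)). Qed.

Lemma measurable_sos c : measurable_fun setT (sos chi c).
Proof. exact: continuous_measurable3 (smooth_continuous (smooth_sos c schi)). Qed.

Lemma sos_bounded c : (forall i, 0 <= c i) -> exists B, forall x, sos chi c x <= B.
Proof.
move=> c0; have [B hB] := choice (fun i => let: And3 _ h _ := nchi i in h).
exists (\sum_i c i * B i ^+ 2) => x; apply: ler_sum => i _.
rewrite ler_wpM2l// -[chi i x ^+ 2]real_normK ?num_real// lerXn2r// ?nnegrE//.
by rewrite (le_trans _ (hB i x)).
Qed.

Lemma measurable_sos2 b : measurable_fun setT (sos2 b).
Proof.
apply: measurable_sum => k; apply: measurable_funM.
  by apply: measurableT_comp; [exact: measurable_sos|exact: measurable_snd].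
apply/measurable_funX/measurableT_comp; [exact: mchi|exact: measurable_fst].
Qed.

Lemma coef_bounded (b : I -> I -> R) : (forall k l, 0 <= b k l) ->
  exists2 C, 0 <= C & forall k y, 0 <= sos chi (b k) y <= C.
Proof.
move=> b0; have [B hB] := choice (fun k => sos_bounded (b0 k)).
have B0 k : 0 <= B k by apply: le_trans (hB k 0); exact: sos_ge0.
exists (\sum_k B k); first exact: sumr_ge0.
move=> k y; rewrite sos_ge0//= (le_trans (hB k y))// (bigD1 k)//= lerDl.
exact: sumr_ge0.
Qed.

Lemma sos2_bounded (b : I -> I -> R) : (forall k l, 0 <= b k l) -> exists B, forall p, sos2 b p <= B.
Proof.
move=> b0; have [C C0 hC] := coef_bounded b0.
have [B hB] := @sos_bounded (fun=> C) (fun=> C0).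
exists B => p; apply: le_trans (hB p.1); apply: ler_sum => k _.
by rewrite ler_wpM2r ?sqr_ge0//; case/andP: (hC k p.2).
Qed.

Lemma root_Lfun2 (b : I -> I -> R) (u t : R3 R -> R) : (forall k l, 0 <= b k l) ->
  u \in Lfun leb3 2%:E -> t \in Lfun leb3 2%:E ->
  (fun p => u p.1 * t p.2 * Num.sqrt (sos2 b p)) \in Lfun leb6 2%:E.
Proof.
move=> b0 uL tL; have [B hB] := sos2_bounded b0.
apply: (@Lfun2_mulbounded _ _ _ _ (fun p => u p.1 * t p.2) _ (Num.sqrt B)).
- exact: tensor_Lfun2.
- by apply: measurable_fun_sqrt; exact: measurable_sos2.
- by move=> p; rewrite ger0_norm ?sqrtr_ge0// ler_wsqrtr.
Qed.

(** Fubini: on the slice with fixed second position y, [sos2 b] is a [sos] whose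
    coefficients depend on y, and slices of test functions are test functions. *)
Lemma weak_derivative_fst (b : I -> I -> R) (u t g : R3 R -> R) (v : R3 R) :
  (forall k l, 0 <= b k l) ->
  u \in Lfun leb3 2%:E -> t \in Lfun leb3 2%:E -> g \in Lfun leb3 2%:E ->
  weak_derivative (Rintegral leb3 setT) v u g ->
  exists2 w, w \in Lfun leb6 2%:E &
    weak_derivative (Rintegral leb6 setT) (v, 0)
      (fun p => u p.1 * t p.2 * Num.sqrt (sos2 b p)) w.
Proof.
move=> b0 uL tL gL wd.
pose c y k := sos chi (b k) y.
have [C C0 hC] := coef_bounded b0.
pose q p := half_derive_sos chi (c p.2) v p.1 / Num.sqrt (sos2 b p).
have [Bd hBd] := choice (fun i => let: And3 _ _ h := nchi i in h v).
pose K := Num.sqrt C * \sum_i Bd i.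
have K0 : 0 <= K.
  rewrite mulr_ge0// ?sqrtr_ge0// sumr_ge0// => i _.
  exact: le_trans (hBd i 0).
have qK p : `|q p| <= K.
  have [s0|s0] := eqVneq (Num.sqrt (sos2 b p)) 0.
    by rewrite /q s0 invr0 mulr0 normr0.
  have sp : 0 < Num.sqrt (sos2 b p) by rewrite lt_neqAle eq_sym s0 sqrtr_ge0.
  rewrite normrM normfV (gtr0_norm sp) ler_pdivrMr//.
  by apply: half_derive_sos_bound => // i; exact: hC.
have mq : measurable_fun setT q.
  apply: measurable_funM; last by apply: measurable_fun_inv; apply: measurable_fun_sqrt; exact: measurable_sos2.
  apply: measurable_sum => k; apply: measurable_funM; first apply: measurable_funM.
  - by apply: measurableT_comp; [exact: measurable_sos|exact: measurable_snd].
  - by apply: measurableT_comp; [exact: mchi|exact: measurable_fst].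
  - apply: (@measurableT_comp _ _ _ _ _ _ ('D_v (chi k)) _ fst) => //.
    exact: continuous_measurable3 (smooth_continuous (smooth_derive v (schi k))).
pose w p := g p.1 * t p.2 * Num.sqrt (sos2 b p) + u p.1 * t p.2 * q p.
have wL : w \in Lfun leb6 2%:E.
  apply: Lfun2D; first exact: root_Lfun2.
  by apply: Lfun2_mulbounded mq qK; exact: tensor_Lfun2.
exists w => // phi tphi.
have fL := root_Lfun2 b0 uL tL.
have I1 := Lfun2_integrableM fL (test_function_Lfun6 (test_function_derive (v, 0) tphi)).
have I2 := Lfun2_integrableM wL (test_function_Lfun6 tphi).
apply/(Rintegral_oppE I1 I2).
have I12 : leb6.-integrable setT (fun p => (u p.1 * t p.2 * Num.sqrt (sos2 b p) *
    'D_(v, 0) phi p + w p * phi p)%:E).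
  under eq_fun do rewrite EFinD; exact: integrableD.
rewrite -[LHS](@integral21_prod_meas1 _ _ _ _ _ leb3 leb3 _ I12) /fubini_G.
rewrite integral0_eq// => y _.
have slice_affine (h : R) (a x : R3 R) : (h *: a + x, y) = h *: (a, 0 : R3 R) + (x, y).
  by congr (_, _); rewrite /= scaler0 add0r.
have tslice : test_function (fun x => phi (x, y)).
  apply: (@test_function_affine _ _ _ (fun x => (x, y)) (fun a => (a, 0)) fst) => //.
  - move=> x A [[P Q] /= [nP nQ] PQ]; apply: filterS nP => z Pz.
    by apply: PQ; split=> //; exact: nbhs_singleton.
  - by move=> p; exact: cvg_fst.
have c0 k : 0 <= c y k by exact: sos_ge0.
have [] := weak_derivative_root nchi c0 uL gL wd tslice.
set J := (X in EFin \o X) => IJ J0.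
have E x : (u x * t y * Num.sqrt (sos2 b (x, y)) * 'D_(v, 0) phi (x, y) +
    w (x, y) * phi (x, y))%:E = ((t y)%:E * (J x)%:E)%E.
  rewrite -EFinM; congr EFin; rewrite /J /w /q.
  rewrite (@derive_affine _ _ _ (fun x => (x, y)) (fun a => (a, 0)))//.
  by rewrite /sos2 /c /=; ring.
under eq_integral => x _ do rewrite E.
rewrite integralZl ?J0 ?mule0//.
Qed.

End two_electrons.

Section swapped_derivative.
Context {R : realType}.

Lemma Rintegral_swap (f : R6 R -> R) : measurable_fun setT f ->
  Rintegral leb6 setT (fun p => f (swap p)) = Rintegral leb6 setT f.
Proof.
move=> mf; congr fine.
exact: (integral_swap leb3 ((measurable_EFinP _ _).2 mf)).
Qed.

Lemma Lfun2_swap (f : R6 R -> R) : f \in Lfun leb6 2%:E ->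
  (fun p => f (swap p)) \in Lfun leb6 2%:E.
Proof.
move=> /Lfun2P[mf If]; apply/Lfun2P; split.
  by apply: measurableT_comp => //; exact: measurable_swap.
have m2 : measurable_fun setT (fun p => (f p ^+ 2)%:E).
  exact/measurable_EFinP/measurable_funX.
have := ge0_integral_swap leb3 m2 => /(_ (fun p => sqr_ge0 (f p))) E.
by rewrite [X in (X < _)%E]E.
Qed.

Lemma weak_derivative_swap (v : R6 R) (u w : R6 R -> R) :
  u \in Lfun leb6 2%:E -> w \in Lfun leb6 2%:E ->
  weak_derivative (Rintegral leb6 setT) v u w ->
  weak_derivative (Rintegral leb6 setT) (swap v) (fun p => u (swap p))
    (fun p => w (swap p)).
Proof.
move=> /Lfun2P[mu _] /Lfun2P[mw _] wd phi tphi.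
have sw (h : R) (a x : R6 R) : swap (h *: a + x) = h *: swap a + swap x by [].
have tsw : test_function (fun p => phi (swap p)).
  have cs := @swap_continuous (R3 R) (R3 R).
  by apply: (@test_function_affine _ _ _ _ _ (@swap (R3 R) (R3 R)) _ cs cs _ sw tphi) => -[].
have /Lfun2P[mt _] := test_function_Lfun6 tsw.
have /Lfun2P[mdt _] := test_function_Lfun6 (test_function_derive v tsw).
have D p : 'D_v (fun p => phi (swap p)) (swap p) = 'D_(swap v) phi p.
  by rewrite (derive_affine phi (swap p) v sw); case: p.
have E1 : Rintegral leb6 setT (fun p => u (swap p) * 'D_(swap v) phi p) =
    Rintegral leb6 setT (fun p => u p * 'D_v (fun p => phi (swap p)) p).
  apply: etrans (Rintegral_swap (measurable_funM mu mdt)).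
  by apply: eq_Rintegral => p _ /=; rewrite D.
have E2 : Rintegral leb6 setT (fun p => w p * phi (swap p)) =
    Rintegral leb6 setT (fun p => w (swap p) * phi p).
  apply: etrans (esym (Rintegral_swap (measurable_funM mw mt))) _.
  by apply: eq_Rintegral => -[].
exact: (etrans E1 (etrans (wd _ tsw) (congr1 -%R E2))).
Qed.

(** The derivatives in the position of the second electron follow from those in the first
    one by exchanging the electrons, which transposes [b]. *)
Lemma weak_partials_root (I : finType) (chi : I -> R3 R -> R) (b : I -> I -> R)
    (s : R3 R -> R) (k : R) i j :
  (forall l, smooth_bounded (chi l)) -> (forall l l', 0 <= b l l') -> inH1 s ->
  weak_partials (position_dir i j)
    (fun p => k * (s p.1 * s p.2 * Num.sqrt (sos2 chi b p))) !=set0.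
Proof.
move=> nchi b0 [sL ds]; have [g gL wg] := ds j.
have ksL : (fun x => s x * k) \in Lfun leb3 2%:E.
  exact: (Lfun2_mulbounded sL (measurable_cst k) (fun=> lexx `|k|)).
have E (b' : I -> I -> R) :
    (fun p => s p.1 * (s p.2 * k) * Num.sqrt (sos2 chi b' p)) =
    (fun p => k * (s p.1 * s p.2 * Num.sqrt (sos2 chi b' p))).
  by apply/funext => p; ring.
rewrite /position_dir; case: ifPn => _.
  have [w wL wd] := weak_derivative_fst nchi b0 sL ksL gL wg.
  by exists w; rewrite -E.
have bT l l' : 0 <= b l' l by exact: b0.
have [w wL wd] := weak_derivative_fst nchi bT sL ksL gL wg.
exists (fun p => w (swap p)); split; first exact: Lfun2_swap.
have := weak_derivative_swap (root_Lfun2 nchi bT sL ksL) wL wd.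
congr weak_derivative; apply/funext => p; rewrite sos2_swap /=.
by ring.
Qed.

End swapped_derivative.

(** * Rerouting a discrete plan away from the diagonal *)

Section reroute.
Context {R : realFieldType} {I : finType}.
Variables (G : I * I -> R) (N F : pred (I * I)) (m : I -> R).
Hypothesis G0 : forall p, 0 <= G p.
Hypothesis rowG : forall k, \sum_l G (k, l) = m k.
Hypothesis colG : forall l, \sum_k G (k, l) = m l.
Hypothesis m1 : \sum_k m k = 1.
Hypothesis Fsym : forall k l, F (k, l) = F (l, k).
Hypothesis spread : forall l, \sum_(k | ~~ F (k, l)) m k <= 8^-1.
Hypothesis near_small : \sum_(p | N p) G p <= 8^-1.

(* N is the set of the bad pairs, F that of the pairs at a distance; [good p q]
   says that q is not bad, and that after swapping the partners in p and q both
   pairs are at a distance *)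
Let good (p q : I * I) := [&& ~~ N q, F (p.1, q.2) & F (q.1, p.2)].

Let S p := \sum_(q | good p q) G q.

Let sum_pair (H : I * I -> R) : \sum_p H p = \sum_k \sum_l H (k, l).
Proof. by rewrite pair_bigA; apply: eq_bigr => -[]. Qed.

Let total : \sum_p G p = 1.
Proof. by rewrite -m1 sum_pair; apply: eq_bigr. Qed.

Let sum_fst (f : I -> R) (Q : pred I) :
  \sum_(q | Q q.1) f q.1 * G q = \sum_(k | Q k) f k * m k.
Proof.
rewrite big_mkcond sum_pair [RHS]big_mkcond; apply: eq_bigr => k _ /=.
by case: (Q k); [rewrite -mulr_sumr rowG|rewrite big1].
Qed.

Let sum_snd (f : I -> R) (Q : pred I) :
  \sum_(q | Q q.2) f q.2 * G q = \sum_(l | Q l) f l * m l.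
Proof.
rewrite big_mkcond sum_pair exchange_big [RHS]big_mkcond; apply: eq_bigr => k _ /=.
by case: (Q k); [rewrite -mulr_sumr colG|rewrite big1].
Qed.

(** Union bound: a good partner is excluded by three events, of mass 1/8 each. *)
Let S_ge p : 2^-1 <= S p.
Proof.
have H : \sum_q G q <= S p + (\sum_(q | N q) G q +
    (\sum_(q | ~~ F (q.2, p.1)) G q + \sum_(q | ~~ F (q.1, p.2)) G q)).
  rewrite /S [\sum_(q | good p q) _]big_mkcond [\sum_(q | N q) _]big_mkcond [\sum_(q | ~~ F (q.2, _)) _]big_mkcond.
  rewrite [\sum_(q | ~~ F (q.1, _)) _]big_mkcond -!big_split /=; apply: ler_sum => q _.
  rewrite /good (Fsym p.1); have := G0 q.
  case: (N q); case: (F (q.2, p.1)); case: (F (q.1, p.2)) => /= ?; lra.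
have A1 : \sum_(q | ~~ F (q.2, p.1)) G q <= 8^-1.
  apply: le_trans (spread p.1).
  rewrite le_eqVlt; apply/orP; left; apply/eqP.
  under eq_bigr do rewrite -[G _]mul1r.
  rewrite (sum_snd (fun=> 1) (fun l => ~~ F (l, p.1))).
  by under eq_bigr do rewrite mul1r.
have A2 : \sum_(q | ~~ F (q.1, p.2)) G q <= 8^-1.
  apply: le_trans (spread p.2).
  rewrite le_eqVlt; apply/orP; left; apply/eqP.
  under eq_bigr do rewrite -[G _]mul1r.
  rewrite (sum_fst (fun=> 1) (fun l => ~~ F (l, p.2))).
  by under eq_bigr do rewrite mul1r.
move: H near_small A1 A2; rewrite total; lra.
Qed.

Let S_gt0 p : 0 < S p.
Proof. by apply: lt_le_trans (S_ge p); rewrite invr_gt0. Qed.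

(** The mass that the bad pair p exchanges with q: the whole mass of p is distributed
    over its good partners in proportion to their masses. *)
Let theta p q := if N p && good p q then G p * G q / S p else 0.

Let theta_ge0 p q : 0 <= theta p q.
Proof. by rewrite /theta; case: ifP => // _; rewrite divr_ge0 ?mulr_ge0// ltW. Qed.

Let theta_row p : \sum_q theta p q = if N p then G p else 0.
Proof.
rewrite /theta; case: (N p) => /=; last by rewrite big1.
rewrite -big_mkcond /= -mulr_suml -mulr_sumr -/(S p).
by rewrite mulfK// gt_eqF.
Qed.

(** Bad pairs are deleted, every good partner q of a bad pair p gives the mass [theta p q],
    and the same mass is put on both of the pairs (p.1, q.2) and (q.1, p.2). *)
Definition rerouted (r : I * I) : R :=
  (if N r then 0 else G r) - \sum_p theta p r +
  \sum_p \sum_q theta p q *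
    ((r == (p.1, q.2))%:R + (r == (q.1, p.2))%:R).

Lemma sum_rerouted (f : I * I -> R) :
  \sum_r rerouted r * f r = \sum_(r | ~~ N r) G r * f r +
    \sum_p \sum_q theta p q * (f (p.1, q.2) + f (q.1, p.2) - f q).
Proof.
have E r : rerouted r * f r = (if ~~ N r then G r * f r else 0) +
    (\sum_p \sum_q (theta p q * ((r == (p.1, q.2))%:R + (r == (q.1, p.2))%:R) * f r) -
     \sum_p theta p r * f r).
  rewrite /rerouted mulrDl mulrBl addrAC -addrA; congr (_ + (_ - _)).
  - by case: (N r) => //=; rewrite mul0r.
  - by rewrite mulr_suml; apply: eq_bigr => p _; rewrite mulr_suml.
  - by rewrite mulr_suml.
rewrite (eq_bigr _ (fun r _ => E r)) big_split /= -big_mkcond; congr (_ + _).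
rewrite sumrB exchange_big /= [X in _ - X]exchange_big /= -sumrB.
apply: eq_bigr => p _; rewrite exchange_big /= -sumrB; apply: eq_bigr => q _.
have D (a : I * I) : \sum_r (r == a)%:R * f r = f a.
  rewrite (bigD1 a)//= eqxx mul1r big1 ?addr0// => r /negbTE ->.
  by rewrite mul0r.
under eq_bigr do rewrite -mulrA mulrDl.
by rewrite -mulr_sumr big_split /= !D; ring.
Qed.

(** A pair r gives at most G r times the total mass of the bad pairs, divided by
    the lower bound 1/2 of [S]: at most G r / 4. *)
Lemma rerouted_ge0 r : 0 <= rerouted r.
Proof.
rewrite /rerouted addr_ge0//; last first.
  by apply: sumr_ge0 => p _; apply: sumr_ge0 => q _; rewrite mulr_ge0// addr_ge0.
rewrite subr_ge0; case: ifPn => Nr.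
  by rewrite big1// => p _; rewrite /theta /good Nr andbF.
apply: (@le_trans _ _ (\sum_(p | N p) G p * G r * 2)).
  rewrite [leRHS]big_mkcond /=; apply: ler_sum => p _; rewrite /theta.
  case: (N p) => //=; case: ifP => _; last by rewrite !mulr_ge0.
  by rewrite ler_wpM2l ?mulr_ge0// -[leRHS]invrK lef_pV2 ?posrE ?invr_gt0.
rewrite -mulr_suml -mulr_suml; have := near_small; have := G0 r; nra.
Qed.

Lemma rerouted_row k : \sum_l rerouted (k, l) = m k.
Proof.
have E : \sum_l rerouted (k, l) = \sum_r rerouted r * (r.1 == k)%:R.
  rewrite sum_pair /=.
  rewrite [RHS](bigD1 k)//= [X in _ = _ + X]big1 ?addr0; last first.
    by move=> i /negbTE ik; apply: big1 => j _; rewrite ik mulr0.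
  by apply: eq_bigr => l _; rewrite eqxx mulr1.
rewrite E sum_rerouted /=.
have E2 p : \sum_q theta p q * ((p.1 == k)%:R + (q.1 == k)%:R - (q.1 == k)%:R) =
    if N p then G p * (p.1 == k)%:R else 0.
  under eq_bigr do rewrite addrK.
  by rewrite -mulr_suml theta_row; case: (N p) => //; rewrite mul0r.
rewrite (eq_bigr _ (fun p _ => E2 p)) -big_mkcond /= addrC.
transitivity (\sum_r G r * (r.1 == k)%:R); first by rewrite [RHS](bigID N).
under eq_bigr do rewrite mulrC.
rewrite (sum_fst (fun i => (i == k)%:R) xpredT).
rewrite (bigD1 k)//= eqxx mul1r big1 ?addr0// => i /negbTE ->.
by rewrite mul0r.
Qed.

Lemma rerouted_col l : \sum_k rerouted (k, l) = m l.
Proof.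
have E : \sum_k rerouted (k, l) = \sum_r rerouted r * (r.2 == l)%:R.
  rewrite sum_pair /=.
  rewrite exchange_big [RHS](bigD1 l)//= [X in _ = _ + X]big1 ?addr0; last first.
    by move=> i /negbTE ik; apply: big1 => j _; rewrite ik mulr0.
  by apply: eq_bigr => k _; rewrite eqxx mulr1.
rewrite E sum_rerouted /=.
have E2 p : \sum_q theta p q * ((q.2 == l)%:R + (p.2 == l)%:R - (q.2 == l)%:R) =
    if N p then G p * (p.2 == l)%:R else 0.
  under eq_bigr do rewrite addrAC subrr add0r.
  by rewrite -mulr_suml theta_row; case: (N p) => //; rewrite mul0r.
rewrite (eq_bigr _ (fun p _ => E2 p)) -big_mkcond /= addrC.
transitivity (\sum_r G r * (r.2 == l)%:R); first by rewrite [RHS](bigID N).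
under eq_bigr do rewrite mulrC.
rewrite (sum_snd (fun i => (i == l)%:R) xpredT).
rewrite (bigD1 l)//= eqxx mul1r big1 ?addr0// => i /negbTE ->.
by rewrite mul0r.
Qed.

Lemma rerouted_support r : rerouted r != 0 -> ~~ N r || F r.
Proof.
apply: contraNT; rewrite negb_or negbK => /andP[Nr Fr].
rewrite /rerouted Nr big1 ?subr0 ?add0r; last first.
  by move=> p _; rewrite /theta /good Nr andbF.
apply/eqP; apply: big1 => p _; apply: big1 => q _; rewrite /theta.
case: ifP => [/andP[_ /and3P[_ F1 F2]]|_]; last by rewrite mul0r.
have /negbTE -> : r != (p.1, q.2) by apply: contraNneq Fr => ->.
have /negbTE -> : r != (q.1, p.2) by apply: contraNneq Fr => ->.
by rewrite addr0 mulr0.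
Qed.

(** The nonnegative cost of the mass taken from the partners is thrown away. *)
Lemma rerouted_cost (c : I * I -> R) (K : R) : (forall p, 0 <= c p) ->
  (forall p, F p -> c p <= K) ->
  \sum_r rerouted r * c r <=
  \sum_(r | ~~ N r) G r * c r + 2 * K * \sum_(p | N p) G p.
Proof.
move=> c0 cK; rewrite sum_rerouted lerD2l [X in _ * X]big_mkcond mulr_sumr /=.
apply: ler_sum => p _; rewrite -theta_row mulr_sumr; apply: ler_sum => q _.
rewrite /theta; case: ifP => [/andP[_ /and3P[_ F1 F2]]|_]; last by rewrite !mul0r mulr0.
rewrite [leRHS]mulrC ler_wpM2l//; first by rewrite divr_ge0 ?mulr_ge0// ltW.
have := cK _ F1; have := cK _ F2; have := c0 q; lra.
Qed.

End reroute.

(** * Plans, their marginals and the masses of sets *)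

Section measures_with_density.
Local Open Scope ereal_scope.
Context d (T : measurableType d) (R : realType).
Variables (lam nu : {measure set T -> \bar R}) (w : T -> R).
Hypothesis mw : measurable_fun setT w.
Hypothesis w0 : forall x, (0 <= w x)%R.
Hypothesis nuE : forall A, measurable A -> nu A = \int[lam]_(x in A) (w x)%:E.

Import HBNNSimple.

(** Monotone approximation by simple functions, for which it is the hypothesis. *)
Lemma ge0_integral_density (h : T -> \bar R) : measurable_fun setT h ->
  (forall x, 0 <= h x) -> \int[nu]_x h x = \int[lam]_x (h x * (w x)%:E).
Proof.
move=> mh h0.
pose f_ := nnsfun_approx measurableT mh.
have cvf x : (f_ n x)%:E @[n --> \oo] --> h x.
  by apply: cvg_nnsfun_approx => // *; exact: h0.
have ndf x (a b : nat) : (a <= b)%N -> (f_ a x)%:E <= (f_ b x)%:E.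
  by move=> ab; rewrite lee_fin; exact/lefP/nd_nnsfun_approx.
transitivity (limn (fun n => \int[nu]_x (f_ n x)%:E)).
  rewrite -monotone_convergence//.
  - by apply: eq_integral => x _; apply/esym/cvg_lim => //; exact: cvf.
  - by move=> n; exact/measurable_EFinP/measurable_funP.
  - by move=> n x _; rewrite lee_fin.
  - by move=> x _ a b ab; exact: ndf.
rewrite [X in limn X](_ : _ = (fun n => \int[lam]_x ((f_ n x)%:E * (w x)%:E))).
  rewrite -monotone_convergence//.
  - apply: eq_integral => x _; apply/cvg_lim => //.
    by apply: cvgeZr => //; exact: cvf.
  - by move=> n; apply: emeasurable_funM; apply/measurable_EFinP.
  - by move=> n x _; rewrite mule_ge0 ?lee_fin.
  - by move=> x _ a b ab; rewrite lee_wpmul2r ?lee_fin//; exact: ndf.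
apply/funext => n.
transitivity (\sum_(k \in range (f_ n))
    \int[lam]_x ((k * \1_(f_ n @^-1` [set k]) x)%:E * (w x)%:E)).
  under eq_integral do rewrite fimfunE -fsumEFin//.
  rewrite ge0_integral_fsum//; last 2 first.
  - by move=> y; exact/measurable_EFinP/measurable_funM.
  - by move=> y x _; rewrite nnfun_muleindic_ge0.
  apply: eq_fsbigr => r; rewrite inE => -[z _ zr].
  have r0 : (0 <= r)%R by rewrite -zr fun_ge0.
  rewrite integralZl_indic_nnsfun// integral_indic// setIT nuE//.
  rewrite integral_mkcond -ge0_integralZl//.
  - apply: eq_integral => x _; rewrite EFinM -muleA; congr (_ * _).
    rewrite patchE indicE; case: ifP => _; first by rewrite mul1e.
    by rewrite mul0e.
  - by apply/(measurable_restrictT _ _).1 => //; apply/measurable_EFinP/measurable_funTS.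
  - by move=> x _; rewrite patchE; case: ifP; rewrite ?lee_fin.
rewrite -ge0_integral_fsum//.
- apply: eq_integral => x _; rewrite [in RHS]fimfunE -fsumEFin//.
  rewrite ge0_mule_fsuml// => k; exact: nnfun_muleindic_ge0.
- by move=> r; apply: emeasurable_funM; apply/measurable_EFinP => //; exact: measurable_funM.
- by move=> r x _; apply: mule_ge0; [exact: nnfun_muleindic_ge0|rewrite lee_fin].
Qed.

End measures_with_density.

Section marginals.
Context {R : realType}.
Variables (rho : R3 R -> R) (gamma : {measure set (R6 R) -> \bar R}).
Hypothesis hrho : densities rho.
Hypothesis hgamma : half_marginals rho gamma.

(** Half of the density, through the square of its root: equal to [rho] / 2 almost
    everywhere, but nonnegative everywhere. *)
Definition weight (x : R3 R) : R := 2^-1 * Num.sqrt (rho x) ^+ 2.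

Lemma weight_ge0 x : 0 <= weight x.
Proof. by rewrite mulr_ge0// ?invr_ge0// sqr_ge0. Qed.

Lemma measurable_weight : measurable_fun setT weight.
Proof.
have [mrho _ _ _] := hrho.
by apply: measurable_funM => //; apply: measurable_funX; exact: measurable_fun_sqrt.
Qed.

Lemma weight_ae : {ae leb3, forall x, weight x = 2^-1 * rho x}.
Proof.
have [_ rho0 _ _] := hrho.
by apply: filterS rho0 => x x0; rewrite /weight sqr_sqrtr.
Qed.

Lemma integral_weight_half (A : set (R3 R)) : measurable A ->
  (\int[leb3]_(x in A) (2^-1 * rho x)%:E = \int[leb3]_(x in A) (weight x)%:E)%E.
Proof.
move=> mA; apply: ae_eq_integral => //.
- apply/measurable_EFinP/measurable_funTS/measurable_funM => //.
  by case: hrho.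
- by apply/measurable_EFinP/measurable_funTS; exact: measurable_weight.
- by apply: filterS weight_ae => x wx _; rewrite /= wx.
Qed.

Lemma integral_weight1 : (\int[leb3]_x (weight x)%:E = 1)%E.
Proof.
rewrite -integral_weight_half//.
have [mrho _ _ I2] := hrho.
under eq_integral do rewrite EFinM.
rewrite integralZl//.
  rewrite I2 -EFinM mulVf//.
apply/integrableP; split; first exact/measurable_EFinP.
rewrite [X in (X < _)%E](_ : _ = 2%:E)%E ?ltry// -I2.
apply: ae_eq_integral => //.
- by apply: measurableT_comp => //; exact/measurable_EFinP.
- exact/measurable_EFinP.
- by have [_ rho0 _ _] := hrho; apply: filterS rho0 => x x0 _; rewrite /= ger0_norm.
Qed.

Lemma integral_marginal_fst (h : R3 R -> \bar R) : measurable_fun setT h ->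
  (forall x, 0 <= h x)%E ->
  (\int[gamma]_p h p.1 = \int[leb3]_x (h x * (weight x)%:E))%E.
Proof.
move=> mh h0.
have H : (\int[pushforward gamma fst]_x h x = \int[gamma]_p h p.1)%E.
  by rewrite ge0_integral_pushforward// preimage_setT.
rewrite -H; apply: ge0_integral_density => //.
- exact: measurable_weight.
- exact: weight_ge0.
- by move=> A mA; have [E _] := hgamma mA; rewrite -integral_weight_half.
Qed.

Lemma integral_marginal_snd (h : R3 R -> \bar R) : measurable_fun setT h ->
  (forall x, 0 <= h x)%E ->
  (\int[gamma]_p h p.2 = \int[leb3]_x (h x * (weight x)%:E))%E.
Proof.
move=> mh h0.
have H : (\int[pushforward gamma snd]_x h x = \int[gamma]_p h p.2)%E.
  by rewrite ge0_integral_pushforward// preimage_setT.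
rewrite -H; apply: ge0_integral_density => //.
- exact: measurable_weight.
- exact: weight_ge0.
- by move=> A mA; have [_ E] := hgamma mA; rewrite -integral_weight_half.
Qed.

Lemma plan_mass1 : gamma setT = 1%E.
Proof.
have [E _] := hgamma (@measurableT _ (R3 R)).
have -> : gamma setT = pushforward gamma fst setT by rewrite /pushforward preimage_setT.
by rewrite E integral_weight_half// integral_weight1.
Qed.

Definition mass (A : set (R3 R)) : \bar R := gamma (fst @^-1` A).

Lemma massE (A : set (R3 R)) : measurable A ->
  mass A = (\int[leb3]_(x in A) (weight x)%:E)%E.
Proof. by move=> mA; have [E _] := hgamma mA; rewrite -integral_weight_half. Qed.

Lemma mass_sndE (A : set (R3 R)) : measurable A -> gamma (snd @^-1` A) = mass A.
Proof.
move=> mA; have [E E'] := hgamma mA.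
by have : pushforward gamma snd A = pushforward gamma fst A by rewrite E' E.
Qed.

(** Continuity from above of a finite measure. *)
Lemma mass_vanish (E : nat -> set (R3 R)) : (forall n, measurable (E n)) ->
  (forall n, E n.+1 `<=` E n) -> (forall x, exists n, ~ E n x) ->
  forall e : R, 0 < e -> exists n, (mass (E n) <= e%:E)%E.
Proof.
move=> mE dE noE e e0.
pose F n : set (R6 R) := fst @^-1` E n.
have mF n : measurable (F n).
  have -> : F n = E n `*` setT by apply/seteqP; split=> p //= -[].
  exact: measurableX.
have F0 : (gamma (F 0%N) < +oo)%E.
  apply: (@le_lt_trans _ _ (gamma setT)); first by apply: le_measure; rewrite ?inE.
  by rewrite plan_mass1 ltry.
have IF : \bigcap_n F n = set0.
  apply/seteqP; split=> // x Fx; have [n] := noE x.1; apply.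
  exact: (Fx n I).
have ni : nonincreasing_seq F.
  apply/nonincreasing_seqP => n; apply/subsetPset => x; exact: dE.
have := nonincreasing_cvg_mu F0 mF.
rewrite IF measure0 => /(_ measurable0 ni).
move=> /fine_cvgP[Ffin /cvgrPdist_le /(_ e e0) [n _ Hn]].
have [n' _ Hn'] := Ffin.
exists (maxn n n').
have := Hn (maxn n n') (leq_maxl _ _); rewrite /= sub0r normrN.
have fn := Hn' (maxn n n') (leq_maxr _ _).
rewrite ger0_norm ?fine_ge0 ?measure_ge0// => H.
by rewrite [mass _](_ : _ = (gamma \o F) (maxn n n'))// -(fineK fn) lee_fin.
Qed.

Lemma measurable_mass_set (A : set (R3 R)) : measurable A ->
  measurable (fst @^-1` A : set (R6 R)).
Proof.
move=> mA; have -> : fst @^-1` A = A `*` setT :> set (R6 R).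
  by apply/seteqP; split=> p //= -[].
exact: measurableX.
Qed.

Lemma mass_le (A B : set (R3 R)) : measurable A -> measurable B -> A `<=` B ->
  (mass A <= mass B)%E.
Proof.
move=> mA mB AB; apply: le_measure; rewrite ?inE; try exact: measurable_mass_set.
by move=> p; exact: AB.
Qed.

Lemma massU (A B : set (R3 R)) : measurable A -> measurable B ->
  (mass (A `|` B) <= mass A + mass B)%E.
Proof.
by move=> mA mB; rewrite /mass preimage_setU; apply: measureU2; exact: measurable_mass_set.
Qed.

Definition tail (L : R) : set (R3 R) := [set x | exists c, L <= `|coord3 c x|].

Lemma measurable_abs_coord c : measurable_fun setT (fun x : R3 R => `|coord3 c x|).
Proof.
apply: continuous_measurable3 => x; apply: cvg_norm; exact: continuous_coord3.
Qed.

Lemma measurable_tail L : measurable (tail L).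
Proof.
have -> : tail L = \bigcup_(c in [set: 'I_3]) [set x | L <= `|coord3 c x|].
  by apply/seteqP; split=> [x [c cx]|x [c _ cx]]; exists c.
apply: fin_bigcup_measurable => [|c _]; first exact: finite_finset.
rewrite -[X in measurable X]setTI; apply: measurable_fun_le => //.
exact: measurable_abs_coord.
Qed.

(** The tails decrease to the empty set. *)
Lemma mass_tail (e : R) : 0 < e -> exists2 L, 0 < L & (mass (tail L) <= e%:E)%E.
Proof.
move=> e0; have [||| n hn] := @mass_vanish (fun n => tail n.+1%:R) _ _ _ e e0.
- by move=> n; exact: measurable_tail.
- by move=> n x [c cx]; exists c; rewrite (le_trans _ cx)// ler_nat.
- move=> x; exists (\max_(c < 3) (Num.trunc `|coord3 c x|)) => -[c].
  apply/negP; rewrite -ltNge (lt_le_trans (truncnS_gt _))// ler_nat ltnS.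
  exact: (leq_bigmax c).
by exists n.+1%:R.
Qed.

Definition slab (t r : R) : set (R3 R) := [set x | `|coord3 ord0 x - t| <= r].

Lemma measurable_slab t r : measurable (slab t r).
Proof.
rewrite -[X in measurable X]setTI; apply: measurable_fun_le => //.
apply: continuous_measurable3 => x; apply: cvg_norm; apply: cvgB; last exact: cvg_cst.
exact: continuous_coord3.
Qed.

(** Uniform absence of mass on planes.  Up to a small mass, the weight is
    concentrated where it is at most M and in the cube of half-side L; there the
    mass of a slab is at most M times its volume 8 r L^2, whatever its position. *)
Lemma mass_slab (e : R) : 0 < e ->
  exists2 r, 0 < r & forall t, (mass (slab t r) <= e%:E)%E.
Proof.
move=> e0; have e3 : 0 < e / 3 by rewrite divr_gt0.
have [L L0 hL] := mass_tail e3.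
pose E n : set (R3 R) := [set x | n%:R <= weight x].
have mE n : measurable (E n).
  rewrite -[X in measurable X]setTI; apply: measurable_fun_le => //.
  exact: measurable_weight.
have [|| M hM] := @mass_vanish E mE _ _ _ e3.
- by move=> n x; rewrite /E /=; apply: le_trans; rewrite ler_nat.
- move=> x; exists (Num.trunc (weight x)).+1; apply/negP; rewrite -ltNge.
  exact: truncnS_gt.
pose r := e / (24 * (M%:R + 1) * (L + 1) ^+ 2).
have den0 : 0 < 24 * (M%:R + 1) * (L + 1) ^+ 2 :> R.
  have M1 : 0 < M%:R + 1 :> R by rewrite ltr_wpDl.
  have L1 : 0 < L + 1 by rewrite addr_gt0.
  by rewrite mulr_gt0 ?exprn_gt0// mulr_gt0.
have r0 : 0 < r by rewrite divr_gt0.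
exists r => // t.
pose B : set (R3 R) := (`[t - r, t + r] `*` `[- L, L]) `*` `[- L, L].
have mB : measurable B by apply: measurableX => //; exact: measurableX.
pose D := B `&` ~` E M.
have mD : measurable D by apply: measurableI => //; exact: measurableC.
have sub : slab t r `<=` (tail L `|` E M) `|` D.
  move=> x sx; have [tx|ntx] := pselect (tail L x); first by left; left.
  have [ex|nex] := pselect (E M x); first by left; right.
  right; split=> //.
  have nt c : `|coord3 c x| <= L.
    by rewrite leNgt; apply/negP => /ltW H; apply: ntx; exists c.
  move: sx (nt (@Ordinal 3 1 isT)) (nt (@Ordinal 3 2 isT)).
  rewrite /slab /B /coord3 /= !(tnth_nth 0)/= ler_distl !ler_norml.
  by move=> ? ? ?; rewrite !in_itv.
apply: (le_trans (mass_le (measurable_slab t r) _ sub)).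
  by apply: measurableU => //; apply: measurableU => //; exact: measurable_tail.
apply: (le_trans (massU _ mD)); first by apply: measurableU => //; exact: measurable_tail.
have H1 : (mass (tail L `|` E M) <= (e / 3)%:E + (e / 3)%:E)%E.
  by apply: (le_trans (massU (measurable_tail L) (mE M))); exact: leeD.
have lB : leb3 B = ((2 * r) * (2 * L) * (2 * L))%:E.
  have l1 (a b : R) : a <= b -> leb1 `[a, b] = (b - a)%:E.
    rewrite /leb1 (@lebesgue_measure_itv R `[a, b])/= lte_fin le_eqVlt.
    by move=> /orP[/eqP ->|->//]; rewrite ltxx subrr.
  have -> : leb3 B = (leb2 (`[(t - r)%R, (t + r)%R] `*` `[(- L)%R, L]) * leb1 `[(- L)%R, L])%E.
    by rewrite /leb3 product_measure1E//; exact: measurableX.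
  have -> : leb2 (`[(t - r), (t + r)] `*` `[(- L), L]) = (leb1 `[(t - r)%R, (t + r)%R] * leb1 `[(- L)%R, L])%E.
    by rewrite /leb2 product_measure1E.
  have tr : t - r <= t + r by move: r0; lra.
  have LL : - L <= L by move: L0; lra.
  by rewrite (l1 _ _ tr) (l1 _ _ LL) -!EFinM; congr EFin; ring.
have H2 : (mass D <= (e / 3)%:E)%E.
  rewrite massE//.
  apply: (@le_trans _ _ (\int[leb3]_(x in D) (cst M%:R%:E x))%E).
    apply: ge0_le_integral => //.
    - by move=> x _; rewrite lee_fin weight_ge0.
    - by apply/measurable_EFinP/measurable_funTS; exact: measurable_weight.
    - by move=> x [_ /negP]; rewrite -ltNge lee_fin => /ltW.
  rewrite integral_cst//.
  apply: (@le_trans _ _ (M%:R%:E * leb3 B)%E).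
    rewrite lee_wpmul2l ?lee_fin//; apply: le_measure; rewrite ?inE//.
    exact: subIsetl.
  rewrite lB -EFinM lee_fin.
  have M0 : 0 <= M%:R :> R by [].
  have rE : r * (24 * (M%:R + 1) * (L + 1) ^+ 2) = e by rewrite divfK// gt_eqF.
  have ML : M%:R * L ^+ 2 <= (M%:R + 1) * (L + 1) ^+ 2.
    by rewrite ler_pM ?sqr_ge0// ?lerDl// lerXn2r// ?nnegrE ?lerDl// ltW// addr_gt0.
  have -> : M%:R * (2 * r * (2 * L) * (2 * L)) = 8 * r * (M%:R * L ^+ 2) by ring.
  have -> : e / 3 = 8 * r * ((M%:R + 1) * (L + 1) ^+ 2) by rewrite -rE; field.
  by rewrite ler_wpM2l// mulr_ge0// ltW.
apply: (le_trans (leeD H1 H2)); rewrite -!EFinD lee_fin; lra.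
Qed.

End marginals.

(** * The Coulomb cost of a density built from cells *)

Section coulomb.
Context {R : realType}.
Implicit Types x y u v : R3 R.

Lemma euclidean_norm_ge0 x : 0 <= euclidean_norm x.
Proof. exact: sqrtr_ge0. Qed.

Lemma sqr_euclidean_norm x :
  euclidean_norm x ^+ 2 = x.1.1 ^+ 2 + x.1.2 ^+ 2 + x.2 ^+ 2.
Proof. by rewrite sqr_sqrtr// !addr_ge0 ?sqr_ge0. Qed.

Lemma coord3_le_norm c x : `|coord3 c x| <= euclidean_norm x.
Proof.
rewrite -sqrtr_sqr ler_wsqrtr//.
have := (sqr_ge0 x.1.1, sqr_ge0 x.1.2, sqr_ge0 x.2) => -[[h1 h2] h3].
by case: c => [] [|[|[|//]]] H; rewrite /coord3 (tnth_nth 0)/=; lra.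
Qed.

(** A crude form of the triangle inequality; the constant 3 (instead of the root
    of 3) keeps the proof polynomial. *)
Lemma euclidean_norm_perturb u v (e : R) : 0 <= e ->
  (forall c, `|coord3 c v - coord3 c u| <= e) ->
  euclidean_norm v <= euclidean_norm u + 3 * e.
Proof.
move=> e0 H; have n0 := euclidean_norm_ge0 u.
have K c : `|coord3 c v| <= `|coord3 c u| + e.
  by rewrite -lerBlDl (le_trans (lerB_dist _ _)).
have S c : coord3 c v ^+ 2 <= coord3 c u ^+ 2 + 2 * e * euclidean_norm u + e ^+ 2.
  rewrite -[coord3 c v ^+ 2]real_normK ?num_real//.
  have := K c; have := coord3_le_norm c u; have := normr_ge0 (coord3 c v).
  rewrite -[coord3 c u ^+ 2]real_normK ?num_real//; have := normr_ge0 (coord3 c u); nra.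
rewrite -(@ler_pXn2r _ 2)// ?nnegrE ?euclidean_norm_ge0 ?addr_ge0 ?mulr_ge0//.
rewrite sqr_euclidean_norm.
have := sqr_euclidean_norm u.
have := (S (@Ordinal 3 0 isT), S (@Ordinal 3 1 isT), S (@Ordinal 3 2 isT)) => -[[]].
rewrite /coord3 !(tnth_nth 0)/=; set E := euclidean_norm u in n0 *; nra.
Qed.

Lemma coulomb_ge0 x y : (0 <= coulomb x y)%E.
Proof. by rewrite /coulomb inve_ge0 lee_fin euclidean_norm_ge0. Qed.

Lemma coulombC x y : coulomb x y = coulomb y x.
Proof.
rewrite /coulomb; congr (_%:E^-1)%E.
by rewrite /euclidean_norm -opprB /= !sqrrN.
Qed.

Lemma coulomb_le x y (r : R) : 0 < r -> r <= euclidean_norm (x - y) ->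
  (coulomb x y <= r^-1%:E)%E.
Proof.
move=> r0 rn; have n0 : 0 < euclidean_norm (x - y) by exact: lt_le_trans rn.
by rewrite /coulomb inver gt_eqF// lee_fin lef_pV2// posrE.
Qed.

Lemma coulomb_ge x y (r : R) : 0 < r -> euclidean_norm (x - y) <= r ->
  (r^-1%:E <= coulomb x y)%E.
Proof.
move=> r0 rn; rewrite /coulomb inver; case: ifPn => [_|n0]; first by rewrite leey.
have np : 0 < euclidean_norm (x - y) by rewrite lt_neqAle eq_sym n0 euclidean_norm_ge0.
by rewrite lee_fin lef_pV2// posrE.
Qed.

Lemma measurable_dist : measurable_fun setT (fun p : R6 R => euclidean_norm (p.1 - p.2)).
Proof.
have m (c : 'I_3) : measurable_fun setT (fun p : R6 R => coord3 c (p.1 - p.2)).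
  under eq_fun do rewrite coord3B.
  apply: measurable_funB.
    apply: (@measurableT_comp _ _ _ _ _ _ (coord3 c) _ fst) => //.
    exact: continuous_measurable3 (@continuous_coord3 R c).
  apply: (@measurableT_comp _ _ _ _ _ _ (coord3 c) _ snd) => //.
  exact: continuous_measurable3 (@continuous_coord3 R c).
have E : (fun p : R6 R => euclidean_norm (p.1 - p.2)) = (fun p =>
    Num.sqrt (coord3 (@Ordinal 3 0 isT) (p.1 - p.2) ^+ 2 +
      coord3 (@Ordinal 3 1 isT) (p.1 - p.2) ^+ 2 +
      coord3 (@Ordinal 3 2 isT) (p.1 - p.2) ^+ 2)).
  by apply/funext => p; rewrite /coord3 !(tnth_nth 0).
rewrite E; apply: measurable_fun_sqrt.
apply: measurable_funD; [apply: measurable_funD|]; apply: measurable_funX; exact: m.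
Qed.

Lemma measurable_coulomb : measurable_fun setT (fun p : R6 R => coulomb p.1 p.2).
Proof.
rewrite (_ : (fun p => _) = (fun p : R6 R =>
  if euclidean_norm (p.1 - p.2) == 0 then +oo%E
  else (euclidean_norm (p.1 - p.2))^-1%:E)); last first.
  by apply/funext => p; rewrite /coulomb inver.
apply: measurable_fun_ifT => //.
- apply: measurable_fun_eqr => //; exact: measurable_dist.
- by apply/measurable_EFinP; apply: measurable_fun_inv; exact: measurable_dist.
Qed.

End coulomb.

Section finite_partition.
Context d (T : measurableType d) {R : realType} (nu : {measure set T -> \bar R}).

Lemma sum_partition_le (J : finType) (g : J -> T -> R) (Q : pred J) (A : set T) :
  (forall j, measurable_fun setT (g j)) -> (forall j x, 0 <= g j x) ->
  (forall x, \sum_j g j x = 1) -> measurable A ->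
  (forall j, Q j -> forall x, g j x != 0 -> A x) ->
  (\sum_(j | Q j) \int[nu]_x (g j x)%:E <= nu A)%E.
Proof.
move=> mg g0 g1 mA gA.
rewrite -big_filter -ge0_integral_sum//; last 2 first.
- by move=> j; exact/measurable_EFinP.
- by move=> j x _; rewrite lee_fin.
under eq_integral do rewrite big_filter.
have -> : nu A = (\int[nu]_x (\1_A x)%:E)%E by rewrite integral_indic// setIT.
apply: ge0_le_integral => //.
- by move=> x _; apply: sume_ge0 => j _; rewrite lee_fin.
- under eq_fun do rewrite -big_filter.
  by apply: emeasurable_sum => j; exact/measurable_EFinP.
- exact/measurable_EFinP.
move=> x _; rewrite sumEFin lee_fin indicE.
have [Ax|nAx] := boolP (x \in A).
  rewrite -(g1 x) [leRHS](bigID Q)/= lerDl; exact: sumr_ge0.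
rewrite big1// => j Qj; apply/eqP; apply: contraNT nAx => /(gA j Qj).
by rewrite inE.
Qed.

End finite_partition.

Section weighted_partition.
Context {R : realType} {I : finType}.
Variables (chi : I -> R3 R -> R) (w : R3 R -> R).
Hypothesis nchi : forall i, smooth_bounded (chi i).
Hypothesis chi1 : forall x, \sum_i chi i x ^+ 2 = 1.
Hypothesis mw : measurable_fun setT w.
Hypothesis w0 : forall x, 0 <= w x.
Hypothesis w1 : (\int[leb3]_x (w x)%:E = 1)%E.

Definition cell_mass (k : I) : R := fine (\int[leb3]_x (chi k x ^+ 2 * w x)%:E)%E.

Lemma measurable_cell k : measurable_fun setT (chi k).
Proof. by have [sc _ _] := nchi k; exact: continuous_measurable3 (smooth_continuous sc). Qed.

Lemma sqr_cell_le1 k x : chi k x ^+ 2 <= 1.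
Proof.
by rewrite -(chi1 x) (bigD1 k)//= lerDl; apply: sumr_ge0 => i _; exact: sqr_ge0.
Qed.

Let mcw k : measurable_fun setT (fun x => chi k x ^+ 2 * w x).
Proof. by apply: measurable_funM => //; apply: measurable_funX; exact: measurable_cell. Qed.

Let cw0 k x : 0 <= chi k x ^+ 2 * w x.
Proof. by rewrite mulr_ge0// sqr_ge0. Qed.

Lemma cell_massE k : (\int[leb3]_x (chi k x ^+ 2 * w x)%:E = (cell_mass k)%:E)%E.
Proof.
rewrite /cell_mass fineK// ge0_fin_numE; last first.
  by apply: integral_ge0 => x _; rewrite lee_fin.
apply: (@le_lt_trans _ _ (\int[leb3]_x (w x)%:E)%E); last by rewrite w1 ltry.
apply: ge0_le_integral => //.
- by move=> x _; rewrite lee_fin.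
- exact/measurable_EFinP.
- exact/measurable_EFinP.
- by move=> x _; rewrite lee_fin ler_piMl// sqr_cell_le1.
Qed.

Lemma cell_mass_ge0 k : 0 <= cell_mass k.
Proof. by rewrite -lee_fin -cell_massE integral_ge0// => x _; rewrite lee_fin. Qed.

Variable a : I -> I -> R.
Hypothesis a0 : forall k l, 0 <= a k l.
Hypothesis rowa : forall k, \sum_l a k l = cell_mass k.
Hypothesis cola : forall l, \sum_k a k l = cell_mass l.

(** For an empty cell the denominator is 0 and so is the coefficient; then row and column of
    [a] vanish too. *)
Definition coef (k l : I) : R := a k l / (cell_mass k * cell_mass l).

Lemma coef_ge0 k l : 0 <= coef k l.
Proof. by rewrite divr_ge0// mulr_ge0// cell_mass_ge0. Qed.

Let a_col0 k l : cell_mass l = 0 -> a k l = 0.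
Proof.
move=> m0; apply/eqP; rewrite eq_le a0 andbT -m0 -cola (bigD1 k)//= lerDl.
exact: sumr_ge0.
Qed.

Let a_row0 k l : cell_mass k = 0 -> a k l = 0.
Proof.
move=> m0; apply/eqP; rewrite eq_le a0 andbT -m0 -rowa (bigD1 l)//= lerDl.
exact: sumr_ge0.
Qed.

Lemma coef_mass k l : coef k l * (cell_mass k * cell_mass l) = a k l.
Proof.
have [k0|k0] := eqVneq (cell_mass k) 0; first by rewrite (a_row0 _ k0) k0 mul0r mulr0.
have [l0|l0] := eqVneq (cell_mass l) 0; first by rewrite (a_col0 _ l0) l0 !mulr0.
by rewrite divfK// mulf_neq0.
Qed.

Lemma coef_row k : \sum_l coef k l * cell_mass l = (cell_mass k != 0)%:R.
Proof.
have [k0|k0] := eqVneq (cell_mass k) 0.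
  by rewrite big1// => l _; rewrite /coef (a_row0 _ k0) !mul0r.
rewrite (eq_bigr (fun l => a k l / cell_mass k)) -?mulr_suml ?rowa ?divff// => l _.
rewrite -(coef_mass k l); have [l0|l0] := eqVneq (cell_mass l) 0.
  by rewrite l0 !mulr0 mul0r.
by field.
Qed.

(** Coefficients of cells without mass are 0, so those cells are missing from the sum
    of the chi_k^2; the weight vanishes there. *)
Lemma null_cell_ae : {ae leb3, forall x, forall k, cell_mass k = 0 -> chi k x ^+ 2 * w x = 0}.
Proof.
apply: filter_forall => k.
have [m0|m0] := eqVneq (cell_mass k) 0; last first.
  by apply: aeW => x /eqP; rewrite (negbTE m0).
have : (\int[leb3]_x `|(chi k x ^+ 2 * w x)%:E| = 0)%E.
  by rewrite -[RHS]/(0%:E) -m0 -cell_massE; apply: eq_integral => x _; rewrite gee0_abs// lee_fin.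
move=> /(ae_eq_integral_abs _ measurableT) => /(_ ((measurable_EFinP _ _).2 (mcw k))).
by apply: filterS => x H _; exact: EFin_inj (H Logic.I).
Qed.

(** Integrating in y replaces chi_l(y)^2 by the mass of the cell l; summing over l then gives
    1 for each nonempty cell k ([coef_row]), and the sum of the chi_k^2 is 1. *)
Lemma density_marginal : {ae leb3, forall x,
  (\int[leb3]_y (w x * w y * sos2 chi coef (x, y))%:E = (w x)%:E)%E}.
Proof.
apply: filterS null_cell_ae => x nx.
have E y : (w x * w y * sos2 chi coef (x, y))%:E =
    (\sum_l (w x * \sum_k coef k l * chi k x ^+ 2)%:E * (chi l y ^+ 2 * w y)%:E)%E.
  rewrite sos2E exchange_big /= sumEFin; congr EFin; rewrite mulr_sumr.
  apply: eq_bigr => l _; rewrite mulr_sumr mulr_sumr mulr_suml.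
  by apply: eq_bigr => k _; ring.
have s0 l : 0 <= w x * \sum_k coef k l * chi k x ^+ 2.
  by rewrite mulr_ge0// sumr_ge0// => k _; rewrite mulr_ge0 ?coef_ge0// sqr_ge0.
under eq_integral do rewrite E.
rewrite ge0_integral_sum//; last 2 first.
- move=> l; apply: emeasurable_funM => //; exact/measurable_EFinP.
- by move=> l y _; rewrite -EFinM lee_fin mulr_ge0.
under eq_bigr => l _.
  rewrite ge0_integralZl//; last 3 first.
  - exact/measurable_EFinP.
  - by move=> y _; rewrite lee_fin.
  - by rewrite lee_fin.
  rewrite cell_massE -EFinM.
  over.
rewrite sumEFin; congr EFin.
rewrite (eq_bigr (fun l => \sum_k (w x * chi k x ^+ 2) * (coef k l * cell_mass l))); last first.
  by move=> l _; rewrite mulr_sumr mulr_suml; apply: eq_bigr => k _; ring.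
rewrite exchange_big /=.
under eq_bigr do rewrite -mulr_sumr coef_row.
transitivity (w x * \sum_k chi k x ^+ 2); last by rewrite chi1 mulr1.
rewrite mulr_sumr; apply: eq_bigr => k _.
have [/nx k0|_] := eqVneq (cell_mass k) 0; last by rewrite mulr1.
by rewrite mulr0 mulrC k0.
Qed.

(** On the product of the cells k and l the cost is at most c_kl, and the joint density
    has mass a_kl there. *)
Lemma density_cost (c : I -> I -> R) : (forall k l, 0 <= c k l) ->
  (forall k l x y, a k l != 0 -> chi k x != 0 -> chi l y != 0 ->
    (coulomb x y <= (c k l)%:E)%E) ->
  (\int[leb6]_p ((w p.1 * w p.2 * sos2 chi coef p)%:E * coulomb p.1 p.2) <=
   (\sum_k \sum_l a k l * c k l)%:E)%E.
Proof.
move=> c0 hc.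
pose h k x := chi k x ^+ 2 * w x.
have mh k : measurable_fun setT (h k) by exact: mcw.
have h0 k x : 0 <= h k x by exact: cw0.
have cc0 k l : 0 <= coef k l * c k l := mulr_ge0 (coef_ge0 k l) (c0 k l).
have hh0 k l p : 0 <= coef k l * c k l * (h k p.1 * h l p.2) :=
  mulr_ge0 (cc0 k l) (mulr_ge0 (h0 k p.1) (h0 l p.2)).
apply: (@le_trans _ _ (\int[leb6]_p \sum_k \sum_l
    ((coef k l * c k l)%:E * ((h k p.1)%:E * (h l p.2)%:E)))%E).
  apply: ge0_le_integral => //.
  - move=> p _; rewrite mule_ge0 ?coulomb_ge0// lee_fin mulr_ge0 ?mulr_ge0//.
    by apply: sos2_ge0 => k l; exact: coef_ge0.
  - apply: emeasurable_funM; last exact: measurable_coulomb.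
    apply/measurable_EFinP/measurable_funM; last exact: measurable_sos2.
    by apply: measurable_funM; apply: measurableT_comp.
  - apply: emeasurable_sum => k; apply: emeasurable_sum => l.
    apply: emeasurable_funM => //; apply: emeasurable_funM; apply/measurable_EFinP.
      exact: (measurableT_comp (mh k) measurable_fst).
    exact: (measurableT_comp (mh l) measurable_snd).
  move=> p _; rewrite sos2E.
  have E : (w p.1 * w p.2 * (\sum_k \sum_l coef k l * chi k p.1 ^+ 2 * chi l p.2 ^+ 2))%:E =
      (\sum_k \sum_l (coef k l * (h k p.1 * h l p.2))%:E)%E.
    under [in RHS]eq_bigr do rewrite sumEFin.
    rewrite sumEFin; congr EFin; rewrite mulr_sumr; apply: eq_bigr => k _.
    by rewrite mulr_sumr; apply: eq_bigr => l _; rewrite /h; ring.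
  have q0 k l : 0 <= coef k l * (h k p.1 * h l p.2).
    by rewrite mulr_ge0 ?coef_ge0// mulr_ge0.
  rewrite E ge0_sume_distrl; last first.
    by move=> k _; apply: sume_ge0 => l _; rewrite lee_fin.
  apply: lee_sum => k _; rewrite ge0_sume_distrl; last by move=> l _; rewrite lee_fin.
  apply: lee_sum => l _ /=.
  have -> : ((coef k l * c k l)%:E * ((h k p.1)%:E * (h l p.2)%:E) =
      (coef k l * (h k p.1 * h l p.2))%:E * (c k l)%:E)%E.
    by rewrite -!EFinM; congr EFin; ring.
  have [z|nz] := eqVneq (coef k l * (h k p.1 * h l p.2)) 0.
    by rewrite z !mul0e.
  rewrite lee_wpmul2l ?lee_fin//; apply: hc.
  - by apply: contraNneq nz => ak; rewrite /coef ak !mul0r.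
  - by apply: contraNneq nz => ck; rewrite /h ck expr0n !mul0r mulr0.
  - by apply: contraNneq nz => cl; rewrite /h cl expr0n !mul0r !mulr0.
rewrite ge0_integral_sum//; last 2 first.
- move=> k; apply: emeasurable_sum => l.
  apply: emeasurable_funM => //; apply: emeasurable_funM; apply/measurable_EFinP.
    exact: (measurableT_comp (mh k) measurable_fst).
  exact: (measurableT_comp (mh l) measurable_snd).
- by move=> k p _; apply: sume_ge0 => l _; rewrite -!EFinM lee_fin.
rewrite -sumEFin; apply: lee_sum => k _.
rewrite ge0_integral_sum//; last 2 first.
- move=> l; apply: emeasurable_funM => //; apply: emeasurable_funM; apply/measurable_EFinP.
    exact: (measurableT_comp (mh k) measurable_fst).
  exact: (measurableT_comp (mh l) measurable_snd).
- by move=> l p _; rewrite -!EFinM lee_fin.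
rewrite -sumEFin; apply: lee_sum => l _.
rewrite ge0_integralZl//; last 3 first.
- apply: emeasurable_funM; apply/measurable_EFinP.
    exact: (measurableT_comp (mh k) measurable_fst).
  exact: (measurableT_comp (mh l) measurable_snd).
- by move=> p _; rewrite -EFinM lee_fin mulr_ge0.
- by rewrite lee_fin.
have -> : (\int[leb6]_p ((h k p.1)%:E * (h l p.2)%:E) = (cell_mass k * cell_mass l)%:E)%E.
  rewrite [LHS](ge0_integral_tensor leb3 leb3 (f := EFin \o h k) (g := EFin \o h l)).
  - by rewrite /= !cell_massE.
  - exact/measurable_EFinP.
  - exact/measurable_EFinP.
  - by move=> x; rewrite lee_fin.
  - by move=> x; rewrite lee_fin.
by rewrite -EFinM lee_fin mulrAC coef_mass.
Qed.

End weighted_partition.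

(** * A near optimal density *)

Section discretized_plan.
Context {R : realType}.
Variables (rho : R3 R -> R) (gamma : {measure set (R6 R) -> \bar R}).
Hypothesis hrho : densities rho.
Hypothesis hgamma : half_marginals rho gamma.
Let W := weight rho.
Let mW : measurable_fun setT W. Proof. exact: measurable_weight hrho. Qed.
Let W0 x : 0 <= W x. Proof. exact: weight_ge0. Qed.
Let W1 : (\int[leb3]_x (W x)%:E = 1)%E. Proof. exact: integral_weight1 hrho. Qed.

Context {I : finType}.
Variable chi : I -> R3 R -> R.
Hypothesis nchi : forall i, smooth_bounded (chi i).
Hypothesis chi1 : forall x, \sum_i chi i x ^+ 2 = 1.

Definition cell2 (p : I * I) (z : R6 R) : R := chi p.1 z.1 ^+ 2 * chi p.2 z.2 ^+ 2.

Lemma cell2_ge0 p z : 0 <= cell2 p z.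
Proof. by rewrite mulr_ge0 ?sqr_ge0. Qed.

Lemma cell2_neq0 p z : cell2 p z != 0 -> chi p.1 z.1 != 0 /\ chi p.2 z.2 != 0.
Proof. by rewrite /cell2 mulf_eq0 !sqrf_eq0 negb_or => /andP. Qed.

Lemma sum_cell2 z : \sum_p cell2 p z = 1.
Proof.
rewrite -(pair_bigA _ (fun k l => chi k z.1 ^+ 2 * chi l z.2 ^+ 2)) /=.
by under eq_bigr do rewrite -mulr_sumr chi1 mulr1; rewrite chi1.
Qed.

Let mchi k : measurable_fun setT (chi k). Proof. exact: measurable_cell. Qed.

Lemma measurable_cell2 p : measurable_fun setT (cell2 p).
Proof.
apply: measurable_funM; apply: measurable_funX.
  exact: (measurableT_comp (mchi p.1) measurable_fst).
exact: (measurableT_comp (mchi p.2) measurable_snd).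
Qed.

Definition plan_mass (p : I * I) : R := fine (\int[gamma]_z (cell2 p z)%:E)%E.

Lemma cell2_le1 p z : cell2 p z <= 1.
Proof. by rewrite -(sum_cell2 z) (bigD1 p)//= lerDl sumr_ge0// => q _; exact: cell2_ge0. Qed.

Lemma plan_massE p : (\int[gamma]_z (cell2 p z)%:E = (plan_mass p)%:E)%E.
Proof.
rewrite /plan_mass fineK// ge0_fin_numE; last first.
  by apply: integral_ge0 => z _; rewrite lee_fin cell2_ge0.
apply: (@le_lt_trans _ _ (\int[gamma]_z (cst 1 z))%E).
  apply: ge0_le_integral => //.
  - by move=> z _; rewrite lee_fin cell2_ge0.
  - by apply/measurable_EFinP; exact: measurable_cell2.
  - by move=> z _; rewrite lee_fin cell2_le1.
by rewrite integral_cst// mul1e (plan_mass1 hrho hgamma) ltry.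
Qed.

Lemma plan_mass_ge0 p : 0 <= plan_mass p.
Proof. by rewrite -lee_fin -plan_massE integral_ge0// => z _; rewrite lee_fin cell2_ge0. Qed.

Let sq_chi k : measurable_fun setT (fun x => (chi k x ^+ 2)%:E).
Proof. by apply/measurable_EFinP; exact: measurable_funX. Qed.

Let sq0 k (x : R3 R) : (0 <= (chi k x ^+ 2)%:E)%E. Proof. by rewrite lee_fin sqr_ge0. Qed.

Lemma cell_mass_fst k : (\int[gamma]_z (chi k z.1 ^+ 2)%:E = (cell_mass chi W k)%:E)%E.
Proof.
rewrite -(cell_massE nchi chi1 mW W0 W1) (integral_marginal_fst hrho hgamma (sq_chi k) (sq0 k)).
by apply: eq_integral => x _; rewrite EFinM.
Qed.

Lemma cell_mass_snd k : (\int[gamma]_z (chi k z.2 ^+ 2)%:E = (cell_mass chi W k)%:E)%E.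
Proof.
rewrite -(cell_massE nchi chi1 mW W0 W1) (integral_marginal_snd hrho hgamma (sq_chi k) (sq0 k)).
by apply: eq_integral => x _; rewrite EFinM.
Qed.

Lemma plan_mass_row k : \sum_l plan_mass (k, l) = cell_mass chi W k.
Proof.
apply: EFin_inj; rewrite -sumEFin -cell_mass_fst.
under eq_bigr do rewrite -plan_massE.
rewrite -ge0_integral_sum//; last 2 first.
- by move=> l; apply/measurable_EFinP; exact: measurable_cell2.
- by move=> l z _; rewrite lee_fin cell2_ge0.
apply: eq_integral => z _; rewrite sumEFin; congr EFin.
by rewrite /cell2 /= -mulr_sumr chi1 mulr1.
Qed.

Lemma plan_mass_col l : \sum_k plan_mass (k, l) = cell_mass chi W l.
Proof.
apply: EFin_inj; rewrite -sumEFin -cell_mass_snd.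
under eq_bigr do rewrite -plan_massE.
rewrite -ge0_integral_sum//; last 2 first.
- by move=> k; apply/measurable_EFinP; exact: measurable_cell2.
- by move=> k z _; rewrite lee_fin cell2_ge0.
apply: eq_integral => z _; rewrite sumEFin; congr EFin.
by rewrite /cell2 /= -mulr_suml chi1 mul1r.
Qed.

Lemma sum_cell_mass : \sum_k cell_mass chi W k = 1.
Proof.
apply: EFin_inj; rewrite -sumEFin.
under eq_bigr do rewrite -cell_mass_fst.
rewrite -ge0_integral_sum//; last first.
  by move=> k; exact: (measurableT_comp (sq_chi k) measurable_fst).
under eq_integral do rewrite sumEFin chi1.
by rewrite integral_cst// mul1e (plan_mass1 hrho hgamma).
Qed.

Lemma sum_cell_mass_le (Q : pred I) (A : set (R3 R)) : measurable A ->
  (forall k, Q k -> forall x, chi k x != 0 -> A x) ->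
  ((\sum_(k | Q k) cell_mass chi W k)%:E <= mass gamma A)%E.
Proof.
move=> mA QA; rewrite -sumEFin.
under eq_bigr do rewrite -cell_mass_fst.
apply: (@sum_partition_le _ _ _ gamma I (fun k z => chi k z.1 ^+ 2)).
- by move=> k; apply/measurable_EFinP; exact: (measurableT_comp (sq_chi k) measurable_fst).
- by move=> k z; exact: sqr_ge0.
- by move=> z; exact: chi1.
- exact: measurable_mass_set.
- by move=> k Qk z; rewrite sqrf_eq0 => /(QA k Qk).
Qed.

Lemma sum_plan_mass_le (Q : pred (I * I)) (A : set (R6 R)) : measurable A ->
  (forall p, Q p -> forall z, cell2 p z != 0 -> A z) ->
  ((\sum_(p | Q p) plan_mass p)%:E <= gamma A)%E.
Proof.
move=> mA QA; rewrite -sumEFin.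
under eq_bigr do rewrite -plan_massE.
apply: (@sum_partition_le _ _ _ gamma (I * I)%type cell2) => //.
- exact: measurable_cell2.
- exact: cell2_ge0.
- exact: sum_cell2.
Qed.

Lemma sum_plan_cost_le (Q : pred (I * I)) (D : I * I -> R) (K : R) :
  0 <= K -> (forall p, 0 <= D p) ->
  (forall p, Q p -> forall z, cell2 p z != 0 ->
    ((D p)%:E <= K%:E * coulomb z.1 z.2)%E) ->
  ((\sum_(p | Q p) plan_mass p * D p)%:E <=
   K%:E * \int[gamma]_z coulomb z.1 z.2)%E.
Proof.
move=> K0 D0 hD.
have X0 z : (0 <= K%:E * coulomb z.1 z.2)%E by rewrite mule_ge0// coulomb_ge0.
have mX : measurable_fun setT (fun z : R6 R => K%:E * coulomb z.1 z.2)%E.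
  by apply: emeasurable_funM => //; exact: measurable_coulomb.
have mc p : measurable_fun setT (fun z => (cell2 p z)%:E).
  by apply/measurable_EFinP; exact: measurable_cell2.
have c0 p z : (0 <= (cell2 p z)%:E)%E by rewrite lee_fin cell2_ge0.
rewrite -ge0_integralZl//; last 2 first.
- exact: measurable_coulomb.
- by move=> z _; exact: coulomb_ge0.
apply: (@le_trans _ _ (\sum_(p | Q p) \int[gamma]_z ((cell2 p z)%:E * (K%:E * coulomb z.1 z.2)))%E).
  rewrite -sumEFin; apply: lee_sum => p Qp.
  rewrite EFinM -plan_massE -ge0_integralZr//; last by rewrite lee_fin.
  apply: ge0_le_integral => //.
  - by move=> z _; rewrite mule_ge0// lee_fin.
  - by apply: emeasurable_funM.
  - by apply: emeasurable_funM.
  move=> z _; have [->|nz] := eqVneq (cell2 p z) 0; first by rewrite !mul0e.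
  by rewrite lee_wpmul2l//; exact: hD.
rewrite -big_filter -ge0_integral_sum//; last 2 first.
- by move=> p; exact: emeasurable_funM.
- by move=> p z _; exact: mule_ge0.
apply: ge0_le_integral => //.
- by move=> z _; apply: sume_ge0 => p _; exact: mule_ge0.
- by apply: emeasurable_sum => p; exact: emeasurable_funM.
move=> z _; rewrite -ge0_sume_distrl// sumEFin -[leRHS]mul1e lee_wpmul2r//.
rewrite lee_fin big_filter -(sum_cell2 z) [leRHS](bigID Q)/= lerDl.
by apply: sumr_ge0 => p _; exact: cell2_ge0.
Qed.

End discretized_plan.

(** Markov's inequality for the Coulomb cost. *)
Lemma near_diagonal_mass (R : realType) (gamma : {measure set (R6 R) -> \bar R})
    (b C : R) : 0 < b ->
  (\int[gamma]_z coulomb z.1 z.2 = C%:E)%E ->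
  (gamma [set z : R6 R | (euclidean_norm (z.1 - z.2) <= b)%R] <= (b * C)%:E)%E.
Proof.
move=> b0 hC; set D := [set z | _].
have mD : measurable D.
  rewrite -[D]setTI; apply: measurable_fun_le => //; exact: measurable_dist.
rewrite EFinM -lee_pdivrMl// -hC.
have -> : gamma D = (\int[gamma]_z (\1_D z)%:E)%E by rewrite integral_indic// setIT.
rewrite -ge0_integralZl//; last 2 first.
- exact/measurable_EFinP.
- by rewrite lee_fin invr_ge0 ltW.
apply: ge0_le_integral => //.
- by move=> z _; rewrite mule_ge0 ?lee_fin// invr_ge0 ltW.
- by apply: emeasurable_funM => //; exact/measurable_EFinP.
- exact: measurable_coulomb.
move=> z _; rewrite indicE; have [|] := boolP (z \in D).
  by rewrite inE mule1 => zD; exact: coulomb_ge.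
by rewrite mule0 coulomb_ge0.
Qed.

Section near_optimal.
Context {R : realType}.
Variables (rho : R3 R -> R) (gamma : {measure set (R6 R) -> \bar R}).
Hypothesis hrho : densities rho.
Hypothesis hgamma : half_marginals rho gamma.
Let W := weight rho.
Let mW : measurable_fun setT W. Proof. exact: measurable_weight hrho. Qed.
Let W0 x : 0 <= W x. Proof. exact: weight_ge0. Qed.
Let W1 : (\int[leb3]_x (W x)%:E = 1)%E. Proof. exact: integral_weight1 hrho. Qed.

(** Scales, from coarse to fine.  Slabs of half-width 3 r carry little mass.  The bad
    pairs may have mass zeta, as after rerouting each costs at most 2 / r.
    At most the mass zeta / 4 lies beyond L in some coordinate; the cells that do not
    lie there have side at most delta.  Two of them are close if their distance is
    below alpha; delta is so small compared with alpha that on the product of two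
    cells that are not close the distance varies at most by the factor 1 + kap. *)
Lemma near_optimal_density (C eta : R) : 0 < eta ->
  (\int[gamma]_z coulomb z.1 z.2 = C%:E)%E ->
  exists (I : finType) (chi : I -> R3 R -> R) (b : I -> I -> R),
  [/\ (forall i, smooth_bounded (chi i)) /\ (forall k l, 0 <= b k l),
      {ae leb3, forall x,
        (\int[leb3]_y (W x * W y * sos2 chi b (x, y))%:E = (W x)%:E)%E},
      {ae leb3, forall y,
        (\int[leb3]_x (W x * W y * sos2 chi b (x, y))%:E = (W y)%:E)%E} &
      (\int[leb6]_p ((W p.1 * W p.2 * sos2 chi b p)%:E * coulomb p.1 p.2) <=
        (C + eta)%:E)%E].
Proof.
move=> eta0 hC.
have C0 : 0 <= C by rewrite -lee_fin -hC integral_ge0// => z _; exact: coulomb_ge0.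
have C1 : 0 < C + 1 by rewrite ltr_wpDl.
have [r3 r30 hr3] : exists2 r, 0 < r & forall t, (mass gamma (slab t r) <= 16^-1%:E)%E.
  by apply: (mass_slab hrho hgamma); rewrite invr_gt0.
pose r := r3 / 3; have r0 : 0 < r by rewrite divr_gt0.
pose zeta := Num.min 8^-1 (r * eta / 4).
have zeta0 : 0 < zeta by rewrite lt_min invr_gt0 ltr0n/= divr_gt0// mulr_gt0.
have zeta8 : zeta <= 8^-1 by rewrite ge_min lexx.
have zetar : zeta <= r * eta / 4 by rewrite ge_min lexx orbT.
have [L0 L00 hL0] : exists2 L, 0 < L & (mass gamma (tail L) <= (Num.min 32^-1 (zeta / 4))%:E)%E.
  by apply: (mass_tail hrho hgamma); rewrite lt_min invr_gt0 ltr0n/= divr_gt0.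
have hL1 : (mass gamma (tail L0) <= 32^-1%:E)%E.
  by apply: (le_trans hL0); rewrite lee_fin ge_min lexx.
have hL2 : (mass gamma (tail L0) <= (zeta / 4)%:E)%E.
  by apply: (le_trans hL0); rewrite lee_fin ge_min lexx orbT.
pose L := L0 + 2 * r.
have Lp : 0 < L by rewrite addr_gt0// mulr_gt0.
pose alpha := zeta / (4 * (C + 1)).
have alpha0 : 0 < alpha by rewrite divr_gt0// mulr_gt0.
pose kap := Num.min 1 (eta / (6 * (C + 1))).
have kap0 : 0 < kap by rewrite lt_min ltr01/= divr_gt0// mulr_gt0.
have kap1 : kap <= 1 by rewrite ge_min lexx.
have kapeta : kap * (6 * (C + 1)) <= eta.
  by rewrite -ler_pdivlMr ?mulr_gt0// ge_min lexx orbT.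
pose delta := Num.min r (alpha * kap / 6).
have delta0 : 0 < delta by rewrite lt_min r0/= divr_gt0// mulr_gt0.
have deltar : delta <= r by rewrite ge_min lexx.
have deltaa : 6 * delta <= kap * alpha.
  have : delta <= alpha * kap / 6 by rewrite ge_min lexx orbT.
  by rewrite ler_pdivlMr// mulrC [kap * _]mulrC.
have d0 : 0 < delta / 2 by rewrite divr_gt0.
have [I [chi [nchi chi1 hpart]]] := partition_of_unity d0 Lp.
have {}hpart i c : (forall x y, chi i x != 0 -> chi i y != 0 ->
       `|coord3 c x - coord3 c y| <= delta) \/
    (forall x, chi i x != 0 -> L <= `|coord3 c x|).
  by have := hpart i c; rewrite mulrCA divff// mulr1.
pose m := cell_mass chi W.
pose G := plan_mass gamma chi.
(* F: cells at distance r in the first coordinate; N: bad pairs, with an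
   unbounded cell or with two close cells *)
pose F : pred (I * I) := fun p => `[< forall x y, chi p.1 x != 0 -> chi p.2 y != 0 ->
  r <= `|coord3 ord0 x - coord3 ord0 y| >].
pose outer k := `[< exists c, forall x, chi k x != 0 -> L <= `|coord3 c x| >].
pose close (p : I * I) := `[< exists x y, [/\ chi p.1 x != 0, chi p.2 y != 0 &
  euclidean_norm (x - y) < alpha] >].
pose N : pred (I * I) := fun p => [|| outer p.1, outer p.2 | close p].
have small k : ~~ outer k -> forall x y c, chi k x != 0 -> chi k y != 0 ->
    `|coord3 c x - coord3 c y| <= delta.
  move=> /asboolPn nk x y c kx ky; have [h|h] := hpart k c; first exact: h.
  by exfalso; apply: nk; exists c.
have Fsym k l : F (k, l) = F (l, k).
  by apply/asboolP/asboolP => /= h x y kx ly; rewrite distrC; exact: h.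
have rowG k : \sum_l G (k, l) = m k by exact: plan_mass_row.
have colG l : \sum_k G (k, l) = m l by exact: plan_mass_col.
have m1 : \sum_k m k = 1 by exact: (sum_cell_mass hrho hgamma).
(* a cell k not at distance r from the cell l lies in a slab around a point
   of l, or in the tail *)
have spread l : \sum_(k | ~~ F (k, l)) m k <= 8^-1.
  have [[y0 ly0]|nl] := pselect (exists y, chi l y != 0); last first.
    rewrite big_pred0 ?invr_ge0// => k; apply/negbTE; rewrite negbK.
    by apply/asboolP => x y /= _ ly; exfalso; apply: nl; exists y.
  rewrite -lee_fin.
  pose A := slab (coord3 ord0 y0) r3 `|` tail L0.
  have mA : measurable A.
    by apply: measurableU; [exact: measurable_slab|exact: measurable_tail].
  apply: (@le_trans _ _ (mass gamma A)); last first.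
    apply: (le_trans (massU _ (measurable_slab _ _) (measurable_tail _))).
    apply: (le_trans (leeD (hr3 _) hL1)).
    by rewrite -EFinD lee_fin; lra.
  apply: (sum_cell_mass_le hrho hgamma) => //.
  move=> k /asboolPn nF x' kx'.
  have [x [y [kx ly xy]]] : exists x y, [/\ chi k x != 0, chi l y != 0 &
      `|coord3 ord0 x - coord3 ord0 y| < r].
    apply: contrapT => no; apply: nF => x y /= kx ly; rewrite leNgt; apply/negP => xy.
    by apply: no; exists x, y.
  have r3E : r3 = 3 * r by rewrite /r; field.
  have [hk|hk] := hpart k ord0; last first.
    by right; exists ord0; have := hk x' kx'; rewrite /L; move: r0; lra.
  have xx' := hk x' x kx' kx.
  have [hl|hl] := hpart l ord0.
    left; rewrite /slab /= r3E; have yy := hl y y0 ly ly0.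
    move: xx' yy xy deltar; rewrite !ler_norml ltr_norml => /andP[? ?] /andP[? ?] /andP[? ?] ?.
    by apply/andP; split; lra.
  right; exists ord0; have Ly := hl y ly.
  have t1 : `|coord3 ord0 y| <= `|coord3 ord0 x'| + `|coord3 ord0 x' - coord3 ord0 y|.
    by rewrite -lerBlDl (le_trans (lerB_dist _ _))// distrC.
  have t2 : `|coord3 ord0 x' - coord3 ord0 y| <= delta + r.
    rewrite (le_trans (ler_distD (coord3 ord0 x) _ _))// lerD// ltW//.
  by move: Ly t1 t2 deltar; rewrite /L; lra.
(* a bad pair of cells lies in a tail or near the diagonal *)
have near_zeta : \sum_(p | N p) G p <= zeta.
  rewrite -lee_fin.
  pose D := [set z : R6 R | euclidean_norm (z.1 - z.2) <= alpha + 6 * delta].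
  have mD : measurable D.
    rewrite -[D]setTI; apply: measurable_fun_le => //; exact: measurable_dist.
  have m1t : measurable (fst @^-1` tail L0 : set (R6 R)).
    by apply: measurable_mass_set; exact: measurable_tail.
  have m2t : measurable (snd @^-1` tail L0 : set (R6 R)).
    have -> : snd @^-1` tail L0 = setT `*` tail L0 :> set (R6 R).
      by apply/seteqP; split=> p //= -[].
    by apply: measurableX => //; exact: measurable_tail.
  pose B : set (R6 R) := ((fst @^-1` tail L0) `|` (snd @^-1` tail L0)) `|` D.
  have mB : measurable B by apply: measurableU => //; exact: measurableU.
  apply: (@le_trans _ _ (gamma B)).
    apply: (sum_plan_mass_le hrho hgamma) => // p Np z /cell2_neq0 [z1 z2].
    have LL : L0 <= L by rewrite lerDl mulr_ge0// ltW.
    have [/asboolP [c hc]|o1] := boolP (outer p.1).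
      by left; left; exists c; exact: le_trans (hc _ z1).
    have [/asboolP [c hc]|o2] := boolP (outer p.2).
      by left; right; exists c; exact: le_trans (hc _ z2).
    right; move: Np; rewrite /N (negbTE o1) (negbTE o2)/= => /asboolP [x [y [px py xy]]].
    have P : forall c, `|coord3 c (z.1 - z.2) - coord3 c (x - y)| <= 2 * delta.
      move=> c; have := small _ o1 z.1 x c z1 px; have := small _ o2 z.2 y c z2 py.
      rewrite !coord3B !ler_norml => /andP[? ?] /andP[? ?].
      by apply/andP; split; lra.
    have dd0 : 0 <= 2 * delta by rewrite mulr_ge0// ltW.
    have := euclidean_norm_perturb dd0 P; rewrite /D /=; move: xy; lra.
  apply: (@le_trans _ _ ((zeta / 4)%:E + (zeta / 4)%:E + ((alpha + 6 * delta) * C)%:E)%E).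
    apply: (le_trans (measureU2 _ _ mD)); first exact: measurableU.
    apply: leeD; last first.
      by apply: near_diagonal_mass hC; rewrite addr_gt0// mulr_gt0.
    apply: (le_trans (measureU2 _ m1t m2t)); apply: leeD => //.
    by have E := mass_sndE hgamma (measurable_tail L0); rewrite -E in hL2; exact: hL2.
  rewrite -!EFinD lee_fin.
  have aC : alpha * (4 * (C + 1)) = zeta by rewrite divfK// gt_eqF// mulr_gt0.
  have kal : kap * alpha <= alpha by rewrite ler_piMl// ltW.
  have : (alpha + 6 * delta) * C <= (2 * alpha) * (C + 1).
    have a2 : alpha + 6 * delta <= 2 * alpha by move: deltaa kal; lra.
    apply: (le_trans (ler_wpM2r C0 a2)).
    by rewrite ler_wpM2l ?lerDl// mulr_ge0// ltW.
  by move: aC; lra.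
have near8 : \sum_(p | N p) G p <= 8^-1 by exact: le_trans zeta8.
have G0 p : 0 <= G p by exact: (plan_mass_ge0 hrho hgamma nchi chi1).
pose a k l := rerouted G N F (k, l).
have a0 k l : 0 <= a k l by exact: (@rerouted_ge0 _ _ G N F m).
have rowa k : \sum_l a k l = m k by exact: rerouted_row.
have cola l : \sum_k a k l = m l by exact: rerouted_col.
(* one point in each cell; D p is the cost between the points of the two cells,
   enlarged so as to bound the cost everywhere on the product of the cells *)
pose pt k := xget 0 [set x | chi k x != 0].
have ptP k x : chi k x != 0 -> chi k (pt k) != 0.
  by move=> kx; rewrite /pt; case: xgetP => [y ->//|/(_ x)/(_ kx)].
pose D (p : I * I) := (1 + kap) / euclidean_norm (pt p.1 - pt p.2).
have k1 : 0 < 1 + kap by rewrite addr_gt0.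
have D0 p : 0 <= D p by rewrite divr_ge0 ?euclidean_norm_ge0// ltW.
have spread_pts p x y x' y' : ~~ N p -> chi p.1 x != 0 -> chi p.2 y != 0 ->
    chi p.1 x' != 0 -> chi p.2 y' != 0 ->
    alpha <= euclidean_norm (x - y) /\
    euclidean_norm (x' - y') <= (1 + kap) * euclidean_norm (x - y).
  rewrite /N negb_or negb_or => /and3P[ o1 o2 nc] px py qx qy.
  move/asboolPn: nc => nc.
  have al : alpha <= euclidean_norm (x - y).
    by rewrite leNgt; apply/negP => xy; apply: nc; exists x, y.
  split=> //.
  have P : forall c, `|coord3 c (x' - y') - coord3 c (x - y)| <= 2 * delta.
    move=> c; have := small _ o1 x' x c qx px; have := small _ o2 y' y c qy py.
    rewrite !coord3B !ler_norml => /andP[? ?] /andP[? ?].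
    by apply/andP; split; lra.
  have dd0 : 0 <= 2 * delta by rewrite mulr_ge0// ltW.
  have := euclidean_norm_perturb dd0 P.
  have : kap * alpha <= kap * euclidean_norm (x - y) by rewrite ler_wpM2l// ltW.
  lra.
have coulD p x y : ~~ N p -> chi p.1 x != 0 -> chi p.2 y != 0 ->
    (coulomb x y <= (D p)%:E)%E.
  move=> Np px py.
  have [ptal _] := spread_pts p _ _ _ _ Np (ptP _ _ px) (ptP _ _ py) px py.
  have [_ h] := spread_pts p _ _ _ _ Np px py (ptP _ _ px) (ptP _ _ py).
  have e0 : 0 < euclidean_norm (pt p.1 - pt p.2) by exact: lt_le_trans ptal.
  rewrite /D -[X in X%:E]invrK invf_div; apply: coulomb_le; first exact: divr_gt0.
  by rewrite ler_pdivrMr// mulrC.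
have Dcoul p : ~~ N p -> forall z, cell2 chi p z != 0 ->
    ((D p)%:E <= ((1 + kap) ^+ 2)%:E * coulomb z.1 z.2)%E.
  move=> Np z /cell2_neq0 [px py].
  have [ptal h] := spread_pts p _ _ _ _ Np (ptP _ _ px) (ptP _ _ py) px py.
  have e0 : 0 < euclidean_norm (pt p.1 - pt p.2) by exact: lt_le_trans ptal.
  have ke0 : 0 < (1 + kap) * euclidean_norm (pt p.1 - pt p.2) by exact: mulr_gt0.
  apply: (@le_trans _ _ (((1 + kap) ^+ 2)%:E *
      (((1 + kap) * euclidean_norm (pt p.1 - pt p.2))^-1)%:E)%E).
    rewrite -EFinM lee_fin /D expr2 invfM mulrACA.
    by rewrite -mulrA mulVKf ?gt_eqF.
  by rewrite lee_wpmul2l ?lee_fin ?exprn_ge0 ?(ltW k1)//; exact: coulomb_ge.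
pose K := r^-1.
have K0 : 0 < K by rewrite invr_gt0.
(* the rerouted plan lives on pairs that are not bad, where D bounds the cost, and
   on pairs at distance r, where K does; rerouting has to be charged K at most,
   and the untouched part D at most, so the minimum is taken on the overlap *)
pose c p := if N p then K else if F p then Num.min K (D p) else D p.
have c0 p : 0 <= c p.
  by rewrite /c; case: ifP => _; [exact: ltW|case: ifP => _ //; rewrite le_min (ltW K0)/=].
have cK p : F p -> c p <= K.
  by rewrite /c => ->; case: ifP => // _; rewrite ge_min lexx.
have cD p : ~~ N p -> c p <= D p.
  by rewrite /c => /negbTE ->; case: ifP => // _; rewrite ge_min lexx orbT.
have coulc k l x y : a k l != 0 -> chi k x != 0 -> chi l y != 0 ->
    (coulomb x y <= (c (k, l))%:E)%E.
  move=> /rerouted_support NF kx ly.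
  have cF : F (k, l) -> (coulomb x y <= K%:E)%E.
    move=> /asboolP /(_ x y kx ly) h; apply: coulomb_le => //.
    by rewrite (le_trans h)// -coord3B coord3_le_norm.
  move: NF; rewrite /c; case: ifPn => [_ /= /cF //|Np _].
  have h := coulD (k, l) x y Np kx ly.
  case: ifP => [/cF hK|//].
  by rewrite EFin_min le_min hK.
exists I, chi, (coef chi W a); split.
- by split=> // k l; exact: coef_ge0.
- exact: density_marginal.
- have aT0 k l : 0 <= a l k by [].
  have := density_marginal nchi chi1 mW W0 W1 (a := fun k l => a l k) aT0 cola rowa.
  apply: filterS => y <-; apply: eq_integral => x _; congr EFin.
  rewrite [W x * W y]mulrC; congr (_ * _).
  rewrite -[(x, y)]/(swap (y, x)) sos2_swap !sos2E.
  apply: eq_bigr => k _; apply: eq_bigr => l _; congr (_ * _ * _).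
  by rewrite /coef [X in _ / X]mulrC.
- apply: (le_trans (density_cost nchi chi1 mW W0 W1 a0 rowa cola
    (c := fun k l => c (k, l)) (fun k l => c0 (k, l)) coulc)).
  rewrite lee_fin.
  have -> : \sum_k \sum_l a k l * c (k, l) = \sum_p rerouted G N F p * c p.
    by rewrite pair_bigA; apply: eq_bigr => -[].
  have H : \sum_p rerouted G N F p * c p <=
      \sum_(p | ~~ N p) G p * c p + 2 * K * \sum_(p | N p) G p.
    by apply: rerouted_cost.
  have H2 : \sum_(p | ~~ N p) G p * c p <= (1 + kap) ^+ 2 * C.
    apply: (@le_trans _ _ (\sum_(p | ~~ N p) G p * D p)).
      by apply: ler_sum => p Np; rewrite ler_wpM2l// cD.
    rewrite -lee_fin EFinM -hC; apply: (sum_plan_cost_le hrho hgamma nchi chi1) => //.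
    by rewrite exprn_ge0// ltW.
  have H3 : 2 * K * \sum_(p | N p) G p <= eta / 2.
    apply: (@le_trans _ _ (2 * K * (r * eta / 4))).
      by rewrite ler_wpM2l ?mulr_ge0 ?(ltW K0)// (le_trans near_zeta).
    by rewrite /K le_eqVlt; apply/orP; left; apply/eqP; field; rewrite gt_eqF.
  (* 2 kap + kap ^ 2 <= 3 kap, and 6 kap (C + 1) <= eta *)
  have H4 : (1 + kap) ^+ 2 * C <= C + eta / 2.
    move: kapeta kap1 C0 kap0; nra.
  by apply: (le_trans H); move: H2 H3 H4; lra.
Qed.

End near_optimal.

(** * Energies of wave functions and the lower bound *)

Section wavefunctions.
Context {R : realType}.
Implicit Types Psi : electron R -> electron R -> R[i].

Lemma normc_sqrE (z : R[i]) :
  ComplexField.Normc.normc z ^+ 2 = complex.Re z ^+ 2 + complex.Im z ^+ 2.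
Proof. by case: z => a b /=; rewrite sqr_sqrtr// addr_ge0 ?sqr_ge0. Qed.

Lemma sum_spin (V : nmodType) (f : 'Z_2 -> V) : \sum_s f s = f 0 + f 1.
Proof.
by rewrite big_ord_recl big_ord1; congr (f _ + f _); exact: val_inj.
Qed.

Lemma integrable_normc_sqrE (f g : R6 R -> R) :
  f \in Lfun leb6 2%:E -> g \in Lfun leb6 2%:E ->
  measurable_fun setT (fun p => f p ^+ 2 + g p ^+ 2) /\
  (\int[leb6]_p (f p ^+ 2 + g p ^+ 2)%:E < +oo)%E.
Proof.
move=> /Lfun2P[mf If] /Lfun2P[mg Ig]; split.
  by apply: measurable_funD; apply: measurable_funX.
under eq_integral do rewrite EFinD.
rewrite ge0_integralD//; first exact: lte_add_pinfty.
- by move=> p _; rewrite lee_fin sqr_ge0.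
- by apply/measurable_EFinP; exact: measurable_funX.
- by move=> p _; rewrite lee_fin sqr_ge0.
- by apply/measurable_EFinP; exact: measurable_funX.
Qed.

(** The chosen representatives of the weak derivatives are square integrable, and
    the kinetic energy depends on the Planck constant only through its prefactor. *)
Lemma kinetic_finite Psi : wavefunctions Psi -> exists2 K : R, 0 <= K &
  forall m hbar, kinetic m hbar Psi = (hbar ^+ 2 / (2 * m) * K)%:E.
Proof.
move=> [_ grad _ _].
pose X := (\sum_(s : 'Z_2) \sum_(t : 'Z_2) \int[leb6]_p
     (\sum_(i < 2) sqnorm_gradient i (spin_component Psi s t) p)%:E)%E.
have g0 s t p : (0 <= (\sum_(i < 2) sqnorm_gradient i (spin_component Psi s t) p)%:E)%E.
  rewrite lee_fin; apply: sumr_ge0 => i _; apply: sumr_ge0 => j _; exact: sqr_ge0.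
have X0 : (0 <= X)%E.
  by apply: sume_ge0 => s _; apply: sume_ge0 => t _; apply: integral_ge0 => p _.
have Xf : (X < +oo)%E.
  apply: lte_sum_pinfty => s _; apply: lte_sum_pinfty => t _.
  pose w i j p := weak_partial (position_dir i j) (@complex.Re R \o spin_component Psi s t) p ^+ 2 +
    weak_partial (position_dir i j) (@complex.Im R \o spin_component Psi s t) p ^+ 2.
  have E p : (\sum_(i < 2) sqnorm_gradient i (spin_component Psi s t) p)%:E =
      (\sum_(i < 2) \sum_(j < 3) (w i j p)%:E)%E.
    rewrite -sumEFin; apply: eq_bigr => i _; rewrite /sqnorm_gradient -sumEFin.
    by apply: eq_bigr => j _; rewrite normc_sqrE.
  under eq_integral do rewrite E.
  have wP i j : measurable_fun setT (w i j) /\ (\int[leb6]_p (w i j p)%:E < +oo)%E.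
    have [h1 h2] := grad s t i j.
    by apply: integrable_normc_sqrE; [exact: (xgetPex (cst 0) h1).1|exact: (xgetPex (cst 0) h2).1].
  have w0 i j p : (0 <= (w i j p)%:E)%E by rewrite lee_fin addr_ge0 ?sqr_ge0.
  have mw i j : measurable_fun setT (fun p => (w i j p)%:E).
    by apply/measurable_EFinP; have [] := wP i j.
  rewrite ge0_integral_sum//; last 2 first.
  - by move=> i; exact: emeasurable_sum.
  - by move=> i p _; exact: sume_ge0.
  apply: lte_sum_pinfty => i _; rewrite ge0_integral_sum//.
  by apply: lte_sum_pinfty => j _; have [] := wP i j.
have Xfin : X \is a fin_num by rewrite ge0_fin_numE.
exists (fine X); first exact: fine_ge0.
by move=> m hbar; rewrite EFinM fineK.
Qed.

Lemma kinetic_ge0 m hbar Psi : 0 < m -> wavefunctions Psi -> (0 <= kinetic m hbar Psi)%E.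
Proof.
move=> m0 /kinetic_finite[K K0 ->].
by rewrite lee_fin mulr_ge0// divr_ge0 ?sqr_ge0// mulr_ge0// ltW.
Qed.

Lemma pair_density_ge0 Psi x y : 0 <= pair_density Psi x y.
Proof. by apply: sumr_ge0 => s _; apply: sumr_ge0 => t _; exact: sqr_ge0. Qed.

Lemma measurable_pair_density Psi : wavefunctions Psi ->
  measurable_fun setT (fun p : R6 R => pair_density Psi p.1 p.2).
Proof.
move=> [L2 _ _ _]; apply: measurable_sum => s; apply: measurable_sum => t.
have [r i] := L2 s t; have [mf _] := integrable_normc_sqrE r i.
by under eq_fun do rewrite normc_sqrE.
Qed.

Lemma pair_density_symmetric Psi : fermionic Psi ->
  {ae leb6, forall p : R6 R, pair_density Psi p.2 p.1 = pair_density Psi p.1 p.2}.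
Proof.
move=> fPsi.
have : {ae leb6, forall p : R6 R, forall s t : 'Z_2,
    Psi (p.2, t) (p.1, s) = - Psi (p.1, s) (p.2, t)}.
  by apply: filter_forall => s; apply: filter_forall => t; exact: fPsi.
apply: filterS => p H; rewrite /pair_density exchange_big /=.
apply: eq_bigr => s _; apply: eq_bigr => t _; rewrite H.
by rewrite !normc_sqrE; case: (Psi _ _) => a b /=; rewrite !sqrrN.
Qed.

End wavefunctions.

Section density_measure.
Context d (T : measurableType d) {R : realType} (lam : {measure set T -> \bar R}).
Variable q : T -> R.
Hypothesis mq : measurable_fun setT q.
Hypothesis q0 : forall x, 0 <= q x.

Lemma exists_density_measure : exists nu : {measure set T -> \bar R},
  forall A, measurable A -> nu A = (\int[lam]_(x in A) (q x)%:E)%E.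
Proof.
pose f (A : set T) := (\int[lam]_(x in A) (q x)%:E)%E.
have f0 : f set0 = 0%E by exact: integral_set0.
have fge0 A : (0 <= f A)%E by apply: integral_ge0 => x _; rewrite lee_fin.
have fadd : semi_sigma_additive f.
  move=> F mF tF mUF; rewrite /f ge0_integral_bigcup//; last 2 first.
  - by apply/measurable_EFinP; exact: measurable_funTS.
  - by move=> x _; rewrite lee_fin.
  by apply: is_cvg_nneseries => n _ _; exact: fge0.
pose mix := isMeasure.Build d T R f f0 fge0 fadd.
pose nu : {measure set T -> \bar R} := HB.pack f mix.
by exists nu.
Qed.

End density_measure.

Section lower_bound.
Context {R : realType}.
Implicit Types Psi : electron R -> electron R -> R[i].

Lemma integral_pair_marginal Psi (rho : R3 R -> R) (A : set (R3 R)) :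
  densities rho -> wavefunctions Psi ->
  {ae leb3, forall x, density Psi x = (rho x)%:E} -> measurable A ->
  (\int[leb6]_(p in fst @^-1` A) (pair_density Psi p.1 p.2)%:E =
   \int[leb3]_(x in A) (2^-1 * rho x)%:E)%E.
Proof.
move=> [mrho _ _ _] wPsi dPsi mA.
have mq := measurable_pair_density wPsi.
have mqA : measurable_fun setT (fun p : R6 R =>
    (\1_A p.1)%:E * (pair_density Psi p.1 p.2)%:E)%E.
  apply: emeasurable_funM; last exact/measurable_EFinP.
  apply/measurable_EFinP; apply: (@measurableT_comp _ _ _ _ _ _ (\1_A : R3 R -> R) _ fst) => //.
have E : (\int[leb6]_(p in fst @^-1` A) (pair_density Psi p.1 p.2)%:E =
    \int[leb6]_p ((\1_A p.1)%:E * (pair_density Psi p.1 p.2)%:E))%E.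
  rewrite integral_mkcond; apply: eq_integral => p _; rewrite patchE indicE.
  have -> : (p \in fst @^-1` A) = (p.1 \in A) by apply/idP/idP; rewrite !inE.
  by case: ifP => _; rewrite ?mul1e ?mul0e.
rewrite E [LHS](fubini_tonelli1 (m1 := leb3) (m2 := leb3))//; last first.
  by move=> p; rewrite mule_ge0// lee_fin// pair_density_ge0.
rewrite [RHS]integral_mkcond /fubini_F /=.
have E2 x : (\int[leb3]_y ((\1_A x)%:E * (pair_density Psi x y)%:E) =
    (\1_A x)%:E * \int[leb3]_y (pair_density Psi x y)%:E)%E.
  rewrite ge0_integralZl//.
  - apply/measurable_EFinP.
    exact: (measurableT_comp mq (measurable_pair1 x)).
  - by move=> y _; rewrite lee_fin pair_density_ge0.
under eq_integral do rewrite E2.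
apply: ae_eq_integral => //.
- have -> : (fun x => (\1_A x)%:E * \int[leb3]_y (pair_density Psi x y)%:E)%E =
      (fun x => fubini_F leb3 (fun p : R6 R => (\1_A p.1)%:E * (pair_density Psi p.1 p.2)%:E)%E x).
    by apply/funext => x; rewrite /fubini_F /= E2.
  apply: measurable_fun_fubini_tonelli_F => // p.
  by rewrite mule_ge0// lee_fin// pair_density_ge0.
- apply/(measurable_restrictT _ _).1 => //.
  by apply/measurable_EFinP; apply: measurable_funTS; exact: measurable_funM.
apply: filterS dPsi => x dx _; rewrite patchE indicE.
have hx : (\int[leb3]_y (pair_density Psi x y)%:E = (2^-1 * rho x)%:E)%E.
  by rewrite EFinM -dx /density muleA -EFinM mulVf// mul1e.
by case: ifP => _; rewrite ?mul0e// mul1e.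
Qed.

(** The measure whose density is the pair density is a plan: its second marginal is
    the first one after exchanging the electrons. *)
Lemma E_OT_le_Vee Psi (rho : R3 R -> R) :
  densities rho -> wavefunctions Psi ->
  {ae leb3, forall x, density Psi x = (rho x)%:E} ->
  (E_OT rho <= Vee (pair_density Psi))%E.
Proof.
move=> hrho wPsi dPsi.
have mq := measurable_pair_density wPsi.
have [nu hnu] := @exists_density_measure _ _ _ leb6 _ mq
  (fun p => pair_density_ge0 Psi p.1 p.2).
have <- : (\int[nu]_p coulomb p.1 p.2)%E = Vee (pair_density Psi).
  rewrite (ge0_integral_density mq _ hnu)//.
  - by apply: eq_integral => p _; rewrite muleC.
  - by move=> p; exact: pair_density_ge0.
  - exact: measurable_coulomb.
  - by move=> p; exact: coulomb_ge0.
apply: ereal_inf_lbound; exists nu => //.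
have mar A : measurable A -> (pushforward nu fst A = \int[leb3]_(x in A) (2^-1 * rho x)%:E)%E.
  move=> mA; rewrite /pushforward hnu; last exact: measurable_mass_set.
  exact: integral_pair_marginal.
split.
  move=> K cK mK; apply: (@le_lt_trans _ _ (nu setT)).
    by apply: le_measure; rewrite ?inE.
  have -> : nu setT = pushforward nu fst setT by rewrite /pushforward preimage_setT.
  by rewrite mar// (integral_weight_half hrho)// (integral_weight1 hrho) ltry.
move=> A mA; split; first exact: mar.
rewrite -mar// /pushforward.
have ms : measurable (snd @^-1` A : set (R6 R)).
  have -> : snd @^-1` A = setT `*` A :> set (R6 R) by apply/seteqP; split=> p //= -[].
  exact: measurableX.
rewrite !hnu//; last exact: measurable_mass_set.
have mA1 : measurable_fun setT (fun p : R6 R => (\1_A p.1)%:E * (pair_density Psi p.1 p.2)%:E)%E.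
  apply: emeasurable_funM; last exact/measurable_EFinP.
  apply/measurable_EFinP; apply: (@measurableT_comp _ _ _ _ _ _ (\1_A : R3 R -> R) _ fst) => //.
have mA2 : measurable_fun setT (fun p : R6 R => (\1_A p.2)%:E * (pair_density Psi p.1 p.2)%:E)%E.
  apply: emeasurable_funM; last exact/measurable_EFinP.
  apply/measurable_EFinP; apply: (@measurableT_comp _ _ _ _ _ _ (\1_A : R3 R -> R) _ snd) => //.
transitivity (\int[leb6]_p ((\1_A p.2)%:E * (pair_density Psi p.1 p.2)%:E))%E.
  rewrite integral_mkcond; apply: eq_integral => p _; rewrite patchE indicE.
  have -> : (p \in snd @^-1` A) = (p.2 \in A) by apply/idP/idP; rewrite !inE.
  by case: ifP => _; rewrite ?mul1e ?mul0e.
transitivity (\int[leb6]_p ((\1_A p.1)%:E * (pair_density Psi p.1 p.2)%:E))%E; last first.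
  rewrite [RHS]integral_mkcond; apply: eq_integral => p _; rewrite patchE indicE.
  have -> : (p \in fst @^-1` A) = (p.1 \in A) by apply/idP/idP; rewrite !inE.
  by case: ifP => _; rewrite ?mul1e ?mul0e.
have := integral_swap leb3 mA2; rewrite -[X in _ = X]/(_) => <-.
apply: ae_eq_integral => //.
- exact: (measurableT_comp mA2 (@measurable_swap _ _ _ _)).
have [_ _ _ fPsi] := wPsi.
by apply: filterS (pair_density_symmetric fPsi) => p hp _ /=; rewrite hp.
Qed.

End lower_bound.

(** * The antisymmetric wave function of a joint density *)

Lemma spinP (s : 'Z_2) : s = 0 \/ s = 1.
Proof. by case: s => [[|[|//]] ?]; [left|right]; exact: val_inj. Qed.

Section antisymmetric_root.
Context {R : realType} {I : finType}.
Variables (rho : R3 R -> R) (chi : I -> R3 R -> R) (b : I -> I -> R).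
Hypothesis hrho : densities rho.
Hypothesis nchi : forall i, smooth_bounded (chi i).
Hypothesis b0 : forall k l, 0 <= b k l.

Definition joint_density (p : R6 R) : R :=
  weight rho p.1 * weight rho p.2 * sos2 chi b p.

Let root (p : R6 R) : R :=
  Num.sqrt (rho p.1) * Num.sqrt (rho p.2) * Num.sqrt (sos2 chi b p).

(* the weights are half of [rho], which gives 1/4, and the joint density is shared
   by two spin components, which gives another 1/2 *)
Let k : R := Num.sqrt 8^-1.

Definition amplitude (s t : 'Z_2) (p : R6 R) : R :=
  if s == t then 0 else if s == 0 then k * root p else - (k * root (swap p)).

Definition antisymmetric_root (z1 z2 : electron R) : R[i] :=
  Complex (amplitude z1.2 z2.2 (z1.1, z2.1)) 0.

Let Psi := antisymmetric_root.

Lemma joint_density_ge0 p : 0 <= joint_density p.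
Proof. by rewrite !mulr_ge0 ?weight_ge0 ?sos2_ge0. Qed.

Lemma measurable_joint_density : measurable_fun setT joint_density.
Proof.
have mW := measurable_weight hrho.
apply: measurable_funM; last exact: measurable_sos2.
by apply: measurable_funM; apply: measurableT_comp.
Qed.

Let sqr_root p : (k * root p) ^+ 2 = joint_density p / 2.
Proof.
rewrite /k !exprMn [X in _ * (_ * X)]sqr_sqrtr ?sos2_ge0//.
rewrite [X in X * (_ * _)]sqr_sqrtr ?invr_ge0//.
by rewrite /joint_density /weight; field.
Qed.

(** All spin components are instances of the same root, the matrix being
    transposed for the exchanged one. *)
Lemma amplitudeE s t : exists (c : R) (b' : I -> I -> R), (forall k l, 0 <= b' k l) /\
  amplitude s t = (fun p => c * (Num.sqrt (rho p.1) * Num.sqrt (rho p.2) *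
                                 Num.sqrt (sos2 chi b' p))).
Proof.
have [->|st] := eqVneq s t.
  by exists 0, b; split=> //; apply/funext => p; rewrite /amplitude eqxx mul0r.
have [s0|s0] := eqVneq s 0.
  by exists k, b; split=> //; apply/funext => p; rewrite /amplitude (negPf st) s0 eqxx.
exists (- k), (fun i j => b j i); split; first by move=> i j; exact: b0.
apply/funext => p; rewrite /amplitude (negPf st) (negPf s0) /root sos2_swap /=.
by ring.
Qed.

Lemma spin_component_antisymmetric_root s t :
  (@complex.Re R \o spin_component Psi s t) = amplitude s t /\
  (@complex.Im R \o spin_component Psi s t) = cst 0.
Proof. by split; apply/funext => -[]. Qed.

Let Lfun2_0 : (cst 0 : R6 R -> R) \in Lfun leb6 2%:E.
Proof.
apply/Lfun2P; split; first exact: measurable_cst.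
by under eq_integral do rewrite /= expr0n/=; rewrite integral0.
Qed.

Lemma inL2_antisymmetric_root s t : inL2 (spin_component Psi s t).
Proof.
have [er ei] := spin_component_antisymmetric_root s t.
rewrite /inL2 er ei; split=> //.
have [c [b' [b'0 ->]]] := amplitudeE s t.
have [_ _ [sL _] _] := hrho.
have h := Lfun2_mulbounded (root_Lfun2 nchi b'0 sL sL) (measurable_cst c) (fun=> lexx `|c|).
by under eq_fun do rewrite mulrC.
Qed.

Lemma has_L2_gradient_antisymmetric_root s t :
  has_L2_gradient (spin_component Psi s t).
Proof.
move=> i j; have [-> ->] := spin_component_antisymmetric_root s t.
have [_ _ sH _] := hrho; split.
  have [c [b' [b'0 ->]]] := amplitudeE s t.
  exact: (weak_partials_root c i j nchi b'0 sH).
have := weak_partials_root 0 i j nchi b0 sH.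
by under eq_fun do rewrite mul0r.
Qed.

Lemma fermionic_antisymmetric_root : fermionic Psi.
Proof.
move=> s t; apply: aeW => p; rewrite /Psi /antisymmetric_root /amplitude /=.
have [->|->] := spinP s; have [->|->] := spinP t; rewrite /=.
- by apply/eqP; rewrite eq_complex /= oppr0 eqxx.
- by apply/eqP; rewrite eq_complex /= oppr0 !eqxx.
- by apply/eqP; rewrite eq_complex /= opprK oppr0 !eqxx.
- by apply/eqP; rewrite eq_complex /= oppr0 eqxx.
Qed.

Lemma sqr_amplitude s t p : ComplexField.Normc.normc (spin_component Psi s t p) ^+ 2 =
  (if s == t then 0 else
  (if s == 0 then joint_density p else joint_density (swap p)) / 2) :> R.
Proof.
rewrite normc_sqrE /= expr0n addr0 /amplitude; case: eqP => _; first by rewrite expr0n.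
by case: eqP => _; rewrite ?sqrrN sqr_root; case: p.
Qed.

Lemma pair_density_antisymmetric_root x y :
  pair_density Psi x y = (joint_density (x, y) + joint_density (y, x)) / 2.
Proof.
have E s t := sqr_amplitude s t (x, y).
rewrite /pair_density !sum_spin.
rewrite [X in X + _ + _](E 0 0) [X in _ + X + _](E 0 1) [X in _ + (X + _)](E 1 0).
rewrite [X in _ + (_ + X)](E 1 1) /=.
by rewrite add0r addr0 -mulrDl.
Qed.

Hypothesis marg_fst : {ae leb3, forall x,
  (\int[leb3]_y (joint_density (x, y))%:E = (weight rho x)%:E)%E}.
Hypothesis marg_snd : {ae leb3, forall y,
  (\int[leb3]_x (joint_density (x, y))%:E = (weight rho y)%:E)%E}.

Let mP : measurable_fun setT (EFin \o joint_density).
Proof. by apply/measurable_EFinP; exact: measurable_joint_density. Qed.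

Let P0 p : (0 <= (joint_density p)%:E)%E.
Proof. by rewrite lee_fin joint_density_ge0. Qed.

Lemma integral_joint_density : (\int[leb6]_p (joint_density p)%:E = 1)%E.
Proof.
rewrite [LHS](fubini_tonelli1 (m1 := leb3) (m2 := leb3))// -[RHS](integral_weight1 hrho).
apply: ae_eq_integral => //.
- exact: measurable_fun_fubini_tonelli_F.
- by apply/measurable_EFinP; exact: measurable_weight hrho.
- by apply: filterS marg_fst => x hx _.
Qed.

Lemma L2norm_antisymmetric_root : L2norm Psi = 1%E.
Proof.
rewrite /L2norm !sum_spin.
have E s t : (\int[leb6]_p (ComplexField.Normc.normc (spin_component Psi s t p) ^+ 2)%:E =
    if s == t then 0 else (2^-1)%:E)%E.
  under eq_integral do rewrite sqr_amplitude.
  case: eqP => _; first by rewrite integral0.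
  under eq_integral do rewrite mulrC EFinM.
  case: eqP => _.
    by rewrite ge0_integralZl// integral_joint_density mule1.
  rewrite ge0_integralZl//; last exact: (measurableT_comp mP (@measurable_swap _ _ _ _)).
  have := integral_swap leb3 mP => /= ->.
  by rewrite integral_joint_density mule1.
rewrite !E /= add0r addr0.
by rewrite -[2^-1 in X in X `^ _]mul1r -splitr powR1.
Qed.

Lemma wavefunctions_antisymmetric_root : wavefunctions Psi.
Proof.
split; [exact: inL2_antisymmetric_root|exact: has_L2_gradient_antisymmetric_root|
  exact: L2norm_antisymmetric_root|exact: fermionic_antisymmetric_root].
Qed.

(** Both marginals of the joint density enter, one for each term of the symmetrization. *)
Lemma density_antisymmetric_root : {ae leb3, forall x, density Psi x = (rho x)%:E}.
Proof.
apply: filterS3 marg_fst marg_snd (weight_ae hrho) => x h1 h2 hw.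
rewrite /density; under eq_integral do rewrite pair_density_antisymmetric_root mulrC EFinM EFinD.
have m1 : measurable_fun setT (fun y => (joint_density (x, y))%:E).
  exact: (measurableT_comp mP (measurable_pair1 x)).
have m2 : measurable_fun setT (fun y => (joint_density (y, x))%:E).
  exact: (measurableT_comp mP (measurable_pair2 x)).
rewrite ge0_integralZl//; last 2 first.
- exact: emeasurable_funD.
- by move=> y _; exact: adde_ge0.
rewrite ge0_integralD// h1 h2 -EFinD -!EFinM hw; congr EFin.
by field.
Qed.

Lemma Vee_antisymmetric_root : Vee (pair_density Psi) =
  (\int[leb6]_p ((joint_density p)%:E * coulomb p.1 p.2))%E.
Proof.
pose h (p : R6 R) : \bar R := ((joint_density p)%:E * coulomb p.1 p.2)%E.
have h0 p : (0 <= h p)%E by rewrite mule_ge0 ?coulomb_ge0.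
have mh : measurable_fun setT h by apply: emeasurable_funM => //; exact: measurable_coulomb.
have mhs : measurable_fun setT (fun p => h (swap p)).
  exact: (measurableT_comp mh (@measurable_swap _ _ _ _)).
have E p : ((pair_density Psi p.1 p.2)%:E * coulomb p.1 p.2 =
    (2^-1)%:E * (h p + h (swap p)))%E.
  rewrite pair_density_antisymmetric_root mulrC EFinM -muleA EFinD ge0_muleDl//.
  by rewrite /h /= [coulomb p.2 p.1]coulombC; case: p.
rewrite /Vee; under eq_integral do rewrite E.
rewrite ge0_integralZl//; last 2 first.
- exact: emeasurable_funD.
- by move=> p _; exact: adde_ge0.
rewrite ge0_integralD// (integral_swap leb3 mh) -/h.
set J := (\int[_]_p h p)%E.
have J0 : (0 <= J)%E by exact: integral_ge0.
rewrite ge0_muleDr// -ge0_muleDl ?lee_fin ?invr_ge0//.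
by rewrite -EFinD -[2^-1]mul1r -splitr mul1e.
Qed.

End antisymmetric_root.

(** * The limit *)

Section semiclassical_limit.
Context {R : realType}.
Implicit Types (rho : R3 R -> R) (m hbar : R).

Lemma E_OT_le_F_HK m hbar rho : 0 < m -> densities rho ->
  (E_OT rho <= F_HK m hbar rho)%E.
Proof.
move=> m0 hrho; apply: le_ereal_inf_tmp => _ [Psi [wPsi dPsi] <-].
apply: le_trans (E_OT_le_Vee hrho wPsi dPsi) _.
by rewrite leeDr// kinetic_ge0.
Qed.

Lemma near_optimal_wavefunction rho (gamma : {measure set (R6 R) -> \bar R})
    (C eta : R) : densities rho -> half_marginals rho gamma -> 0 < eta ->
  (\int[gamma]_z coulomb z.1 z.2 = C%:E)%E ->
  exists Psi, [/\ wavefunctions Psi,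
    {ae leb3, forall x, density Psi x = (rho x)%:E} &
    (Vee (pair_density Psi) <= (C + eta)%:E)%E].
Proof.
move=> hrho hgamma eta0 hC.
have [I [chi [b [[nchi b0] marg1 marg2 cost]]]] :=
  near_optimal_density hrho hgamma eta0 hC.
exists (antisymmetric_root rho chi b); split.
- exact: wavefunctions_antisymmetric_root.
- exact: density_antisymmetric_root.
- by rewrite Vee_antisymmetric_root.
Qed.

Lemma E_OT_ge0 rho : (0 <= E_OT rho)%E.
Proof.
apply: le_ereal_inf_tmp => _ [nu _ <-]; apply: integral_ge0 => p _.
exact: coulomb_ge0.
Qed.

(** The wave function is chosen before the Planck constant: a third of [eps] is
    spent on the plan, a third on the wave function, and a third on the kinetic energy. *)
Lemma F_HK_le_near m rho (E eps : R) : 0 < m -> densities rho -> E_OT rho = E%:E ->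
  0 < eps -> \forall hbar \near 0^'+, (F_HK m hbar rho <= (E + eps)%:E)%E.
Proof.
move=> m0 hrho hE eps0.
have e3 : 0 < eps / 3 by rewrite divr_gt0.
have Efin : E_OT rho \is a fin_num by rewrite hE.
have [_ [gamma [_ hgamma] <-] cost] := lb_ereal_inf_adherent e3 Efin.
rewrite -/(E_OT rho) hE -EFinD in cost.
have cost0 : (0 <= \int[gamma]_p coulomb p.1 p.2)%E.
  by apply: integral_ge0 => p _; exact: coulomb_ge0.
have cfin : (\int[gamma]_p coulomb p.1 p.2)%E \is a fin_num.
  by rewrite ge0_fin_numE// (lt_trans cost)// ltry.
have [Psi [wPsi dPsi VPsi]] :=
  near_optimal_wavefunction hrho hgamma e3 (esym (fineK cfin)).
have [K K0 kin] := kinetic_finite wPsi.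
have : (fun hbar : R => hbar ^+ 2 / (2 * m) * K) @ 0^'+ --> (0 : R).
  apply: cvg_at_right_filter.
  rewrite [X in _ --> X](_ : 0 = 0 ^+ 2 / (2 * m) * K :> R); last by rewrite expr0n !mul0r.
  apply: cvgMr_tmp; apply: cvgMr_tmp; exact: exprn_continuous.
move=> /cvgrPdist_le /(_ _ e3); apply: filterS => hbar; rewrite sub0r normrN => hk.
apply: le_trans (_ : (kinetic m hbar Psi + Vee (pair_density Psi) <= _)%E).
  by apply: ereal_inf_lbound; exists Psi.
have -> : E + eps = eps / 3 + (E + eps / 3 + eps / 3) by field.
rewrite EFinD; apply: leeD.
  by rewrite kin lee_fin (le_trans (ler_norm _) hk).
by apply: le_trans VPsi _; rewrite lee_fin lerD2r -lee_fin fineK// ltW.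
Qed.

End semiclassical_limit.

Theorem theorem5p2 (R : realType) (m : R) (hm : 0 < m)
    (rho : R3 R -> R) (hrho : densities rho) :
  F_HK m hbar rho @[hbar --> 0^'+] --> E_OT rho.
Proof.
have lower hbar := @E_OT_le_F_HK R m hbar rho hm hrho.
case hE : (E_OT rho) (E_OT_ge0 rho) => [E| |]// _; last first.
  apply: cvg_near_cst; apply: nearW => hbar.
  by apply/eqP; rewrite -leye_eq -hE lower.
apply/fine_cvgP.
have near_fin : \forall hbar \near 0^'+, F_HK m hbar rho \is a fin_num.
  have := F_HK_le_near hm hrho hE ltr01; apply: filterS => hbar h.
  rewrite fin_real// (lt_le_trans (ltNyr E)) -?hE ?lower//=.
  exact: le_lt_trans h (ltry _).
split=> //; apply/cvgrPdist_le => eps eps0.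
near=> hbar.
have hfin : F_HK m hbar rho \is a fin_num by near: hbar.
have hup : (F_HK m hbar rho <= (E + eps)%:E)%E.
  by near: hbar; exact: F_HK_le_near.
have := lower hbar; rewrite hE; move: hup; rewrite -(fineK hfin) !lee_fin => h1 h2.
rewrite /= distrC ger0_norm ?subr_ge0//.
by rewrite lerBlDl.
Unshelve. all: by end_near.
Qed.
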